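(* Let $(M,\nabla)$ be a flat manifold and $T_\nabla M$ the associated left-symmetric algebroid. Then the exact pre-symplectic algebroids with respect to $T_\nabla M$ are classified by the third cohomology group $\tilde H^3(T_\nabla M)$. That is: for an exact pre-symplectic algebroid $(E,\star,\rho,(\cdot,\cdot)_-)$ with respect to $T_\nabla M$ and an isotropic splitting $\sigma:TM\to E$ of $\rho$, the class $[\tilde\phi]\in\tilde H^3(T_\nabla M)$ of the cochain $\tilde\phi$ determined by $$\tilde\phi(x,y,z)=\langle\phi(x,z),y\rangle,\qquad \rho^*\phi(x,y)=\sigma(x)\star\sigma(y)-\sigma(\nabla_xy),$$ for vector fields $x,y,z$ on $M$, is well defined and independent of $\sigma$, and $E\mapsto[\tilde\phi]$ induces a bijection from the set of isomorphism classes of exact pre-symplectic algebroids with respect to $T_\nabla M$ onto $\tilde H^3(T_\nabla M)$.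
   Context: All vector bundles are real, of finite rank, over the smooth manifold $M$; bundle maps cover the identity of $M$. A flat manifold $(M,\nabla)$ is a smooth manifold with a flat torsion free connection $\nabla$ on $TM$. A pre-symplectic algebroid $(E,\star,\rho,(\cdot,\cdot)_-)$ is a vector bundle $E\to M$ equipped with a nondegenerate skew-symmetric ($C^\infty(M)$-)bilinear form $(\cdot,\cdot)_-$, an ($\mathbb R$-bilinear) multiplication $\star:\Gamma(E)\times\Gamma(E)\to\Gamma(E)$ and a bundle map $\rho:E\to TM$ such that for all $e_1,e_2,e_3\in\Gamma(E)$: (i) $(e_1,e_2,e_3)-(e_2,e_1,e_3)=\frac16 D\,T(e_1,e_2,e_3)$; (ii) $\rho(e_1)(e_2,e_3)_-=(e_1\star e_2-\frac12D(e_1,e_2)_-,\,e_3)_-+(e_2,[e_1,e_3]_E)_-$. Here $(e_1,e_2,e_3)=e_1\star(e_2\star e_3)-(e_1\star e_2)\star e_3$; $T(e_1,e_2,e_3)=(e_1\star e_2,e_3)_-+(e_1,e_2\star e_3)_--(e_2\star e_1,e_3)_--(e_2,e_1\star e_3)_-\in C^\infty(M)$; $D:C^\infty(M)\to\Gamma(E)$ is defined by $(Df,e)_-=\rho(e)(f)$; and $[e_1,e_2]_E=e_1\star e_2-e_2\star e_1$. It is exact with respect to $T_\nabla M$ if $0\to T^*M\xrightarrow{\rho^*}E\xrightarrow{\rho}TM\to0$ is an exact sequence of vector bundles, where $(\rho^*(\xi),e)_-=\langle\xi,\rho(e)\rangle$ for $\xi\in\Omega^1(M)$, $e\in\Gamma(E)$,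 and $\rho(e_1\star e_2)=\nabla_{\rho(e_1)}\rho(e_2)$ for all $e_1,e_2\in\Gamma(E)$. An isotropic splitting is a bundle map $\sigma:TM\to E$ with $\rho\circ\sigma=\mathrm{id}$ and $(\sigma(x),\sigma(y))_-=0$ for all $x,y$. An isomorphism of exact pre-symplectic algebroids with respect to $T_\nabla M$ is a vector bundle isomorphism over $\mathrm{id}_M$ intertwining the multiplications, the maps $\rho$ and the skew-symmetric forms. A left-symmetric algebroid $(A,\cdot_A,a_A)$ is a vector bundle $A\to M$ with an $\mathbb R$-bilinear product $\cdot_A$ on $\Gamma(A)$ whose associator $x\cdot_A(y\cdot_Az)-(x\cdot_Ay)\cdot_Az$ is symmetric in $x,y$, and a bundle map $a_A:A\to TM$ with $x\cdot_A(fy)=f(x\cdot_Ay)+a_A(x)(f)y$ and $(fx)\cdot_Ay=f(x\cdot_Ay)$. Put $[x,y]_A=x\cdot_Ay-y\cdot_Ax$. $T_\nabla M$ denotes $(TM,\nabla,\mathrm{id})$, i.e. $x\cdot y=\nabla_xy$. Cochains: $C^{n+1}(A)=\Gamma(\wedge^nA^*\otimes A^* )$, $n\ge0$, with coboundary $\delta:C^n(A)\to C^{n+1}(A)$, $$\delta\varphi(x_1,\dots,x_{n+1})=\sum_{i=1}^n(-1)^{i+1}a_A(x_i)\varphi(x_1,\dots,\hat{x_i},\dots,x_{n+1})-\sum_{i=1}^n(-1)^{i+1}\varphi(x_1,\dots,\hat{x_i},\dots,x_n,x_i\cdot_Ax_{n+1})+\sum_{1\le i<j\le n}(-1)^{i+j}\varphi([x_i,x_j]_A,x_1,\dots,\hat{x_i},\dots,\hat{x_j},\dots,x_{n+1}).$$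 $\tilde H^n(A)$ is the $n$-th cohomology of the subcomplex $(\tilde C^\bullet(A),\delta)$ with $\tilde C^1(A)=\{\varphi\in C^1(A):\varphi([x,y]_A)=a_A(x)\varphi(y)-a_A(y)\varphi(x)\}$, $\tilde C^2(A)=\{\varphi\in C^2(A):\varphi(x,y)=\varphi(y,x)\}$, $\tilde C^3(A)=\{\varphi\in C^3(A):\varphi(x,y,z)+\varphi(y,z,x)+\varphi(z,x,y)=0\}$, $\tilde C^n(A)=C^n(A)$ for $n\ge4$. *)

(* Defs.v *)
(* Smooth manifolds, vector bundles and (exact) pre-symplectic algebroids over
   the real numbers R : realType, on top of MathComp-Analysis. *)
From HB Require Import structures.
From mathcomp Require Import all_boot all_order all_algebra perm.
From mathcomp Require Import all_classical all_reals topology normedtype derive.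

Set Implicit Arguments.
Unset Strict Implicit.
Unset Printing Implicit Defensive.
Import Order.TTheory GRing.Theory Num.Theory numFieldNormedType.Exports.
Local Open Scope classical_set_scope.
Local Open Scope ring_scope.

Section Calculus.
Context {R : realType} {n : nat}.
Implicit Types (U : set 'rV[R]_n) (f g : 'rV[R]_n -> R).

Definition partial (i : 'I_n) f : 'rV[R]_n -> R :=
  fun x => 'D_(delta_mx 0 i : 'rV[R]_n) f x.

Fixpoint Ck (k : nat) U f : Prop :=
  (forall x, U x -> {for x, continuous f}) /\
  if k is k'.+1 then
    forall i : 'I_n, (forall x, U x -> derivable f x (delta_mx 0 i : 'rV[R]_n))
                     /\ Ck k' U (partial i f)
  else True.

Definition Cinfty U f : Prop := forall k, Ck k U f.

Lemma Ck_cont k U f x : Ck k U f -> U x -> {for x, continuous f}.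
Proof. by case: k => [|k] [cf _]; apply: cf. Qed.

Lemma Ck_le k U f : Ck k.+1 U f -> Ck k U f.
Proof.
elim: k f => [|k IH] f [cf df]; first by split.
by split=> // i; have [? ?] := df i; split=> //; apply: IH.
Qed.

Lemma Ck_eq k U f g : open U -> (forall x, U x -> f x = g x) ->
  Ck k U f -> Ck k U g.
Proof.
move=> oU.
have near_eq f' g' x : (forall y, U y -> f' y = g' y) -> U x ->
    \forall y \near x, f' y = g' y.
  move=> fg Ux; have nU : nbhs x U by apply: open_nbhs_nbhs.
  by apply: filterS nU => y /fg.
have cont_eq f' g' x : (forall y, U y -> f' y = g' y) -> U x ->
    {for x, continuous f'} -> {for x, continuous g'}.
  move=> fg Ux cf; rewrite /prop_for /continuous_at -(fg _ Ux).
  exact: cvg_trans (near_eq_cvg (near_eq _ _ _ fg Ux)) cf.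
elim: k f g => [|k IH] f g fg [cf df].
  by split=> // x Ux; exact: cont_eq fg Ux (cf x Ux).
split=> [x Ux|i]; first exact: cont_eq fg Ux (cf x Ux).
have [dfi cki] := df i; split=> [x Ux|].
  exact: near_eq_derivable (near_eq _ _ _ fg Ux) (dfi _ Ux).
by apply: IH cki => x Ux; exact: near_eq_derive (near_eq _ _ _ fg Ux).
Qed.

Lemma Ck_sub k U V f : V `<=` U -> Ck k U f -> Ck k V f.
Proof.
move=> VU; elim: k f => [|k IH] f [cf df]; split=> //.
- by move=> x /VU/cf.
- by move=> x /VU/cf.
- by move=> i; have [dfi cki] := df i; split; [move=> x /VU/dfi|apply: IH].
Qed.

Lemma Ck_cst k U a : Ck k U (fun=> a).
Proof.
elim: k a => [|k IH] a; (split=> [x _|]; first exact: cst_continuous) => //.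
move=> i; split=> [x _|]; first exact: derivable_cst.
rewrite (_ : partial i _ = fun=> 0) //.
by apply/funext => x; rewrite /partial derive_cst.
Qed.

Lemma CkD k U f g : open U -> Ck k U f -> Ck k U g -> Ck k U (f + g).
Proof.
move=> oU; elim: k f g => [|k IH] f g [cf df] [cg dg].
  by split=> // x Ux; apply: continuousD; [apply: cf|apply: cg].
split=> [x Ux|i]; first by apply: continuousD; [apply: cf|apply: cg].
have [dfi cfi] := df i; have [dgi cgi] := dg i; split=> [x Ux|].
  by apply: derivableD; [apply: dfi|apply: dgi].
apply: Ck_eq (IH _ _ cfi cgi) => // x Ux.
by rewrite /partial deriveD //; [apply: dfi|apply: dgi].
Qed.

Lemma CkM k U f g : open U -> Ck k U f -> Ck k U g -> Ck k U (f * g).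
Proof.
move=> oU; elim: k f g => [|k IH] f g ckf ckg.
  by split=> // x Ux; apply: continuousM; apply: Ck_cont Ux; [exact: ckf|exact: ckg].
split=> [x Ux|i].
  by apply: continuousM; apply: Ck_cont Ux; [exact: ckf|exact: ckg].
have [dfi cfi] := ckf.2 i; have [dgi cgi] := ckg.2 i; split=> [x Ux|].
  by apply: derivableM; [apply: dfi|apply: dgi].
apply: (@Ck_eq _ _ (f * partial i g + g * partial i f)) => // [x Ux|].
  by rewrite /partial deriveM //; [apply: dfi|apply: dgi].
by apply: CkD => //; apply: IH => //; apply: Ck_le.
Qed.

End Calculus.

Record chart (R : realType) (T : topologicalType) (n : nat) := Chart {
  cdom : set T;
  cfun :> T -> 'rV[R]_n;
  cinv : 'rV[R]_n -> T;
  cdom_open : open cdom;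
  cimg_open : open (cfun @` cdom);
  cfunK : forall p, cdom p -> cinv (cfun p) = p;
  cfun_continuous : forall p, cdom p -> {for p, continuous cfun};
  cinv_continuous : forall x, (cfun @` cdom) x -> {for x, continuous cinv} }.

Record manifold (R : realType) (n : nat) := Manifold {
  msort :> topologicalType;
  m_hausdorff : hausdorff_space msort;
  m_second_countable : @second_countable msort;
  atlas : set (chart R msort n);
  atlas_cover : forall p, exists c, atlas c /\ cdom c p;
  atlas_compat : forall c d, atlas c -> atlas d -> forall i : 'I_n,
    Cinfty (c @` (cdom c `&` cdom d)) (fun x => d (cinv c x) 0 i) }.

Section SmoothFunctions.
Context {R : realType} {n : nat} (M : manifold R n).

Definition smooth_on (U : set M) (g : M -> R) : Prop :=
  forall c, atlas c -> Cinfty (c @` (U `&` cdom c)) (g \o cinv c).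

Definition smooth (g : M -> R) : Prop := smooth_on setT g.

Lemma chart_image_open (c : chart R M n) (U : set M) :
  open U -> open (c @` (U `&` cdom c)).
Proof.
move=> oU; rewrite openE => _ [p [Up cp] <-].
have cpi : (c @` cdom c) (c p) by exists p.
have nU : nbhs (c p) (cinv c @^-1` U).
  apply: (cinv_continuous cpi); rewrite cfunK //; exact: open_nbhs_nbhs.
have nI : nbhs (c p) (c @` cdom c).
  by apply: open_nbhs_nbhs; split=> //; apply: cimg_open.
apply: filterS (filterI nU nI) => x [Ux [q cq qx]]; exists q => //.
by split=> //; move: Ux; rewrite -qx /= cfunK.
Qed.

Lemma smooth_on_cst U a : smooth_on U (fun=> a).
Proof. by move=> c _ k; apply: Ck_cst. Qed.

Lemma smooth_onD U f g : open U ->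
  smooth_on U f -> smooth_on U g -> smooth_on U (f + g).
Proof.
by move=> oU sf sg c Ac k; apply: CkD; [apply: chart_image_open|apply: sf|apply: sg].
Qed.

Lemma smooth_onM U f g : open U ->
  smooth_on U f -> smooth_on U g -> smooth_on U (f * g).
Proof.
by move=> oU sf sg c Ac k; apply: CkM; [apply: chart_image_open|apply: sf|apply: sg].
Qed.

Lemma smooth_on_sub (U V : set M) g : V `<=` U -> smooth_on U g -> smooth_on V g.
Proof.
move=> VU sg c Ac k; apply: Ck_sub (sg c Ac k).
by move=> _ [p [Vp cp] <-]; exists p => //; split=> //; apply: VU.
Qed.

Definition smooth_pred : {pred M -> R} := fun g => `[< smooth g >].

Lemma smooth_subring : subring_closed smooth_pred.
Proof.
have sM f g : smooth f -> smooth g -> smooth (f * g).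
  by apply: smooth_onM; apply: openT.
split=> [|f g /asboolP sf /asboolP sg|f g /asboolP sf /asboolP sg]; apply/asboolP.
- exact: smooth_on_cst.
- have -> : f - g = f + (fun=> -1) * g.
    by apply/funext => p; rewrite !fctE mulN1r.
  apply: smooth_onD => //; first exact: openT.
  by apply: sM => //; apply: smooth_on_cst.
- exact: sM.
Qed.

HB.instance Definition _ :=
  GRing.isSubringClosed.Build (M -> R) smooth_pred smooth_subring.

Record cinf := Cinf { cinf_val :> M -> R; _ : cinf_val \in smooth_pred }.

HB.instance Definition _ := [isSub for cinf_val].
HB.instance Definition _ := [Choice of cinf by <:].
HB.instance Definition _ := GRing.SubChoice_isSubComPzRing.Build (M -> R)
  smooth_pred cinf smooth_subring.

Lemma cinf_smooth (f : cinf) : smooth f.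
Proof. by case: f => f /= /asboolP. Qed.

Definition mk_cinf (g : M -> R) (sg : smooth g) : cinf := Cinf (asboolT sg).

Definition cstC (a : R) : cinf := mk_cinf (smooth_on_cst setT a).

(* A family of vector spaces over M with a C^oo(M)-module of sections, called
   smooth. Vector bundles are the locally trivial ones (see is_vbundle). *)
Record vfamily := VFamily {
  fib :> M -> lmodType R;
  is_section : (forall p, fib p) -> Prop;
  is_section0 : is_section (fun=> 0);
  is_sectionP : forall (f : cinf) s t, is_section s -> is_section t ->
    is_section (fun p => f p *: s p + t p) }.

Record section (V : vfamily) := Section_ {
  section_val :> forall p, V p;
  sectionP : is_section section_val }.

Lemma section_eq (V : vfamily) (s t : section V) : (forall p, s p = t p) -> s = t.
Proof.
case: s t => [s ps] [t pt] /= st.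
have e : s = t by apply: functional_extensionality_dep.
by subst t; congr Section_; apply: Prop_irrelevance.
Qed.

Section SectionModule.
Variable V : vfamily.
Implicit Types (f g : cinf) (s t u : section V).

HB.instance Definition _ := gen_eqMixin (section V).
HB.instance Definition _ := gen_choiceMixin (section V).

Definition sec_lin f s t : section V := Section_ (is_sectionP f (sectionP s) (sectionP t)).
Definition sec0 : section V := Section_ (is_section0 V).
Definition sec_add s t := sec_lin 1 s t.
Definition sec_opp s := sec_lin (-1) s sec0.
Definition sec_scale f s := sec_lin f s sec0.

Lemma sec_addE s t p : sec_add s t p = s p + t p.
Proof. by rewrite /= scale1r. Qed.
Lemma sec_oppE s p : sec_opp s p = - s p.
Proof. by rewrite /= addr0 scaleN1r. Qed.
Lemma sec_scaleE f s p : sec_scale f s p = f p *: s p.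
Proof. by rewrite /= addr0. Qed.

Fact sec_addA : associative sec_add.
Proof. by move=> s t u; apply: section_eq => p; rewrite !sec_addE addrA. Qed.
Fact sec_addC : commutative sec_add.
Proof. by move=> s t; apply: section_eq => p; rewrite !sec_addE addrC. Qed.
Fact sec_add0 : left_id sec0 sec_add.
Proof. by move=> s; apply: section_eq => p; rewrite sec_addE add0r. Qed.
Fact sec_addN : left_inverse sec0 sec_opp sec_add.
Proof. by move=> s; apply: section_eq => p; rewrite sec_addE sec_oppE addNr. Qed.

HB.instance Definition _ :=
  GRing.isZmodule.Build (section V) sec_addA sec_addC sec_add0 sec_addN.

Fact sec_scaleA f g s : sec_scale f (sec_scale g s) = sec_scale (f * g) s.
Proof. by apply: section_eq => p; rewrite !sec_scaleE scalerA. Qed.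
Fact sec_scale1 : left_id 1 sec_scale.
Proof. by move=> s; apply: section_eq => p; rewrite sec_scaleE scale1r. Qed.
Fact sec_scaleDr : right_distributive sec_scale +%R.
Proof.
move=> f s t; apply: section_eq => p.
by rewrite sec_scaleE !sec_addE !sec_scaleE scalerDr.
Qed.
Fact sec_scaleDl s : {morph sec_scale^~ s : f g / f + g}.
Proof.
move=> f g; apply: section_eq => p.
by rewrite sec_scaleE !sec_addE !sec_scaleE scalerDl.
Qed.

HB.instance Definition _ := GRing.Zmodule_isLmodule.Build cinf (section V)
  sec_scaleA sec_scale1 sec_scaleDr sec_scaleDl.

End SectionModule.

Record frame (V : M -> lmodType R) := Frame {
  fdom : set M;
  frank : nat;
  fvec : 'I_frank -> forall p, V p }.

Arguments fvec {V} F i p : rename.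

Definition smooth_comb (V : M -> lmodType R) (U : set M) (F : frame V)
    (s : forall p, V p) : Prop :=
  exists a : 'I_(frank F) -> M -> R, (forall i, smooth_on U (a i)) /\
    forall p, U p -> s p = \sum_i a i p *: fvec F i p.

(* Local trivializations of a smooth vector bundle with fibres V p: a cover of
   M by open sets carrying frames which are related by smooth transition
   functions. *)
Definition trivializing (V : M -> lmodType R) (A : set (frame V)) : Prop :=
  [/\ forall F, A F -> open (fdom F),
      forall p, exists F, A F /\ fdom F p,
      forall F, A F -> forall p, fdom F p -> forall v : V p,
        exists! a : 'rV[R]_(frank F), v = \sum_i a 0 i *: fvec F i p &
      forall F G, A F -> A G -> forall i,
        smooth_comb (fdom F `&` fdom G) G (fvec F i)].

Definition is_vbundle (V : vfamily) : Prop :=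
  exists A : set (frame V), trivializing A /\
    forall s, is_section s <-> forall F, A F -> smooth_comb (fdom F) F s.

(* A smooth bundle map over the identity: fibrewise linear, and mapping smooth
   sections to smooth sections. *)
Record bundle_map (V W : vfamily) := BundleMap {
  bmap :> forall p, {linear V p -> W p};
  bmap_smooth : forall s : section V, is_section (fun p => bmap p (s p)) }.

Definition push (V W : vfamily) (F : bundle_map V W) (s : section V) : section W :=
  Section_ (bmap_smooth F s).

Definition chart_at (p : M) : chart R M n := sval (cid (atlas_cover p)).

(* A tangent vector at p is given by its coordinates in the chart chart_at p;
   tder p v is the associated derivation of C^oo(M) at p. *)
Definition tder (p : M) (v : 'rV[R]_n) (f : cinf) : R :=
  \sum_(i < n) v 0 i * partial i (f \o cinv (chart_at p)) (chart_at p p).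

Lemma tderP p a v w f : tder p (a *: v + w) f = a * tder p v f + tder p w f.
Proof.
rewrite /tder mulr_sumr -big_split /=; apply: eq_bigr => i _.
by rewrite !mxE mulrDl mulrA.
Qed.

Definition is_vfield (x : M -> 'rV[R]_n) : Prop :=
  forall f : cinf, smooth (fun p => tder p (x p) f).

Fact is_vfield0 : is_vfield (fun=> 0).
Proof.
move=> f; rewrite (_ : (fun _ => _) = fun=> 0); first exact: smooth_on_cst.
by apply/funext => p; rewrite /tder big1 // => i _; rewrite mxE mul0r.
Qed.

Fact is_vfieldP (f : cinf) x y : is_vfield x -> is_vfield y ->
  is_vfield (fun p => f p *: x p + y p).
Proof.
move=> hx hy g; rewrite (_ : (fun _ => _) =
  (f : M -> R) * (fun p => tder p (x p) g) + (fun p => tder p (y p) g)).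
  apply: smooth_onD; [exact: openT| |exact: hy].
  by apply: smooth_onM; [exact: openT|exact: cinf_smooth|exact: hx].
by apply/funext => p; rewrite tderP.
Qed.

Definition tangent : vfamily :=
  @VFamily (fun=> 'rV[R]_n : lmodType R) is_vfield is_vfield0 is_vfieldP.

Definition vfield := section tangent.

Definition lie (x : vfield) (f : cinf) : cinf := mk_cinf (sectionP x f).

Definition covector : lmodType R := 'Hom('rV[R]_n, R^o).

Definition is_oneform (xi : M -> covector) : Prop :=
  forall x : vfield, smooth (fun p => xi p (x p)).

Fact is_oneform0 : is_oneform (fun=> 0).
Proof.
move=> x; rewrite (_ : (fun _ => _) = fun=> 0); first exact: smooth_on_cst.
by apply/funext => p; rewrite lfunE.
Qed.

Fact is_oneformP (f : cinf) xi eta : is_oneform xi -> is_oneform eta ->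
  is_oneform (fun p => f p *: xi p + eta p).
Proof.
move=> hx hy x; rewrite (_ : (fun _ => _) =
  (f : M -> R) * (fun p => xi p (x p)) + (fun p => eta p (x p))).
  apply: smooth_onD; [exact: openT| |exact: hy].
  by apply: smooth_onM; [exact: openT|exact: cinf_smooth|exact: hx].
by apply/funext => p; rewrite !lfunE /= lfunE.
Qed.

Definition cotangent : vfamily :=
  @VFamily (fun=> covector) is_oneform is_oneform0 is_oneformP.

Definition oneform := section cotangent.

Definition is_lie_bracket (x y w : vfield) : Prop :=
  forall f : cinf, lie w f = lie x (lie y f) - lie y (lie x f).

Record flat_connection := FlatConnection {
  nabla :> vfield -> vfield -> vfield;
  nabla_linear : forall (f : cinf) x x' y,
    nabla (f *: x + x') y = f *: nabla x y + nabla x' y;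
  nablaD : forall x y y', nabla x (y + y') = nabla x y + nabla x y';
  nabla_leibniz : forall x (f : cinf) y,
    nabla x (f *: y) = f *: nabla x y + lie x f *: y;
  nabla_torsion_free : forall x y, is_lie_bracket x y (nabla x y - nabla y x);
  nabla_flat : forall x y w z, is_lie_bracket x y w ->
    nabla x (nabla y z) - nabla y (nabla x z) - nabla w z = 0 }.

(* A left-symmetric algebroid. Local triviality of A is not part of the record,
   as only the module of sections matters below. Compatibility with real scalars
   follows from lsa_scalel and lsa_leibniz, derivations vanishing on constants. *)
Record lsa := Lsa {
  lsa_family :> vfamily;
  lsa_mul : section lsa_family -> section lsa_family -> section lsa_family;
  lsa_anchor : bundle_map lsa_family tangent;
  lsa_mulDl : forall x x' y, lsa_mul (x + x') y = lsa_mul x y + lsa_mul x' y;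
  lsa_mulDr : forall x y y', lsa_mul x (y + y') = lsa_mul x y + lsa_mul x y';
  lsa_assoc : forall x y z,
    lsa_mul x (lsa_mul y z) - lsa_mul (lsa_mul x y) z =
    lsa_mul y (lsa_mul x z) - lsa_mul (lsa_mul y x) z;
  lsa_leibniz : forall x (f : cinf) y,
    lsa_mul x (f *: y) = f *: lsa_mul x y + lie (push lsa_anchor x) f *: y;
  lsa_scalel : forall (f : cinf) x y, lsa_mul (f *: x) y = f *: lsa_mul x y }.

Section TangentLsa.
Variable nabla : flat_connection.

Fact is_section_id (x : vfield) :
  is_section (v := tangent) (fun p => (idfun : {linear 'rV[R]_n -> 'rV[R]_n}) (x p)).
Proof. exact: sectionP x. Qed.

Definition id_tangent : bundle_map tangent tangent :=
  BundleMap (bmap := fun p => idfun : {linear tangent p -> tangent p}) is_section_id.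

Fact nablaDl x x' y : nabla (x + x') y = nabla x y + nabla x' y.
Proof. by have := nabla_linear nabla 1 x x' y; rewrite !scale1r. Qed.

Fact nabla0l y : nabla 0 y = 0.
Proof. by apply: (addrI (nabla 0 y)); rewrite -nablaDl !addr0. Qed.

Fact nablaZl (f : cinf) x y : nabla (f *: x) y = f *: nabla x y.
Proof. by have := nabla_linear nabla f x 0 y; rewrite nabla0l !addr0. Qed.

Fact nabla_assoc x y z :
  nabla x (nabla y z) - nabla (nabla x y) z = nabla y (nabla x z) - nabla (nabla y x) z.
Proof.
have /eqP := nabla_flat nabla z (nabla_torsion_free nabla x y).
rewrite nablaDl -scaleN1r nablaZl scaleN1r subr_eq0 subr_eq => /eqP ->.
by rewrite addrAC [X in X + _]addrAC subrr add0r addrC.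
Qed.

Fact nabla_leibniz_id x (f : cinf) y :
  nabla x (f *: y) = f *: nabla x y + lie (push id_tangent x) f *: y.
Proof.
rewrite nabla_leibniz; congr (_ + lie _ f *: y).
exact: section_eq.
Qed.

Definition lsa_tangent : lsa :=
  Lsa nablaDl (nablaD nabla) nabla_assoc nabla_leibniz_id nablaZl.

End TangentLsa.

Section Cohomology.
Variable A : lsa.

Definition lsa_bracket (x y : section A) : section A := lsa_mul x y - lsa_mul y x.

Definition lsa_der (x : section A) (f : cinf) : cinf := lie (push (lsa_anchor A) x) f.

(* Cochains of degree k.+1, as C^oo(M)-multilinear maps of k.+1 sections of A;
   the first k arguments, in which the cochain is skew-symmetric, form a
   tuple. *)
Definition cochain (k : nat) : Type := k.-tuple (section A) -> section A -> cinf.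

Definition is_cochain k (phi : cochain k) : Prop :=
  [/\ forall (x : k.-tuple (section A)) (f : cinf) y z,
        phi x (f *: y + z) = f * phi x y + phi x z,
      forall (x : k.-tuple (section A)) (i : 'I_k) (f : cinf) y z w,
        let upd u := [tuple if j == i then u else tnth x j | j < k] in
        phi (upd (f *: y + z)) w = f * phi (upd y) w + phi (upd z) w &
      forall (s : 'S_k) (x : k.-tuple (section A)) w,
        phi [tuple tnth x (s j) | j < k] w = (-1) ^+ s * phi x w].

Definition omit k (x : k.+1.-tuple (section A)) (i : 'I_k.+1) : k.-tuple (section A) :=
  [tuple tnth x (lift i j) | j < k].

(* ([x_i, x_j], x_0, ..., omitting x_i and x_j, ..., x_k) for i < j <= k; the
   default value 0 is never used. *)
Definition omit2 k (x : k.+1.-tuple (section A)) (i j : 'I_k.+1) : k.-tuple (section A) :=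
  [tuple nth 0 (lsa_bracket (tnth x i) (tnth x j) ::
                [seq tnth x l | l <- enum 'I_k.+1 & (l != i) && (l != j)]) l
  | l < k].

(* Indices start at 0, hence the sign (-1)^i in the first two sums. *)
Definition delta k (phi : cochain k) : cochain k.+1 := fun x z =>
  \sum_(i < k.+1) (-1) ^+ i * lsa_der (tnth x i) (phi (omit x i) z)
  - \sum_(i < k.+1) (-1) ^+ i * phi (omit x i) (lsa_mul (tnth x i) z)
  + \sum_(i < k.+1) \sum_(j < k.+1 | (i < j)%N)
      (-1) ^+ (i + j) * phi (omit2 x i j) z.

Definition tilde_cond k : cochain k -> Prop :=
  match k return cochain k -> Prop with
  | 0 => fun phi => forall x y,
      phi [tuple] (lsa_bracket x y) =
      lsa_der x (phi [tuple] y) - lsa_der y (phi [tuple] x)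
  | 1 => fun phi => forall x y, phi [tuple x] y = phi [tuple y] x
  | 2 => fun phi => forall x y z,
      phi [tuple x; y] z + phi [tuple y; z] x + phi [tuple z; x] y = 0
  | _ => fun=> True
  end.

Definition is_tilde_cochain k (phi : cochain k) : Prop :=
  is_cochain phi /\ tilde_cond phi.

Definition tilde_cocycle k (phi : cochain k) : Prop :=
  is_tilde_cochain phi /\ forall x z, delta phi x z = 0.

Definition tilde_coboundary k : cochain k -> Prop :=
  match k return cochain k -> Prop with
  | 0 => fun phi => forall x z, phi x z = 0
  | k'.+1 => fun phi => exists2 h : cochain k', is_tilde_cochain h &
      forall x z, phi x z = delta h x z
  end.

Definition tilde_class k (phi : cochain k) : set (cochain k) :=
  [set psi | tilde_cocycle psi /\
             tilde_coboundary (fun x z => psi x z - phi x z)].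

(* The cohomology in degree k.+1, as the set of classes of cocycles. *)
Definition tilde_cohomology k : set (set (cochain k)) :=
  [set tilde_class phi | phi in @tilde_cocycle k].

Definition tilde_H3 : set (set (cochain 2)) := @tilde_cohomology 2.

End Cohomology.

(* The data of a pre-symplectic algebroid, before imposing the two axioms of
   is_presymplectic. *)
Record psa_data := PsaData {
  psa_bundle :> vfamily;
  psa_vbundle : is_vbundle psa_bundle;
  form : forall p, psa_bundle p -> psa_bundle p -> R;
  form_linear : forall p a u v w,
    @form p (a *: u + v) w = a * form u w + form v w;
  form_skew : forall p (u v : psa_bundle p), form u v = - form v u;
  form_nondegenerate : forall p (u : psa_bundle p),
    (forall v, form u v = 0) -> u = 0;
  form_smooth : forall s t : section psa_bundle, smooth (fun p => form (s p) (t p));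
  anchor : bundle_map psa_bundle tangent;
  star : section psa_bundle -> section psa_bundle -> section psa_bundle;
  star_linearl : forall a e e' e1,
    star (cstC a *: e + e') e1 = cstC a *: star e e1 + star e' e1;
  star_linearr : forall a e e' e1,
    star e1 (cstC a *: e + e') = cstC a *: star e1 e + star e1 e' }.

Section PreSymplectic.
Variable E : psa_data.
Implicit Types e : section E.

Definition pairing e1 e2 : cinf := mk_cinf (form_smooth e1 e2).

Definition rho e : vfield := push (anchor E) e.

(* Df is the section with (Df, e) = rho(e)(f) for all e; it exists and is
   unique because the form is nondegenerate. *)
Definition D (f : cinf) : section E :=
  xget 0 [set d | forall e, pairing d e = lie (rho e) f].

Definition assoc e1 e2 e3 : section E :=
  star e1 (star e2 e3) - star (star e1 e2) e3.

Definition brack e1 e2 : section E := star e1 e2 - star e2 e1.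

Definition Tform e1 e2 e3 : cinf :=
  pairing (star e1 e2) e3 + pairing e1 (star e2 e3)
  - pairing (star e2 e1) e3 - pairing e2 (star e1 e3).

Definition is_presymplectic : Prop :=
  (forall e1 e2 e3,
     assoc e1 e2 e3 - assoc e2 e1 e3 = cstC (1 / 6) *: D (Tform e1 e2 e3)) /\
  (forall e1 e2 e3,
     lie (rho e1) (pairing e2 e3) =
     pairing (star e1 e2 - cstC (1 / 2) *: D (pairing e1 e2)) e3
     + pairing e2 (brack e1 e3)).

(* rho^* xi is the vector with (rho^* xi, v) = <xi, rho v> for all v. *)
Definition rho_star (p : M) (xi : covector) : E p :=
  xget 0 [set u | forall v : E p, form u v = xi (anchor E p v)].

Definition is_exact (nabla : flat_connection) : Prop :=
  [/\ forall p, injective (@rho_star p),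
      forall p (u : E p), anchor E p u = 0 <-> exists xi, rho_star p xi = u,
      forall p (v : tangent p), exists u : E p, anchor E p u = v &
      forall e1 e2, rho (star e1 e2) = nabla (rho e1) (rho e2)].

Definition isotropic_splitting (sigma : bundle_map tangent E) : Prop :=
  (forall p v, anchor E p (sigma p v) = v) /\
  (forall p (v w : tangent p), form (sigma p v) (sigma p w) = 0).

End PreSymplectic.

Section OverFlatManifold.
Variable nabla : flat_connection.

Record exact_psa := ExactPsa {
  epsa_data :> psa_data;
  epsa_presymplectic : is_presymplectic epsa_data;
  epsa_exact : is_exact epsa_data nabla }.

(* The inverse of a fibrewise bijective smooth bundle map is smooth, so F is
   an isomorphism of vector bundles. *)
Definition psa_iso (E E' : exact_psa) : Prop :=
  exists F : bundle_map E E',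
    [/\ forall p, bijective (F p),
        forall e1 e2, push F (star e1 e2) = star (push F e1) (push F e2),
        forall p (u : E p), anchor E' p (F p u) = anchor E p u &
        forall p (u v : E p), form (F p u) (F p v) = form u v].

(* Isomorphism classes, as predicates on exact_psa. The type exact_psa lies in
   too large a universe for the type constructor set. *)
Record iso_class := IsoClass {
  iso_class_mem : exact_psa -> Prop;
  iso_classP : exists E, iso_class_mem = psa_iso E }.

Definition iso_class_of (E : exact_psa) : iso_class :=
  IsoClass (ex_intro (fun E' => psa_iso E = psa_iso E') E erefl).

Definition splitting_cochain (E : exact_psa) (sigma : bundle_map tangent E)
    (tphi : cochain (lsa_tangent nabla) 2) : Prop :=
  exists phi : vfield -> vfield -> oneform,
    (forall x y p, rho_star E p (phi x y p) =
       (star (push sigma x) (push sigma y) - push sigma (nabla x y)) p) /\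
    (forall x y z p, tphi [tuple x; y] z p = phi x z p (y p)).

End OverFlatManifold.

End SmoothFunctions.

Arguments tilde_H3 {R n M} A.

(* Main.v *)
From HB Require Import structures.
From mathcomp Require Import all_boot all_order all_algebra perm.
From mathcomp Require Import all_classical all_reals topology normedtype derive.
From mathcomp Require Import interval_inference landau sequences realfun exp ring lra.
Require Import Defs.

(** Given an isotropic splitting [sigma] of an exact pre-symplectic algebroid [E],
    a section [e] is the same as the pair of the vector field [x = rho e] and the
    1-form [w z = (e, sigma z)] ([wform]), and the form is
    [(e1, e2) = w1 x2 - w2 x1] ([pairingE]). Exactness says that the product of
    two sections has vector field [nabla x1 x2]. The invariance axiom determines
    its 1-form up to one unknown, the 1-form of [sigma x1 * sigma x2]: it is
<<
    a(x1, z, x2) + x1 w2(z) - z w2(x1) / 2 - w2([x1, z])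
                 + w1(nabla_z x2) - z w1(x2) / 2
>>
    on [z] ([split_star_formula]), where [a] is the cochain of the splitting. The
    same axiom makes [a] skew in its first two arguments with vanishing cyclic sum;
    since [a] is clearly linear over the smooth functions in its second argument,
    it is so in all of them. Conversely the formula and these symmetries imply
    invariance ([formula_invariance]).

    With the product formula, the defect in the associator axiom is a computation
    ([associator_identity]): by flatness all terms with the [wi] cancel, and the
    coboundary of [a] is left. Hence the axioms of a pre-symplectic algebroid say
    precisely that [a] is a cocycle ([presymplectic_coboundary3]), and every cocycle
    arises from [TM + T*M] with the product given by the formula
    ([cocycle_realized]).

    A second isotropic splitting differs from the first by a symmetric bilinear form
    [h], and its cochain differs by [delta h] ([split_tensor_change]); every
    symmetric [h] occurs ([splitting_shift]). So the class of [a] depends on [E]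
    only. If two algebroids have the same class, their splittings can be chosen with
    equal cochains, and then identifying sections that have the same vector field
    and 1-form is an isomorphism ([psa_iso_cohomologous]).

    This algebra is carried out on sections, which requires some differential
    topology. Bump functions ([bump]) show that bundle maps and 1-forms are the same
    as maps of sections that are linear over the smooth functions
    ([clin_bundle_map], [clinf_oneform]) and, with the inverse of the Gram matrix,
    that such function-valued maps on [E] are represented by sections ([riesz]).
    Isotropic splittings exist ([isotropic_splitting_exists]) because local
    splittings can be glued along a countable cover, the manifold being second
    countable, and then corrected by half of the 2-form that obstructs isotropy. *)

Set Implicit Arguments.
Unset Strict Implicit.
Unset Printing Implicit Defensive.
Import Order.TTheory GRing.Theory Num.Theory numFieldNormedType.Exports.
Local Open Scope classical_set_scope.
Local Open Scope ring_scope.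

(** * Functions with continuous partial derivatives *)


Section LinComb.
Context {R : realType} {n : nat}.
Variable d : 'I_n -> R.

(** The shape of the differential of a function with partial derivatives [d]. *)
Definition lincomb (h : 'rV[R]_n) : R := \sum_i h 0 i * d i.

Lemma lincomb_linear : linear lincomb.
Proof.
move=> a u v; rewrite /lincomb scaler_sumr -big_split /=; apply: eq_bigr => i _.
by rewrite !mxE mulrDl -mulrA.
Qed.

HB.instance Definition _ :=
  GRing.isLinear.Build R 'rV[R]_n R _ lincomb lincomb_linear.

Lemma lincomb_continuous : continuous lincomb.
Proof.
apply: continuous_big => [|i _ x]; first exact: add_continuous.
have c : continuous_at x (fun h : 'rV[R]_n => h 0 i) by exact: coord_continuous.
exact: (cvgMr_tmp (b := d i) c).
Qed.
End LinComb.

(** A directional derivative is the derivative of the restriction to a line;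
    this is how one-variable results are brought to bear below. *)
Lemma derive_line (R : realType) (V W : normedModType R) (f : V -> W) y v (s : R) :
  derivable f (s *: v + y) v ->
  is_derive s 1 (fun t : R => f (t *: v + y)) ('D_v f (s *: v + y)).
Proof.
have E : (fun h : R => h^-1 *: (((fun t : R => f (t *: v + y)) \o shift s) (h *: 1) -
      f (s *: v + y))) =
    (fun h => h^-1 *: ((f \o shift (s *: v + y)) (h *: v) - f (s *: v + y))).
  apply/funext => h /=; congr (_ *: (f _ - _)).
  by rewrite [X in (X + s) *: v]mulr1 scalerDl addrA.
by move=> df; split; rewrite /derivable /derive E.
Qed.

Lemma mvt_line (R : realType) (V : normedModType R) (f : V -> R) y v (t : R) :
  (forall s : R, `|s| <= `|t| -> derivable f (s *: v + y) v) ->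
  exists s : R, `|s| <= `|t| /\ f (t *: v + y) - f y = t * 'D_v f (s *: v + y).
Proof.
move=> df; pose g (s : R) : R := f (s *: v + y).
have dg (s : R) : `|s| <= `|t| -> is_derive s 1 g ('D_v f (s *: v + y)).
  by move=> /df; exact: derive_line.
have cg (a b : R) : (forall s, s \in `[a, b] -> `|s| <= `|t|) ->
    {within `[a, b], continuous g}.
  move=> ab; apply: derivable_within_continuous => s /ab/dg ds.
  exact: ex_derive.
have g0 : g 0 = f y by rewrite /g scale0r add0r.
have [t0|t0] := leP 0 t.
  have tb (s : R) : s \in `[0, t] -> `|s| <= `|t|.
    by rewrite in_itv /= => /andP[s0 st]; rewrite !ger0_norm.
  have [s st E] := @MVT_segment R g (fun s : R => 'D_v f (s *: v + y)) 0 t t0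
    (fun s st => dg s (tb s (subset_itv_oo_cc st))) (cg _ _ tb).
  exists s; split; first exact: tb.
  by rewrite -/(g t) -g0 E subr0 mulrC.
have tb (s : R) : s \in `[t, 0] -> `|s| <= `|t|.
  by rewrite in_itv /= => /andP[s0 st]; rewrite !ler0_norm ?lerN2 // ltW.
have [s st E] := @MVT_segment R g (fun s : R => 'D_v f (s *: v + y)) t 0 (ltW t0)
  (fun s st => dg s (tb s (subset_itv_oo_cc st))) (cg _ _ tb).
exists s; split; first exact: tb.
by rewrite -/(g t) -g0 -opprB E sub0r mulrN opprK mulrC.
Qed.

Section C1Diff.
Context {R : realType} {n : nat}.

(** [trunc i h] interpolates between 0 and [h], changing one coordinate at a time. *)
Definition trunc (k : nat) (h : 'rV[R]_n) : 'rV[R]_n :=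
  \row_i (if (i < k)%N then h 0 i else 0).

Lemma coord_le_norm (h : 'rV[R]_n) i : `|h 0 i| <= `|h|.
Proof.
by rewrite [leRHS]/Num.Def.normr/= mx_normrE; exact: (le_bigmax _ _ (ord0, i)).
Qed.

Lemma norm_rV_le (h : 'rV[R]_n) (c : R) : 0 <= c ->
  (forall i, `|h 0 i| <= c) -> `|h| <= c.
Proof.
move=> c0 hc; rewrite [leLHS]/Num.Def.normr/= mx_normrE.
by apply: bigmax_le => // -[i j] _ /=; rewrite ord1.
Qed.

(** Consecutive interpolating vectors differ in one coordinate, so the mean value
    theorem on a segment applies. *)
Lemma increment_trunc (f : 'rV[R]_n -> R) (a h : 'rV[R]_n) :
  (forall y, `|y - a| <= `|h| -> forall i, derivable f y (delta_mx 0 i)) ->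
  forall i : 'I_n, exists y, `|y - a| <= `|h| /\
    f (trunc i.+1 h + a) - f (trunc i h + a) = h 0 i * partial i f y.
Proof.
move=> df i; pose e : 'rV[R]_n := delta_mx 0 i.
have E : trunc i.+1 h = h 0 i *: e + trunc i h.
  apply/rowP => j; rewrite !mxE /= ltnS leq_eqVlt.
  have [->|ji] := eqVneq j i; first by rewrite eqxx ltnn mulr1 addr0.
  by move: ji; rewrite -val_eqE => /negbTE ->; rewrite mulr0 add0r.
have bnd (s : R) : `|s| <= `|h 0 i| -> `|s *: e + (trunc i h + a) - a| <= `|h|.
  move=> sh; rewrite addrA addrK; apply: norm_rV_le => // j.
  rewrite !mxE /=; have [->|ji] := eqVneq j i.
    by rewrite ltnn mulr1 addr0 (le_trans sh) // coord_le_norm.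
  rewrite mulr0 add0r; case: ifP => _; first exact: coord_le_norm.
  by rewrite normr0.
have [s [sh es]] : exists s : R, `|s| <= `|h 0 i| /\
    f (h 0 i *: e + (trunc i h + a)) - f (trunc i h + a) =
    h 0 i * 'D_e f (s *: e + (trunc i h + a)).
  by apply: mvt_line => s sh; apply: df; exact: bnd.
by exists (s *: e + (trunc i h + a)); split; [exact: bnd|rewrite E -addrA].
Qed.

(** Continuous partial derivatives give a total differential: [f (a + h) - f a]
    telescopes along the vectors [trunc i h], and each partial derivative met on
    the way is close to its value at [a]. *)
Lemma C1_differentiable (U : set 'rV[R]_n) (f : 'rV[R]_n -> R) (a : 'rV[R]_n) :
  open U -> U a -> Ck 1 U f -> differentiable f a.
Proof.
move=> oU Ua [_ df]; pose L := lincomb (fun i => partial i f a).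
have fL : (f \o shift a : 'rV[R]_n -> R^o) =
    cst (f a) + L +o_ (0 : 'rV[R]_n) (id : 'rV[R]_n -> 'rV[R]_n).
  apply/eqaddoP => _/posnumP[e].
  (* The denominator is [n.+1] because [n] may be 0. *)
  have : \forall h \near (0 : 'rV[R]_n), forall y, `|y - a| <= `|h| ->
      U y /\ forall i, `|partial i f y - partial i f a| <= e%:num / n.+1%:R.
    have : \forall y \near a, U y /\
        forall i, `|partial i f y - partial i f a| <= e%:num / n.+1%:R.
      have nU : nbhs a U by exact: open_nbhs_nbhs.
      have ci : nbhs a [set y | forall i, `|partial i f y - partial i f a| <=
          e%:num / n.+1%:R].
        apply: (@filter_forall _ _ (fun i y => `|partial i f y - partial i f a| <=
          e%:num / n.+1%:R) (nbhs a)) => i.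
        have cf : {for a, continuous (partial i f)} by apply: (df i).2.1.
        have e0 : 0 < e%:num / n.+1%:R :> R by rewrite divr_gt0.
        by move/cvgrPdist_le: cf => /(_ _ e0); apply: filterS => y; rewrite distrC.
      by apply: filterS2 nU ci => y.
    move=> /nbhs_ballP[r /= r0 rP].
    apply: filterS (nbhs0_lt r0) => h hr y yh; apply: rP.
    by rewrite -ball_normE /= distrC (le_lt_trans yh).
  apply: filterS => h hP.
  have [y yP] := choice (increment_trunc (f := f) (a := a) (h := h)
    (fun y yh i => (df i).1 y (hP y yh).1)).
  have tel : f (h + a) - f a = \sum_(i < n) h 0 i * partial i f (y i).
    transitivity (\sum_(0 <= i < n) (f (trunc i.+1 h + a) - f (trunc i h + a))).
      rewrite telescope_sumr //; congr (f _ - f _).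
        by congr (_ + _); apply/rowP => i; rewrite mxE ltn_ord.
      by rewrite -[LHS]add0r; congr (_ + _); apply/rowP => i; rewrite !mxE.
    by rewrite big_mkord; apply: eq_bigr => i _; rewrite (yP i).2.
  rewrite [X in `|X|](_ : _ =
    \sum_(i < n) h 0 i * (partial i f (y i) - partial i f a)); last first.
    rewrite !fctE /= opprD addrA tel /L /lincomb -sumrB.
    by apply: eq_bigr => i _; rewrite mulrBr.
  apply: (le_trans (ler_norm_sum _ _ _)).
  apply: (@le_trans _ _ (\sum_(i < n) `|h| * (e%:num / n.+1%:R))).
    apply: ler_sum => i _; rewrite normrM ler_pM //; first exact: coord_le_norm.
    exact: (hP _ (yP i).1).2.
  rewrite sumr_const card_ord -[leLHS]mulr_natr -mulrA [leRHS]mulrC ler_wpM2l //.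
  by rewrite -mulrA ler_piMr // mulrC ler_pdivrMr // mul1r ler_nat.
apply/diffP.
apply: (@getPex _ (fun (df : {linear 'rV[R]_n -> R}) => continuous df /\
  forall y, f y = f (lim (nbhs a)) + df (y - lim (nbhs a))
                  +o_(y \near a) (y - lim (nbhs a)))).
exists (lincomb (fun i => partial i f a) : {linear 'rV[R]_n -> R}); split; first exact: lincomb_continuous.
rewrite lim_id //.
apply/funeqP; rewrite -/(_ + _); apply/eqaddoP => _/posnumP[e].
have c : (y - a) @[y --> a] --> (0 : 'rV[R]_n).
  by rewrite -(subrr a); exact: (cvgB cvg_id (cvg_cst _)).
move/eqaddoP: fL => /(_ e%:num (gt0 e)) /c H.
apply: (@filterS _ (nbhs a) _ _ _ _ H) => y.
by rewrite /= !fctE /= addrNK.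
Qed.
End C1Diff.

(** * The chain rule and the algebra of functions of class C^k *)

Section ChainRule.
Context {R : realType} {m n : nat}.
Implicit Types (g : 'rV[R]_n -> R) (phi : 'rV[R]_m -> 'rV[R]_n).

(** Along the line through [x] in the direction [v] the composite is a function of
    one real variable, for which differentiability of the outer map is enough. *)
Lemma derive_chain g phi x v :
  (forall i, derivable (fun y => phi y 0 i) x v) -> differentiable g (phi x) ->
  is_derive x v (g \o phi)
    (\sum_i 'D_v (fun y => phi y 0 i) x * partial i g (phi x)).
Proof.
move=> dphi dg.
have dp : derivable phi x v by apply/derivable_mxP => i j; rewrite ord1.
pose F (t : R) := phi (t *: v + x).
have F0 : F 0 = phi x by rewrite /F scale0r add0r.
have dF : is_derive (0 : R) 1 F ('D_v phi x).
  by have := @derive_line R _ _ phi x v 0; rewrite scale0r add0r => /(_ dp).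
have diffF : differentiable F (0 : R) by apply/derivable1_diffP; exact: ex_derive.
have dg' : differentiable g (F 0) by rewrite F0.
have diffgF : differentiable (g \o F) (0 : R) by exact: differentiable_comp.
have [dgp vgp] : is_derive (0 : R) 1 (fun t : R => (g \o phi) (t *: v + x))
    ('d g (phi x) ('D_v phi x)).
  split; first exact: diff_derivable.
  rewrite (_ : (fun _ => _) = g \o F) // deriveE // diff_comp //= F0.
  by congr ('d g _ _); rewrite -deriveE // (@derive_val _ _ _ _ _ _ _ dF).
have dgphi : derivable (g \o phi) x v by apply/derivable1P.
split => //.
have := @derive_line R _ _ (g \o phi) x v 0; rewrite scale0r add0r.
move=> /(_ dgphi)[_ <-]; rewrite vgp.
rewrite [in LHS](row_sum_delta ('D_v phi x)) linear_sum /=.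
apply: eq_bigr => i _; rewrite linearZ /= derive_mx // mxE.
by congr (_ * _); rewrite /partial deriveE.
Qed.
End ChainRule.

Section CkClosure.
Context {R : realType} {n : nat}.
Implicit Types (U V : set 'rV[R]_n) (f g : 'rV[R]_n -> R).

Lemma Ck_sum k U (I : Type) (r : seq I) (P : pred I) (F : I -> 'rV[R]_n -> R) :
  open U -> (forall i, P i -> Ck k U (F i)) ->
  Ck k U (fun x => \sum_(i <- r | P i) F i x).
Proof.
move=> oU hF; elim: r => [|i r IH].
  by apply: Ck_eq (Ck_cst k U 0) => // x _; rewrite big_nil.
have [Pi|nPi] := boolP (P i).
  by apply: Ck_eq (CkD oU (hF i Pi) IH) => // x _; rewrite big_cons Pi.
by apply: Ck_eq IH => // x _; rewrite big_cons (negbTE nPi).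
Qed.

Lemma Ck_prod k U (I : Type) (r : seq I) (P : pred I) (F : I -> 'rV[R]_n -> R) :
  open U -> (forall i, P i -> Ck k U (F i)) ->
  Ck k U (fun x => \prod_(i <- r | P i) F i x).
Proof.
move=> oU hF; elim: r => [|i r IH].
  by apply: Ck_eq (Ck_cst k U 1) => // x _; rewrite big_nil.
have [Pi|nPi] := boolP (P i).
  by apply: Ck_eq (CkM oU (hF i Pi) IH) => // x _; rewrite big_cons Pi.
by apply: Ck_eq IH => // x _; rewrite big_cons (negbTE nPi).
Qed.

Lemma CkN k U f : open U -> Ck k U f -> Ck k U (- f).
Proof.
move=> oU cf; apply: (Ck_eq oU _ (CkM oU (Ck_cst k U (-1)) cf)) => x _.
by rewrite !fctE mulN1r.
Qed.

(** Regularity is tested near each point, by induction on the order. *)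
Lemma Ck_local k U f :
  (forall x, U x -> exists V, [/\ open V, V x & Ck k V f]) -> Ck k U f.
Proof.
elim: k f => [|k IH] f loc; split=> //.
- by move=> x /loc[V [_ Vx cf]]; exact: Ck_cont cf Vx.
- by move=> x /loc[V [_ Vx cf]]; exact: Ck_cont cf Vx.
- move=> i; split=> [x /loc[V [_ Vx cf]]|]; first exact: (cf.2 i).1.
  by apply: IH => x /loc[V [oV Vx cf]]; exists V; split=> //; exact: (cf.2 i).2.
Qed.

(** The derivative of [1 / f] is [- f' / f ^ 2], a product of functions to which
    the induction hypothesis applies. *)
Lemma CkV k U f : open U -> (forall x, U x -> f x != 0) ->
  Ck k U f -> Ck k U (fun x => (f x)^-1).
Proof.
move=> oU f0; elim: k => [|k IH] cf.
  by split=> // x Ux; apply: continuousV; [exact: f0|exact: Ck_cont cf Ux].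
split=> [x Ux|i].
  by apply: continuousV; [exact: f0|exact: Ck_cont cf Ux].
have [dfi cfi] := cf.2 i; split=> [x Ux|].
  by apply: derivableV; [exact: f0|exact: dfi].
have cV := IH (Ck_le cf).
apply: (Ck_eq oU _ (CkN oU (CkM oU (CkM oU cV cV) cfi))) => x Ux.
rewrite /partial deriveV; [|exact: f0|exact: dfi].
by rewrite !fctE /= /GRing.scale /= mulNr expr2 invfM.
Qed.

Lemma is_derive_coord (i j : 'I_n) (x : 'rV[R]_n) :
  is_derive x (delta_mx 0 j : 'rV[R]_n) (fun x => x 0 i) ((i == j)%:R : R).
Proof.
have df : differentiable (fun x : 'rV[R]_n => x 0 i) x.
  exact: differentiable_coord.
split; first exact: diff_derivable.
have := @derive_line R _ _ (fun x : 'rV[R]_n => x 0 i) x (delta_mx 0 j) 0.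
rewrite scale0r add0r => /(_ (diff_derivable df))[_ <-].
rewrite (_ : (fun _ => _) = (fun t : R => t * (i == j)%:R + x 0 i)); last first.
  by apply/funext => t; rewrite !mxE.
by rewrite derive_val /GRing.scale /= ?(scaler0, mulr1, mulr0, add0r, addr0).
Qed.

Lemma Ck_coord k U i : open U -> Ck k U (fun x => x 0 i).
Proof.
move=> oU; case: k => [|k]; first by split=> // x _; exact: coord_continuous.
split=> [x _|j]; first exact: coord_continuous.
split=> [x _|]; first exact: (ex_derive (is_derive := is_derive_coord i j x)).
apply: (Ck_eq oU _ (Ck_cst k U (i == j)%:R)) => x _.
by rewrite /partial; have [_ ->] := is_derive_coord i j x.
Qed.
End CkClosure.

(** By the chain rule the partial derivatives of the composite are sums of products
    of functions of the same kind with one order less. *)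
Lemma Ck_comp (R : realType) (m n k : nat) (U : set 'rV[R]_m) (V : set 'rV[R]_n)
    (g : 'rV[R]_n -> R) (phi : 'rV[R]_m -> 'rV[R]_n) :
  open U -> open V -> (forall x, U x -> V (phi x)) ->
  Ck k V g -> (forall i, Ck k U (fun x => phi x 0 i)) -> Ck k U (g \o phi).
Proof.
move=> oU oV UV.
have cphi k' : (forall i, Ck k' U (fun x => phi x 0 i)) ->
    forall x, U x -> {for x, continuous phi}.
  move=> cp x Ux; apply/(@cvgrPdist_le _ _ _ (nbhs x)) => /= e e0.
  have H : nbhs x [set y | forall i, `|phi x 0 i - phi y 0 i| <= e].
    apply: (@filter_forall _ _ (fun i y => `|phi x 0 i - phi y 0 i| <= e) (nbhs x)).
    by move=> i; have /cvgrPdist_le := Ck_cont (cp i) Ux; exact.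
  apply: (@filterS _ (nbhs x) _ _ _ _ H) => y hy.
  by apply: norm_rV_le => [|i]; [exact: ltW|rewrite !mxE].
have cont k' f : Ck k' V f -> (forall i, Ck k' U (fun x => phi x 0 i)) ->
    forall x, U x -> {for x, continuous (f \o phi)}.
  move=> cf cp x Ux; apply: continuous_comp; first exact: cphi cp _ Ux.
  exact: Ck_cont cf (UV _ Ux).
elim: k g => [|k IH] g cg cp; first by split=> //; exact: cont cg cp.
split=> [|j]; first exact: cont cg cp.
have dd x : U x -> is_derive x (delta_mx 0 j : 'rV[R]_m) (g \o phi)
    (\sum_i 'D_(delta_mx 0 j : 'rV[R]_m) (fun y => phi y 0 i) x * partial i g (phi x)).
  move=> Ux; apply: derive_chain => [i|]; first exact: ((cp i).2 j).1.
  apply: (@C1_differentiable _ _ V) => //; first exact: UV.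
  by elim: k {IH} g cg {cp} => // k IH g /Ck_le; exact: IH.
split=> [x /dd|]; first by move=> ?; exact: ex_derive.
have cpk i : Ck k U (fun x => phi x 0 i) by exact: Ck_le.
apply: (@Ck_eq _ _ k U (fun x => \sum_i partial j (fun y => phi y 0 i) x *
    (partial i g \o phi) x)) => //.
  by move=> x /dd[_ <-].
apply: Ck_sum => // i _; apply: CkM => //; first exact: ((cp i).2 j).2.
by apply: IH => //; exact: (cg.2 i).2.
Qed.

(** * A smooth step function *)

Section FlatFunction.
Context {R : realType}.

(** The functions [t^-j exp (- 1 / t)], extended by 0. Treating all [j] together
    makes the family stable under differentiation, up to linear combinations. *)
Definition flat (j : nat) (t : R) : R :=
  if 0 < t then t^-1 ^+ j * expR (- t^-1) else 0.

Lemma flat_ge0 j t : 0 <= flat j t.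
Proof.
rewrite /flat; case: ifP => // t0.
by rewrite mulr_ge0 ?expR_ge0 // exprn_ge0 // invr_ge0 ltW.
Qed.

Lemma flat_gt0 j t : 0 < t -> 0 < flat j t.
Proof.
by move=> t0; rewrite /flat t0 mulr_gt0 ?expR_gt0 // exprn_gt0 // invr_gt0.
Qed.

Lemma flat_le0 j t : t <= 0 -> flat j t = 0.
Proof. by rewrite /flat leNgt => /negbTE ->. Qed.

Lemma flatS j t : t * flat j.+1 t = flat j t.
Proof.
rewrite /flat; case: ifP => t0; last by rewrite mulr0.
by rewrite exprS !mulrA divff ?mul1r // gt_eqF.
Qed.

(** With [u = 1 / t] this is [u ^ m <= m! exp u], a term of the exponential
    series. *)
Lemma flat_le_fact j t : flat j.+1 t <= j.+1`!%:R.
Proof.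
rewrite /flat; case: ifP => // t0; set u := t^-1.
have u0 : 0 <= u by rewrite invr_ge0 ltW.
have h : u ^+ j.+1 / j.+1`!%:R <= expR u.
  by apply: le_trans (expR_ge1Dxn j u0); rewrite lerDr.
by rewrite expRN ler_pdivrMr ?expR_gt0 // mulrC -ler_pdivrMr // ltr0n fact_gt0.
Qed.

(** At 0 the difference quotient is [flat j.+1 h = h * flat j.+2 h], and the last
    factor is bounded. *)
Lemma is_derive_flat j (t : R) : is_derive t 1 (flat j) (flat j.+2 t - j%:R * flat j.+1 t).
Proof.
have [t0|t0|<-] := ltgtP 0 t.
- pose f (s : R) := s^-1 ^+ j * expR (- s^-1).
  have ft : is_derive t (1 : R) f (flat j.+2 t - j%:R * flat j.+1 t).
    have dV : is_derive t 1 (fun s : R => s^-1) (- t ^- 2).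
      split; first by apply: derivableV; rewrite ?gt_eqF.
      rewrite deriveV ?gt_eqF // derive_id.
      by rewrite [LHS]mulr1.
    have dN : is_derive t 1 (fun s : R => - s^-1) (t ^- 2).
      by have := is_deriveN dV; rewrite opprK.
    have dE : is_derive t 1 (expR \o (fun s : R => - s^-1)) (expR (- t^-1) * t ^- 2).
      exact: is_derive1_comp.
    have dX := is_deriveX j dV.
    have := is_deriveM dX dE.
    rewrite (_ : (_ ^+ j * (expR \o _)) = f); last first.
      by apply/funext => s; rewrite /f !fctE /= ?exprfctE.
    move=> df; apply: (is_derive_eq df).
    rewrite /flat t0 ?exprfctE /GRing.scale /= -!exprVn.
    case: (j) => [|i] /=; first by rewrite !expr0 !mul0r; ring.
    by rewrite !exprS; ring.
  apply: (near_eq_is_derive _ ft).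
  have : nbhs t [set s | 0 < s] by exact: lt_nbhsr.
  by apply: filterS => s /= s0; rewrite /flat s0.
- have -> : flat j.+2 t - j%:R * flat j.+1 t = 0.
    by rewrite !flat_le0 ?mulr0 ?subrr // ltW.
  apply: (near_eq_is_derive _ (is_derive_cst (0 : R) t 1)).
  have : nbhs t [set s | s < 0] by exact: lt_nbhsl.
  by apply: filterS => s /= s0; rewrite flat_le0 // ltW.
have -> : flat j.+2 0 - j%:R * flat j.+1 0 = 0 by rewrite !flat_le0 ?mulr0 ?subrr.
have c : h^-1 *: ((flat j \o shift 0) (h *: 1) - flat j 0) @[h --> 0^'] --> (0 : R).
  apply/cvgrPdist_le => /= e e0.
  have d0 : 0 < e / j.+2`!%:R by rewrite divr_gt0 // ltr0n fact_gt0.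
  apply: (filterS _ (dnbhs0_lt d0)) => h hd.
  rewrite sub0r normrN [flat j 0]flat_le0 // subr0 addr0.
  rewrite [X in flat j X]mulr1 -flatS /GRing.scale /=.
  have [->|h0] := eqVneq h 0; first by rewrite invr0 mul0r normr0 ltW.
  rewrite mulrA mulVf // mul1r -flatS normrM.
  rewrite [X in _ * X]ger0_norm ?flat_ge0 //.
  apply: (le_trans (ler_wpM2l _ (flat_le_fact j.+1 h))) => //.
  by rewrite -ler_pdivlMr ?ltr0n ?fact_gt0 // ltW.
by split; [apply/cvg_ex; exists 0|apply: cvg_lim].
Qed.

Lemma flat_continuous j : continuous (flat j).
Proof.
move=> t; apply: differentiable_continuous; apply/derivable1_diffP.
exact: (ex_derive (is_derive := is_derive_flat j t)).
Qed.

Lemma derive_comp1 (V : normedModType R) (h : R -> R) (dh : R) (phi : V -> R) x v :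
  is_derive (phi x) 1 h dh -> derivable phi x v ->
  is_derive x v (h \o phi) (dh * 'D_v phi x).
Proof.
move=> hd dphi; pose F (t : R) := phi (t *: v + x).
have F0 : F 0 = phi x by rewrite /F scale0r add0r.
have dF : is_derive (0 : R) 1 F ('D_v phi x).
  by have := @derive_line R _ _ phi x v 0; rewrite scale0r add0r => /(_ dphi).
have hd' : is_derive (F 0) 1 h dh by rewrite F0.
have [dgp vgp] : is_derive (0 : R) 1 (fun t : R => (h \o phi) (t *: v + x))
    (dh * 'D_v phi x).
  exact: (is_derive1_comp (f := h) (g := F)).
have dgphi : derivable (h \o phi) x v by apply/derivable1P.
split => //.
have := @derive_line R _ _ (h \o phi) x v 0; rewrite scale0r add0r.
by move=> /(_ dgphi)[_ <-]; rewrite vgp.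
Qed.

Lemma Ck_flat n k j (U : set 'rV[R]_n) (phi : 'rV[R]_n -> R) :
  open U -> Ck k U phi -> Ck k U (flat j \o phi).
Proof.
move=> oU; elim: k j phi => [|k IH] j phi cp.
  split=> // x Ux; apply: continuous_comp; first exact: Ck_cont cp Ux.
  exact: flat_continuous.
split=> [x Ux|i].
  apply: continuous_comp; first exact: Ck_cont cp Ux.
  exact: flat_continuous.
have dd x : U x -> is_derive x (delta_mx 0 i : 'rV[R]_n) (flat j \o phi)
    ((flat j.+2 (phi x) - j%:R * flat j.+1 (phi x)) * partial i phi x).
  move=> Ux; apply: derive_comp1; last exact: (cp.2 i).1.
  exact: is_derive_flat.
split=> [x /dd ?|]; first exact: ex_derive.
have cpk := Ck_le cp.
have c1 := CkD oU (IH j.+2 _ cpk) (CkM oU (Ck_cst k U (- j%:R)) (IH j.+1 _ cpk)).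
apply: (Ck_eq oU _ (CkM oU c1 (cp.2 i).2)) => x Ux.
rewrite /partial; have [_ ->] := dd x Ux.
by rewrite !fctE /= mulNr.
Qed.

(** The denominator makes the value exactly 1, and not only positive, for
    [1 <= t]. *)
Definition step (t : R) : R := flat 0 t / (flat 0 t + flat 0 (1 - t)).

Lemma step_den_gt0 t : 0 < flat 0 t + flat 0 (1 - t).
Proof.
have [t0|t0] := ltP 0 t; first by rewrite ltr_pwDl ?flat_ge0 ?flat_gt0.
by rewrite ltr_wpDl ?flat_ge0 ?flat_gt0 // subr_gt0 (le_lt_trans t0).
Qed.

Lemma step_ge1 t : 1 <= t -> step t = 1.
Proof.
move=> t1; rewrite /step [flat 0 (1 - t)]flat_le0 ?subr_le0 // addr0 divff //.
by rewrite gt_eqF // flat_gt0 // (lt_le_trans _ t1).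
Qed.

Lemma step_le0 t : t <= 0 -> step t = 0.
Proof. by move=> t0; rewrite /step flat_le0 // mul0r. Qed.

Lemma Ck_step n k (U : set 'rV[R]_n) (phi : 'rV[R]_n -> R) :
  open U -> Ck k U phi -> Ck k U (step \o phi).
Proof.
move=> oU cp; have c1 := Ck_flat 0 oU cp.
have c2 : Ck k U (fun x => flat 0 (1 - phi x)).
  apply: (Ck_flat 0 oU (phi := fun x => 1 - phi x)).
  exact: (CkD oU (Ck_cst k U 1) (CkN oU cp)).
apply: (Ck_eq oU _ (CkM oU c1 (CkV oU _ (CkD oU c1 c2)))) => // x _.
by rewrite !fctE /= gt_eqF // step_den_gt0.
Qed.
End FlatFunction.

(** * Smooth functions on a manifold *)

Section SmoothFunctionTheory.
Context {R : realType} {n : nat} (M : manifold R n).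
Implicit Types (U V K : set M) (f g : M -> R) (p q : M).

Lemma cinf_eq (f g : cinf M) : (forall p, f p = g p) -> f = g.
Proof. by move=> fg; apply: val_inj; apply/funext. Qed.

Lemma cinfD (f g : cinf M) p : (f + g) p = f p + g p. Proof. by []. Qed.
Lemma cinfN (f : cinf M) p : (- f) p = - f p. Proof. by []. Qed.
Lemma cinfM (f g : cinf M) p : (f * g) p = f p * g p. Proof. by []. Qed.
Lemma cinf0 p : (0 : cinf M) p = 0. Proof. by []. Qed.
Lemma cinf1 p : (1 : cinf M) p = 1. Proof. by []. Qed.

Lemma cstCE a p : cstC M a p = a. Proof. by []. Qed.

Lemma cinf_congr (f g : cinf M) p : f = g -> f p = g p.
Proof. by move=> ->. Qed.

Lemma cinf_sum (I : Type) (r : seq I) (P : pred I) (F : I -> cinf M) p :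
  (\sum_(i <- r | P i) F i) p = \sum_(i <- r | P i) F i p.
Proof.
elim: r => [|i r IH]; first by rewrite !big_nil.
by rewrite !big_cons; case: ifP => _; rewrite ?cinfD IH.
Qed.

Lemma chart_imageE (c : chart R M n) U V x :
  U `&` cdom c `<=` V -> (c @` (U `&` cdom c)) x -> V (cinv c x) /\ cdom c (cinv c x).
Proof. by move=> UV [q [Uq cq] <-]; rewrite cfunK //; split => //; exact: UV. Qed.

Lemma smooth_on_eq U f g : open U -> (forall p, U p -> f p = g p) ->
  smooth_on U f -> smooth_on U g.
Proof.
move=> oU fg sf c Ac k; apply: Ck_eq (sf c Ac k); first exact: chart_image_open.
by move=> x /(@chart_imageE c U U x (@subIsetl _ _ _))[/fg].
Qed.

Lemma smooth_on_local U f :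
  (forall p, U p -> exists V, [/\ open V, V p & smooth_on V f]) -> smooth_on U f.
Proof.
move=> loc c Ac k; apply: Ck_local => _ [p [Up cp] <-].
have [V [oV Vp sf]] := loc p Up; exists (c @` (V `&` cdom c)); split => //.
- exact: chart_image_open.
- by exists p.
- exact: sf.
Qed.

(** Smoothness is local. All functions obtained below by extension by zero or by
    local choices are shown to be smooth through this. *)
Lemma smooth_on_glue U f :
  (forall p, U p -> exists V g,
     [/\ open V, V p, smooth_on V g & forall q, V q -> f q = g q]) -> smooth_on U f.
Proof.
move=> loc; apply: smooth_on_local => p /loc[V [g [oV Vp sg fg]]].
by exists V; split=> //; apply: smooth_on_eq sg => // q /fg.
Qed.

Lemma smooth_on_sum U (I : Type) (r : seq I) (P : pred I) (F : I -> M -> R) :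
  open U -> (forall i, P i -> smooth_on U (F i)) ->
  smooth_on U (fun x => \sum_(i <- r | P i) F i x).
Proof.
move=> oU hF c Ac k; have oc := chart_image_open (c := c) oU.
by apply: (Ck_sum r (F := fun i => F i \o cinv c)) => // i Pi; exact: hF.
Qed.

Lemma smooth_on_prod U (I : Type) (r : seq I) (P : pred I) (F : I -> M -> R) :
  open U -> (forall i, P i -> smooth_on U (F i)) ->
  smooth_on U (fun x => \prod_(i <- r | P i) F i x).
Proof.
move=> oU hF c Ac k; have oc := chart_image_open (c := c) oU.
by apply: (Ck_prod r (F := fun i => F i \o cinv c)) => // i Pi; exact: hF.
Qed.

Lemma smooth_onV U f : open U -> (forall p, U p -> f p != 0) ->
  smooth_on U f -> smooth_on U (fun p => (f p)^-1).
Proof.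
move=> oU f0 sf c Ac k; apply: (@CkV _ _ k _ (f \o cinv c)); last exact: sf.
  exact: chart_image_open.
by move=> x /(@chart_imageE c U U x (@subIsetl _ _ _))[/f0].
Qed.

Lemma nbhs_dom (c : chart R M n) p : cdom c p -> nbhs p (cdom c).
Proof. by move=> cp; apply: open_nbhs_nbhs; split=> //; exact: cdom_open. Qed.

Lemma smooth_on_continuous U f p : open U -> U p -> smooth_on U f ->
  {for p, continuous f}.
Proof.
move=> oU Up sf; have [c [Ac cp]] := atlas_cover p.
have cf : {for c p, continuous (f \o cinv c)}.
  by apply: (Ck_cont (sf c Ac 0%N)); exists p.
have cc : {for p, continuous (f \o cinv c \o c)}.
  by apply: continuous_comp => //; exact: cfun_continuous.
have ne : \forall q \near p, (f \o cinv c \o c) q = f q.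
  by apply: filterS (nbhs_dom cp) => q cq; rewrite /= cfunK.
have E : (f \o cinv c \o c) p = f p by rewrite /= cfunK.
rewrite /prop_for /continuous_at -E.
exact: cvg_trans (near_eq_cvg ne) cc.
Qed.

(** One chart suffices to test smoothness, as changes of chart are smooth. *)
Lemma smooth_of_chart (c : chart R M n) U (g : 'rV[R]_n -> R) :
  atlas c -> open U -> U `<=` cdom c -> Cinfty (c @` U) g -> smooth_on U (g \o c).
Proof.
move=> Ac oU Uc sg d Ad k.
have -> : (g \o c) \o cinv d = g \o (c \o cinv d) by [].
apply: (@Ck_comp _ _ _ _ _ (c @` U)).
- exact: chart_image_open.
- by rewrite -(setIidl Uc); exact: chart_image_open.
- by move=> x /(@chart_imageE d U U x (@subIsetl _ _ _))[Ux _]; exists (cinv d x).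
- exact: sg.
move=> i; apply: Ck_sub (atlas_compat Ad Ac i k).
by move=> _ [q [Uq dq] <-]; exists q => //; split=> //; exact: Uc.
Qed.

Lemma smooth_coord (c : chart R M n) i : atlas c ->
  smooth_on (cdom c) (fun q => c q 0 i).
Proof.
move=> Ac; apply: (@smooth_of_chart c (cdom c) (fun x => x 0 i)) => //.
- exact: cdom_open.
- by move=> k; apply: Ck_coord; exact: cimg_open.
Qed.

(** The function is built in a chart from [step] and the squared distance to the
    image of [p], and extended by zero. The support [K] is the image of a compact
    ball, hence closed because [M] is Hausdorff: this is what makes the extension
    smooth. Being 1 on a neighbourhood, and not only at [p], it cuts functions and
    sections off without changing them near [p]. *)
Lemma bump p U : open U -> U p -> exists (chi : cinf M) (V K : set M),
  [/\ open V, V p, closed K, V `<=` K /\ K `<=` U &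
      (forall q, V q -> chi q = 1) /\ (forall q, ~ K q -> chi q = 0)].
Proof.
move=> oU Up; have [c [Ac cp]] := atlas_cover p.
pose x0 := c p.
have oW := chart_image_open (c := c) oU.
have Wx0 : (c @` (U `&` cdom c)) x0 by exists p.
have /nbhs_ballP[r /= r0 rW] : nbhs x0 (c @` (U `&` cdom c)) by exact: open_nbhs_nbhs.
(* [phi] is at least 1 close to [x0], and negative beyond distance [2 * e], which
   is less than [r]. *)
pose e : R := r / 3.
have e0 : 0 < e by rewrite divr_gt0.
pose phi (x : 'rV[R]_n) : R := 2 + - (\sum_i (x 0 i - x0 0 i) ^+ 2 / e ^+ 2).
have phi_small x : 0 <= phi x -> `|x - x0| <= 2 * e.
  move=> h; apply: norm_rV_le => [|i]; first by rewrite mulr_ge0 ?ltW.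
  have e20 : 0 <= 2 * e by rewrite mulr_ge0 ?ltW.
  rewrite !mxE -(@ler_pXn2r _ 2) ?nnegrE //.
  rewrite real_normK ?num_real // exprMn.
  have hi : (x 0 i - x0 0 i) ^+ 2 / e ^+ 2 <= 2.
    have : \sum_i (x 0 i - x0 0 i) ^+ 2 / e ^+ 2 <= 2 by move: h; rewrite /phi; lra.
    apply: le_trans; rewrite (bigD1 i) //= lerDl sumr_ge0 // => j _.
    by rewrite divr_ge0 ?sqr_ge0.
  have e2 : 0 < e ^+ 2 by rewrite exprn_gt0.
  rewrite ler_pdivrMr // in hi; apply: (le_trans hi).
  by rewrite ler_pM2r //; lra.
have sphi (U' : set 'rV[R]_n) k : open U' -> Ck k U' phi.
  move=> oU'; apply: (CkD oU' (Ck_cst _ _ _)); apply: (CkN oU').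
  apply: Ck_sum => // j _; apply: (CkM oU' _ (Ck_cst _ _ _)).
  have cx : Ck k U' (fun x => x 0 j - x0 0 j).
    exact: (CkD oU' (Ck_coord k j oU') (Ck_cst _ _ _)).
  exact: (CkM oU' cx cx).
pose B := closed_ball x0 (2 * e).
have e20 : 0 < 2 * e by rewrite mulr_gt0.
have BE x : B x <-> `|x - x0| <= 2 * e.
  by rewrite /B closed_ballE // /closed_ball_ /= distrC.
have BW : B `<=` c @` (U `&` cdom c).
  move=> x /BE hx; apply: rW; rewrite -ball_normE /= distrC (le_lt_trans hx) //.
  by rewrite /e; lra.
have cB : compact B.
  apply: bounded_closed_compact; last exact: closed_ball_closed.
  exists (`|x0| + 2 * e); split; first exact: num_real.
  move=> y hy x /BE hx; apply: ltW; apply: le_lt_trans hy.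
  by rewrite -[x](subrK x0) addrC (le_trans (ler_normD _ _)) // lerD2l.
pose K := cinv c @` B.
have clK : closed K.
  apply: compact_closed; first exact: m_hausdorff.
  apply: continuous_compact => //; apply: continuous_in_subspaceT => x /set_mem/BW Wx.
  by apply: cinv_continuous; case: Wx => q [_ cq] <-; exists q.
have KUc : K `<=` U `&` cdom c.
  by move=> _ [x /BW Wx <-]; case: Wx => q [Uq cq] <-; rewrite cfunK.
pose chi q : R := if pselect (cdom c q) then step (phi (c q)) else 0.
have chi0 q : ~ K q -> chi q = 0.
  move=> nK; rewrite /chi; case: pselect => // cq; apply: step_le0.
  rewrite leNgt; apply/negP => /ltW/phi_small/BE h; apply: nK.
  by exists (c q) => //; rewrite cfunK.
have schi : smooth chi.
  apply: smooth_on_glue => q _; have [cq|ncq] := pselect (cdom c q).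
    exists (cdom c), ((step \o phi) \o c); split => //; first exact: cdom_open.
      apply: smooth_of_chart => // [|k]; first exact: cdom_open.
      by apply: Ck_step; [exact: cimg_open|apply: sphi; exact: cimg_open].
    by move=> q' cq'; rewrite /chi; case: pselect.
  exists (~` K), (fun=> 0); split.
  - exact: closed_openC.
  - by move=> /KUc[].
  - exact: smooth_on_cst.
  - by move=> q' /chi0.
pose P := [set q | chi q = 1 /\ U q].
have nP : nbhs p P.
  have d0 : 0 < e / n.+1%:R by rewrite divr_gt0.
  have : nbhs p (cfun c @^-1` ball x0 (e / n.+1%:R)).
    by apply: (cfun_continuous cp); exact: nbhsx_ballx.
  move=> nb; have nU : nbhs p U by exact: open_nbhs_nbhs.
  apply: filterS (filterI nb (filterI (nbhs_dom cp) nU)) => q [].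
  rewrite /= -ball_normE /= distrC => hq [cq Uq].
  split=> //; rewrite /chi; case: pselect => // a; apply: step_ge1.
  suff : \sum_i (c q 0 i - x0 0 i) ^+ 2 / e ^+ 2 <= 1 by rewrite /phi; lra.
  have bi i : (c q 0 i - x0 0 i) ^+ 2 / e ^+ 2 <= n.+1%:R^-1.
    rewrite ler_pdivrMr ?exprn_gt0 //.
    have h1 : `|c q 0 i - x0 0 i| <= e / n.+1%:R.
      by apply: (le_trans _ (ltW hq)); have := coord_le_norm (c q - x0) i; rewrite !mxE.
    rewrite -[leLHS]real_normK ?num_real //.
    apply: (@le_trans _ _ ((e / n.+1%:R) ^+ 2)).
      by rewrite ler_pXn2r ?nnegrE // ltW.
    rewrite exprMn mulrC ler_wpM2r ?sqr_ge0 // -[leRHS]mulr1 expr2.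
    by rewrite ler_wpM2l // invf_le1 // ler1n.
  apply: (le_trans (ler_sum _ (fun i _ => bi i))).
  by rewrite sumr_const card_ord -[leLHS]mulr_natl ler_pdivrMr // mul1r ler_nat.
exists (mk_cinf schi), P°, K; split=> //.
- exact: open_interior.
- split; last by move=> q /KUc[].
  by move=> q /interior_subset[c1 _]; apply: contrapT => /chi0; rewrite c1 => /eqP; rewrite oner_eq0.
by split=> [q /interior_subset[]|].
Qed.

(** Off the open set where [f] is smooth the product vanishes on the open
    complement of [K]. *)
Lemma smooth_cutoff U K f (chi : cinf M) : open U -> closed K -> K `<=` U ->
  (forall q, ~ K q -> chi q = 0) -> smooth_on U f -> smooth (fun q => chi q * f q).
Proof.
move=> oU cK KU chi0 sf; apply: smooth_on_glue => q _.
have [Uq|nUq] := pselect (U q).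
  exists U, ((chi : M -> R) * f); split=> //; apply: smooth_onM => //.
  by apply: smooth_on_sub (cinf_smooth chi).
exists (~` K), (fun=> 0); split.
- exact: closed_openC.
- by move=> /KU.
- exact: smooth_on_cst.
- by move=> q' /chi0 ->; rewrite mul0r.
Qed.

Lemma smooth_on_extend U p f : open U -> U p -> smooth_on U f ->
  exists (g : cinf M) V, [/\ open V, V p, V `<=` U & forall q, V q -> g q = f q].
Proof.
move=> oU Up sf; have [chi [V [K [oV Vp cK [VK KU] [chi1 chi0]]]]] := bump oU Up.
exists (mk_cinf (smooth_cutoff oU cK KU chi0 sf)), V; split=> //.
- by move=> q /VK/KU.
- by move=> q /chi1 /= ->; rewrite mul1r.
Qed.
End SmoothFunctionTheory.

(** * Tangent vectors and coordinate frames *)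

Section TangentVectors.
Context {R : realType} {n : nat} (M : manifold R n).
Implicit Types (U V K : set M) (p q : M) (c d : chart R M n).

Lemma chart_at_atlas p : atlas (chart_at p).
Proof. exact: (svalP (cid (atlas_cover p))).1. Qed.

Lemma chart_at_dom p : cdom (chart_at p) p.
Proof. exact: (svalP (cid (atlas_cover p))).2. Qed.

(** The derivation [tder] on arbitrary functions, so that it applies to chart
    coordinates, which are only defined locally. *)
Definition tderf p (v : 'rV[R]_n) (g : M -> R) : R :=
  \sum_(i < n) v 0 i * partial i (g \o cinv (chart_at p)) (chart_at p p).

Lemma nbhs_cinv c p (P : set M) : cdom c p -> nbhs p P -> nbhs (c p) (cinv c @^-1` P).
Proof.
move=> cp nP; have cpi : (c @` cdom c) (c p) by exists p.
by apply: (cinv_continuous cpi); rewrite cfunK.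
Qed.

Lemma near_partial i c p (f g : M -> R) : cdom c p ->
  (\forall q \near p, f q = g q) ->
  partial i (f \o cinv c) (c p) = partial i (g \o cinv c) (c p).
Proof.
move=> cp fg; apply: near_eq_derive; exact: nbhs_cinv cp fg.
Qed.

(** Tangent vectors only see germs, so local functions may be replaced by global
    ones that agree with them nearby. *)
Lemma near_tderf p v (f g : M -> R) :
  (\forall q \near p, f q = g q) -> tderf p v f = tderf p v g.
Proof.
move=> fg; apply: eq_bigr => i _; congr (_ * _).
by apply: near_partial => //; exact: chart_at_dom.
Qed.

Lemma open_eq_near U p (f g : M -> R) : open U -> U p -> (forall q, U q -> f q = g q) ->
  \forall q \near p, f q = g q.
Proof. by move=> oU Up fg; apply: filterS (open_nbhs_nbhs (conj oU Up)). Qed.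

Lemma partial_coord i j c p : cdom c p ->
  partial j (fun x => c (cinv c x) 0 i) (c p) = (i == j)%:R.
Proof.
move=> cp; have [_ <-] := is_derive_coord i j (c p).
apply: near_eq_derive.
have : nbhs (c p) (c @` cdom c).
  by apply: open_nbhs_nbhs; split; [exact: cimg_open|exists p].
by apply: filterS => _ [q cq <-]; rewrite cfunK.
Qed.

(** The chain rule for a change of chart. *)
Lemma partial_transition c d U p (g : M -> R) j : atlas c -> atlas d ->
  cdom c p -> cdom d p -> open U -> U p -> smooth_on U g ->
  partial j (g \o cinv c) (c p) =
  \sum_i partial j (fun x => d (cinv c x) 0 i) (c p) * partial i (g \o cinv d) (d p).
Proof.
move=> Ac Ad cp dp oU Up sg.
have oI : open (cdom c `&` cdom d) by apply: openI; exact: cdom_open.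
have E : (g \o cinv d) \o (d \o cinv c) = ((g \o cinv d) \o d) \o cinv c by [].
transitivity (partial j ((g \o cinv d) \o (d \o cinv c)) (c p)).
  rewrite E; apply: near_partial => //.
  by apply: filterS (nbhs_dom dp) => q dq; rewrite /= cfunK.
have [_ H] : is_derive (c p) (delta_mx 0 j : 'rV[R]_n) ((g \o cinv d) \o (d \o cinv c))
    (\sum_i 'D_(delta_mx 0 j : 'rV[R]_n) (fun x => (d \o cinv c) x 0 i) (c p) *
      partial i (g \o cinv d) ((d \o cinv c) (c p))).
  apply: derive_chain => [i|].
    by apply: ((atlas_compat Ac Ad i 1%N).2 j).1; exists p.
  rewrite /= cfunK //.
  apply: (@C1_differentiable _ _ (d @` (U `&` cdom d))) => //.
  - exact: chart_image_open.
  - by exists p.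
  - exact: sg.
by rewrite /partial H /= cfunK.
Qed.

(** The coordinate vector field of the chart [c], expressed at [q] in the chart
    [chart_at q] that defines tangent vectors at [q]. *)
Definition dvec c (j : 'I_n) q : 'rV[R]_n :=
  \row_i partial j (fun x => chart_at q (cinv c x) 0 i) (c q).

Lemma tderf_dvec c U q (g : M -> R) j : atlas c -> cdom c q -> open U -> U q ->
  smooth_on U g -> tderf q (dvec c j q) g = partial j (g \o cinv c) (c q).
Proof.
move=> Ac cq oU Uq sg.
rewrite (partial_transition j Ac (chart_at_atlas q) cq (chart_at_dom q) oU Uq sg).
by apply: eq_bigr => i _; rewrite mxE.
Qed.

(** The coordinates of a tangent vector in the frame [dvec c] are its derivatives
    of the coordinate functions of [c]. *)
Definition tcoef c (i : 'I_n) q (v : 'rV[R]_n) : R := tderf q v (fun q => c q 0 i).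

Lemma tcoef_dvec c q i j : atlas c -> cdom c q -> tcoef c i q (dvec c j q) = (i == j)%:R.
Proof.
move=> Ac cq.
rewrite /tcoef (tderf_dvec _ Ac cq (cdom_open c) cq); last exact: smooth_coord.
by rewrite /comp partial_coord.
Qed.

(** The Jacobian matrices of the two changes of chart are inverse to each other. *)
Lemma dvec_expand c q (v : 'rV[R]_n) : atlas c -> cdom c q ->
  v = \sum_i tcoef c i q v *: dvec c i q.
Proof.
move=> Ac cq; apply/rowP => k; rewrite summxE.
set d := chart_at q; have Ad : atlas d := chart_at_atlas q.
have dq : cdom d q := chart_at_dom q.
have := fun j => partial_transition j Ad Ac dq cq (cdom_open d) dq (smooth_coord k Ad).
rewrite /comp => H.
transitivity (\sum_j v 0 j * (k == j)%:R).
  rewrite (bigD1 k) //= eqxx mulr1 big1 ?addr0 // => j.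
  by rewrite eq_sym => /negbTE ->; rewrite mulr0.
transitivity (\sum_j \sum_i v 0 j * (partial j (fun x => c (cinv d x) 0 i) (d q) *
    partial i (fun x => d (cinv c x) 0 k) (c q))).
  by apply: eq_bigr => j _; rewrite -mulr_sumr -H partial_coord.
rewrite exchange_big /=; apply: eq_bigr => i _.
rewrite !mxE /tcoef /tderf -/d mulr_suml; apply: eq_bigr => j _.
by rewrite mulrA.
Qed.

Lemma smooth_partial c U (g : M -> R) j : atlas c -> open U -> U `<=` cdom c ->
  smooth_on U g -> smooth_on U (fun q => partial j (g \o cinv c) (c q)).
Proof.
move=> Ac oU Uc sg; apply: (smooth_of_chart (g := partial j (g \o cinv c)) Ac oU Uc) => k.
by have := ((sg c Ac k.+1).2 j).2; rewrite (setIidl Uc).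
Qed.

(** The coordinate functions of [c] extend to global functions without change near
    a given point, and a vector field maps these to smooth functions. *)
Lemma vfield_coef (x : forall p, tangent M p) c i : atlas c -> is_vfield x ->
  smooth_on (cdom c) (fun q => tcoef c i q (x q)).
Proof.
move=> Ac hx; apply: smooth_on_glue => q cq.
have [f [V [oV Vq Vc fV]]] := smooth_on_extend (cdom_open c) cq (smooth_coord i Ac).
exists V, (fun q => tder q (x q) f); split=> //.
  by apply: smooth_on_sub (hx f).
move=> q' Vq'; rewrite /tcoef; apply/esym; apply: near_tderf.
exact: open_eq_near oV Vq' fV.
Qed.

Lemma tderf_coef c U q v (g : M -> R) : atlas c -> cdom c q -> open U -> U q ->
  smooth_on U g -> tderf q v g = \sum_i tcoef c i q v * partial i (g \o cinv c) (c q).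
Proof.
move=> Ac cq oU Uq sg; set d := chart_at q.
have Ad : atlas d := chart_at_atlas q; have dq : cdom d q := chart_at_dom q.
transitivity (\sum_j \sum_i v 0 j * (partial j (fun x => c (cinv d x) 0 i) (d q) *
    partial i (g \o cinv c) (c q))).
  apply: eq_bigr => j _; rewrite -mulr_sumr.
  by rewrite (partial_transition j Ad Ac dq cq oU Uq sg).
rewrite exchange_big /=; apply: eq_bigr => i _.
by rewrite /tcoef /tderf mulr_suml; apply: eq_bigr => j _; rewrite mulrA.
Qed.

Lemma vfield_from_coef (x : forall p, tangent M p) :
  (forall c, atlas c -> forall i, smooth_on (cdom c) (fun q => tcoef c i q (x q))) ->
  is_vfield x.
Proof.
move=> hx f; apply: smooth_on_glue => q _.
have [c [Ac cq]] := atlas_cover q.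
exists (cdom c), (fun q => \sum_i tcoef c i q (x q) * partial i (f \o cinv c) (c q)).
have oc := cdom_open c.
split=> //.
- apply: smooth_on_sum => // i _.
  apply: (smooth_onM oc (hx c Ac i)); apply: smooth_partial => //.
  by apply: smooth_on_sub (cinf_smooth f).
- move=> q' cq'; rewrite [LHS](@tderf_coef c setT) //; first exact: openT.
  exact: cinf_smooth.
Qed.

Definition tframe c : frame (tangent M) := @Frame R n M (tangent M) (cdom c) n (dvec c).

Lemma tcoefP c i q a v w : tcoef c i q (a *: v + w) = a * tcoef c i q v + tcoef c i q w.
Proof.
rewrite /tcoef /tderf mulr_sumr -big_split /=; apply: eq_bigr => j _.
by rewrite !mxE mulrDl mulrA.
Qed.

Lemma tcoef0 c i q : tcoef c i q 0 = 0.
Proof. by rewrite /tcoef /tderf big1 // => j _; rewrite mxE mul0r. Qed.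

Lemma tcoef_sum c q (a : 'I_n -> R) i : atlas c -> cdom c q ->
  tcoef c i q (\sum_j a j *: dvec c j q) = a i.
Proof.
move=> Ac cq.
have L (r : seq 'I_n) : tcoef c i q (\sum_(j <- r) a j *: dvec c j q) =
    \sum_(j <- r) a j * tcoef c i q (dvec c j q).
  elim: r => [|j r IH]; first by rewrite !big_nil tcoef0.
  by rewrite !big_cons tcoefP IH.
rewrite L (bigD1 i) //= tcoef_dvec // eqxx mulr1 big1 ?addr0 // => j.
by rewrite tcoef_dvec // eq_sym => /negbTE ->; rewrite mulr0.
Qed.

(** Charts give local frames; everything proved below for vector bundles thus
    applies to vector fields. *)
Lemma tangent_vbundle : is_vbundle (tangent M).
Proof.
exists (tframe @` @atlas R n M); split; first split.
- by move=> _ [c _ <-]; exact: cdom_open.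
- by move=> p; have [c [Ac cp]] := atlas_cover p; exists (tframe c); split=> //; exists c.
- move=> _ [c Ac <-] p /= cp v; exists (\row_i tcoef c i p v); split.
    rewrite [LHS](@dvec_expand c p) //; apply: eq_bigr => i _.
    by rewrite mxE.
  by move=> a ->; apply/rowP => i; rewrite mxE tcoef_sum.
- move=> _ _ [c Ac <-] [d Ad <-] i /=.
  exists (fun k q => partial i (fun x => d (cinv c x) 0 k) (c q)); split.
    move=> k; apply: (@smooth_partial c _ (fun q => d q 0 k)) => //.
      by apply: openI; exact: cdom_open.
    by apply: smooth_on_sub (smooth_coord k Ad); exact: subIsetr.
  move=> q [cq dq]; rewrite [LHS](@dvec_expand d q) //; apply: eq_bigr => k _.
  congr (_ *: _); rewrite /tcoef (tderf_dvec i Ac cq (cdom_open d) dq) //.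
  exact: smooth_coord.
move=> s; split=> [hs _ [c Ac <-]|hs].
  exists (fun i q => tcoef c i q (s q)); split=> [i|q /= cq].
    exact: vfield_coef.
  by rewrite [LHS](@dvec_expand c q).
apply: vfield_from_coef => c Ac i.
have [a [sa ea]] := hs _ (ex_intro2 _ _ c Ac erefl).
apply: (smooth_on_eq (cdom_open c) _ (sa i)) => q cq.
by rewrite ea //= tcoef_sum.
Qed.

Lemma partialD c p U (f g : M -> R) i : atlas c -> cdom c p -> open U -> U p ->
  smooth_on U f -> smooth_on U g ->
  partial i ((f + g) \o cinv c) (c p) =
  partial i (f \o cinv c) (c p) + partial i (g \o cinv c) (c p).
Proof.
move=> Ac cp oU Up sf sg.
have W : (c @` (U `&` cdom c)) (c p) by exists p.
by apply: deriveD; [apply: ((sf c Ac 1%N).2 i).1 W|apply: ((sg c Ac 1%N).2 i).1 W].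
Qed.

Lemma partialM c p U (f g : M -> R) i : atlas c -> cdom c p -> open U -> U p ->
  smooth_on U f -> smooth_on U g ->
  partial i ((f * g) \o cinv c) (c p) =
  f p * partial i (g \o cinv c) (c p) + g p * partial i (f \o cinv c) (c p).
Proof.
move=> Ac cp oU Up sf sg.
have W : (c @` (U `&` cdom c)) (c p) by exists p.
have dE := @deriveM _ _ (f \o cinv c) (g \o cinv c) (c p) (delta_mx 0 i).
rewrite /partial [LHS]dE.
- by rewrite /= cfunK.
- exact: ((sf c Ac 1%N).2 i).1 W.
- exact: ((sg c Ac 1%N).2 i).1 W.
Qed.

Lemma tderD p v (f g : cinf M) : tder p v (f + g) = tder p v f + tder p v g.
Proof.
rewrite /tder -big_split /=; apply: eq_bigr => i _; rewrite -mulrDr; congr (_ * _).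
apply: (@partialD _ _ setT) => //; [exact: chart_at_atlas|exact: chart_at_dom|
  exact: openT|exact: cinf_smooth|exact: cinf_smooth].
Qed.

Lemma tderM p v (f g : cinf M) : tder p v (f * g) = f p * tder p v g + g p * tder p v f.
Proof.
rewrite /tder !mulr_sumr -big_split /=; apply: eq_bigr => i _.
rewrite [f p * _]mulrCA [g p * _]mulrCA -mulrDr; congr (_ * _).
apply: (@partialM _ _ setT) => //; [exact: chart_at_atlas|exact: chart_at_dom|
  exact: openT|exact: cinf_smooth|exact: cinf_smooth].
Qed.

Lemma tder_cst p v a : tder p v (cstC M a) = 0.
Proof.
rewrite /tder big1 // => i _; rewrite /partial.
by rewrite (_ : _ \o _ = cst a) // derive_cst mulr0.
Qed.
End TangentVectors.

(** * Sections of vector bundles and tensoriality *)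

Section Sections.
Context {R : realType} {n : nat} {M : manifold R n}.
Implicit Types (V : vfamily M) (p q : M).

Lemma secD V (s t : section V) p : (s + t) p = s p + t p.
Proof. exact: sec_addE. Qed.
Lemma secN V (s : section V) p : (- s) p = - s p.
Proof. exact: sec_oppE. Qed.
Lemma secB V (s t : section V) p : (s - t) p = s p - t p.
Proof. by rewrite secD secN. Qed.
Lemma secZ V (f : cinf M) (s : section V) p : (f *: s) p = f p *: s p.
Proof. exact: sec_scaleE. Qed.

Lemma sec_sum V (I : Type) (r : seq I) (P : pred I) (F : I -> section V) p :
  (\sum_(i <- r | P i) F i) p = \sum_(i <- r | P i) F i p.
Proof.
elim: r => [|i r IH]; first by rewrite !big_nil.
by rewrite !big_cons; case: ifP => _; rewrite ?secD IH.
Qed.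

(** Linearity over the ring of smooth functions, in the unbundled form in which
    maps between modules of sections are produced below. *)
Definition clin V (W : vfamily M) (L : section V -> section W) :=
  forall (f : cinf M) s t, L (f *: s + t) = f *: L s + L t.
Definition clinf V (L : section V -> cinf M) :=
  forall (f : cinf M) s t, L (f *: s + t) = f * L s + L t.

Lemma clin0 V (W : vfamily M) (L : section V -> section W) : clin L -> L 0 = 0.
Proof.
move=> hL; have := hL (-1) 0 0; rewrite scaler0 addr0 scaleN1r => E.
by rewrite E addNr.
Qed.
Lemma clinD V (W : vfamily M) (L : section V -> section W) : clin L -> {morph L : s t / s + t}.
Proof. by move=> hL s t; have := hL 1 s t; rewrite !scale1r. Qed.
Lemma clinZ V (W : vfamily M) (L : section V -> section W) f s : clin L -> L (f *: s) = f *: L s.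
Proof. by move=> hL; have := hL f s 0; rewrite (clin0 hL) !addr0. Qed.
Lemma clinB V (W : vfamily M) (L : section V -> section W) : clin L -> {morph L : s t / s - t}.
Proof. by move=> hL s t; rewrite (clinD hL) -scaleN1r (clinZ _ _ hL) scaleN1r. Qed.
Lemma clin_sum V (W : vfamily M) (L : section V -> section W) (I : Type) (r : seq I)
  (F : I -> section V) : clin L -> L (\sum_(i <- r) F i) = \sum_(i <- r) L (F i).
Proof.
move=> hL; elim: r => [|i r IH]; first by rewrite !big_nil (clin0 hL).
by rewrite !big_cons (clinD hL) IH.
Qed.
Lemma clinf0 V (L : section V -> cinf M) : clinf L -> L 0 = 0.
Proof.
move=> hL; have := hL (-1) 0 0; rewrite scaler0 addr0 mulN1r => E.
by rewrite E addNr.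
Qed.
Lemma clinfD V (L : section V -> cinf M) : clinf L -> {morph L : s t / s + t}.
Proof. by move=> hL s t; have := hL 1 s t; rewrite !(scale1r, mul1r). Qed.
Lemma clinfZ V (L : section V -> cinf M) f s : clinf L -> L (f *: s) = f * L s.
Proof. by move=> hL; have := hL f s 0; rewrite (clinf0 hL) !addr0. Qed.
Lemma clinfN V (L : section V -> cinf M) : clinf L -> {morph L : s / - s}.
Proof. by move=> hL s; rewrite -scaleN1r (clinfZ _ _ hL) mulN1r. Qed.
Lemma clinfB V (L : section V -> cinf M) : clinf L -> {morph L : s t / s - t}.
Proof. by move=> hL s t; rewrite (clinfD hL) (clinfN hL). Qed.
Lemma clinf_sum V (L : section V -> cinf M) (I : Type) (r : seq I)
  (F : I -> section V) : clinf L -> L (\sum_(i <- r) F i) = \sum_(i <- r) L (F i).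
Proof.
move=> hL; elim: r => [|i r IH]; first by rewrite !big_nil (clinf0 hL).
by rewrite !big_cons (clinfD hL) IH.
Qed.

(** A frame over [W] made of global sections, in which global sections have
    smooth coefficients. *)
Definition lbasis V (W : set M) r (t : 'I_r -> section V) :=
  [/\ open W,
      forall q, W q -> forall v : V q, exists a : 'I_r -> R, v = \sum_i a i *: t i q,
      forall q, W q -> forall a b : 'I_r -> R,
        \sum_i a i *: t i q = \sum_i b i *: t i q -> forall i, a i = b i &
      forall s : section V, exists a : 'I_r -> M -> R,
        (forall i, smooth_on W (a i)) /\
        forall q, W q -> s q = \sum_i a i q *: t i q].

Section VectorBundle.
Variable V : vfamily M.
Hypothesis vbV : is_vbundle V.

(** Near each point the coefficients of [s] in a local frame are those of a
    section. *)
Lemma section_local (s : forall p, V p) :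
  (forall p, exists W (t : section V), [/\ open W, W p & forall q, W q -> s q = t q]) ->
  is_section s.
Proof.
move=> loc; have [A [[Ao Acov Auniq Atrans] secE]] := vbV.
apply/secE => F AF.
have co q : exists a : 'I_(frank F) -> R,
    fdom F q -> s q = \sum_i a i *: fvec i q.
  have [Fq|nFq] := pselect (fdom F q); last by exists (fun=> 0).
  by have [a [ea _]] := Auniq F AF q Fq (s q); exists (a 0).
have [a ha] := choice co.
exists (fun i q => a q i); split=> // i.
apply: smooth_on_glue => q Fq; have [W [t [oW Wq st]]] := loc q.
have [b [sb tb]] := (secE t).1 (sectionP t) F AF.
exists (W `&` fdom F), (b i); split=> //.
- by apply: openI => //; exact: Ao.
- by apply: smooth_on_sub (sb i); exact: subIsetr.
move=> q' [Wq' Fq'].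
have [c [_ uc]] := Auniq F AF q' Fq' (s q').
have c1 : c = \row_j a q' j.
  by apply: uc; rewrite (ha q' Fq'); apply: eq_bigr => j _; rewrite mxE.
have c2 : c = \row_j b j q'.
  by apply: uc; rewrite (st q' Wq') (tb q' Fq'); apply: eq_bigr => j _; rewrite mxE.
by move: c1; rewrite c2 => /rowP/(_ i); rewrite !mxE.
Qed.

(** Local frames, cut off by a bump function, become families of global
    sections. *)
Lemma vbundle_basis p : exists (W : set M) r (t : 'I_r -> section V),
  W p /\ lbasis W t.
Proof.
have [A [[Ao Acov Auniq Atrans] secE]] := vbV.
have [F [AF Fp]] := Acov p.
have [chi [W [K [oW Wp cK [WK KF] [chi1 chi0]]]]] := bump (Ao F AF) Fp.
have sec (i : 'I_(frank F)) : is_section (v := V) (fun q => chi q *: fvec i q).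
  apply/secE => G AG; have [b [sb eb]] := Atrans F G AF AG i.
  exists (fun j q => chi q * b j q); split=> [j|q Gq].
    apply: smooth_on_glue => q Gq; have [Fq|nFq] := pselect (fdom F q).
      exists (fdom F `&` fdom G), ((chi : M -> R) * b j); split=> //.
        by apply: openI; exact: Ao.
      apply: smooth_onM; [by apply: openI; exact: Ao| |exact: sb].
      by apply: smooth_on_sub (cinf_smooth chi).
    exists (~` K), (fun=> 0); split.
    - exact: closed_openC.
    - by move=> /KF.
    - exact: smooth_on_cst.
    - by move=> q' /chi0 ->; rewrite mul0r.
  have [Fq|nFq] := pselect (fdom F q).
    by rewrite eb // scaler_sumr; apply: eq_bigr => j _; rewrite scalerA.
  have -> : chi q = 0 by apply: chi0 => /KF.
  by rewrite scale0r big1 // => j _; rewrite mul0r scale0r.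
exists W, (frank F), (fun i => Section_ (sec i)); split=> //.
have tE q i : W q -> Section_ (sec i) q = fvec i q.
  by move=> Wq; rewrite /= chi1 // scale1r.
have sumE q (a : 'I_(frank F) -> R) : W q ->
    \sum_i a i *: Section_ (sec i) q = \sum_i a i *: fvec i q.
  by move=> Wq; apply: eq_bigr => i _; rewrite tE.
split=> //.
- move=> q Wq v; have [a [ea _]] := Auniq F AF q (KF _ (WK _ Wq)) v.
  by exists (a 0); rewrite sumE.
- move=> q Wq a b; rewrite !sumE // => ab.
  have [c [_ uc]] := Auniq F AF q (KF _ (WK _ Wq)) (\sum_i a i *: fvec i q).
  have c1 : c = \row_j a j by apply: uc; apply: eq_bigr => j _; rewrite mxE.
  have c2 : c = \row_j b j by apply: uc; rewrite ab; apply: eq_bigr => j _; rewrite mxE.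
  by move=> i; move: c1; rewrite c2 => /rowP/(_ i); rewrite !mxE.
- move=> s; have [a [sa ea]] := (secE s).1 (sectionP s) F AF.
  exists a; split=> [i|q Wq]; first by apply: smooth_on_sub (sa i) => q /WK/KF.
  by rewrite sumE // ea //; exact: KF (WK _ Wq).
Qed.

Lemma section_ext p (v : V p) : exists s : section V, s p = v.
Proof.
have [W [r [t [Wp [_ gen _ _]]]]] := vbundle_basis p.
have [a ->] := gen p Wp v; exists (\sum_i cstC M (a i) *: t i).
by rewrite sec_sum; apply: eq_bigr => i _; rewrite secZ.
Qed.

Lemma lbasis_section W r (t : 'I_r -> section V) p (a : 'I_r -> M -> R) :
  lbasis W t -> W p -> (forall i, smooth_on W (a i)) ->
  exists (s : section V) W', [/\ open W', W' p, W' `<=` W &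
    forall q, W' q -> s q = \sum_i a i q *: t i q].
Proof.
move=> [oW _ _ _] Wp sa.
have [chi [W' [K [oW' Wp' cK [WK KW] [chi1 chi0]]]]] := bump oW Wp.
exists (\sum_i mk_cinf (smooth_cutoff oW cK KW chi0 (sa i)) *: t i), W'.
split=> //; first by move=> q /WK/KW.
by move=> q Wq; rewrite sec_sum; apply: eq_bigr => i _; rewrite secZ /= chi1 // mul1r.
Qed.

(** Near [p] the coefficients of [s] in a frame vanish at [p]; after cutting off
    they become global functions. This is the reason why maps that are linear over
    the smooth functions are tensorial. *)
Lemma section_vanish (s : section V) p : s p = 0 ->
  exists (chi : cinf M) r (a : 'I_r -> cinf M) (t : 'I_r -> section V),
    [/\ chi p = 1, chi *: s = \sum_i a i *: t i & forall i, a i p = 0].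
Proof.
move=> sp; have [W [r [t [Wp [oW gen uniq coef]]]]] := vbundle_basis p.
have [chi [W' [K [oW' Wp' cK [WK KW] [chi1 chi0]]]]] := bump oW Wp.
have [a [sa ea]] := coef s.
exists chi, r, (fun i => mk_cinf (smooth_cutoff oW cK KW chi0 (sa i))), t.
split; first exact: chi1.
  apply: section_eq => q; rewrite sec_sum secZ.
  have [Wq|nWq] := pselect (W q).
    by rewrite ea // scaler_sumr; apply: eq_bigr => i _; rewrite secZ scalerA.
  have c0 : chi q = 0 by apply: chi0 => /KW.
  by rewrite c0 scale0r big1 // => i _; rewrite secZ /= c0 mul0r scale0r.
move=> i /=; rewrite (uniq p Wp (a ^~ p) (fun=> 0)) ?mulr0 //.
by rewrite -ea // sp big1 // => j _; rewrite scale0r.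
Qed.

Lemma clin_tensor (W : vfamily M) (L : section V -> section W) (s : section V) p :
  clin L -> s p = 0 -> L s p = 0.
Proof.
move=> hL /section_vanish[chi [r [a [t [c1 E a0]]]]].
have : L (chi *: s) p = 0.
  rewrite E clin_sum // sec_sum big1 // => i _.
  by rewrite clinZ // secZ a0 scale0r.
by rewrite clinZ // secZ c1 scale1r.
Qed.

Lemma clinf_tensor (L : section V -> cinf M) (s : section V) p :
  clinf L -> s p = 0 -> L s p = 0.
Proof.
move=> hL /section_vanish[chi [r [a [t [c1 E a0]]]]].
have : L (chi *: s) p = 0.
  rewrite E clinf_sum // cinf_sum big1 // => i _.
  by rewrite clinfZ // cinfM a0 mul0r.
by rewrite clinfZ // cinfM c1 mul1r.
Qed.

Lemma clin_point (W : vfamily M) (L : section V -> section W) (s t : section V) p :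
  clin L -> s p = t p -> L s p = L t p.
Proof.
move=> hL st; apply/eqP; rewrite -subr_eq0 -secB -clinB //.
by rewrite (clin_tensor hL) // secB st subrr.
Qed.

Lemma clinf_point (L : section V -> cinf M) (s t : section V) p :
  clinf L -> s p = t p -> L s p = L t p.
Proof.
move=> hL st; apply/eqP; rewrite -subr_eq0.
have := clinf_tensor (s := s - t) (p := p) hL; rewrite secB st subrr clinfB //.
by move=> /(_ erefl) /= <-.
Qed.

(** A section through a given vector. The values at [p] of tensorial maps do not
    depend on the choice. *)
Definition ext p (v : V p) : section V := sval (cid (section_ext v)).
Lemma extE p (v : V p) : ext v p = v.
Proof. exact: (svalP (cid (section_ext v))). Qed.

Lemma clinf_ext_linear (L : section V -> cinf M) p : clinf L ->
  linear (fun v : V p => L (ext v) p : R^o).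
Proof.
move=> hL a u v; rewrite -[RHS]/((cstC M a * L (ext u) + L (ext v)) p) -hL.
by apply: clinf_point => //; rewrite secD secZ !extE.
Qed.

Section MkBundleMap.
Variables (W : vfamily M) (L : section V -> section W).
Hypothesis hL : clin L.

Definition point_map p (v : V p) : W p := L (ext v) p.

Lemma point_map_linear p : linear (@point_map p).
Proof.
move=> a u v; rewrite /point_map -[a *: L _ p]/(cstC M a p *: L (ext u) p) -secZ -secD -hL.
by apply: clin_point => //; rewrite secD secZ !extE.
Qed.

HB.instance Definition _ p :=
  GRing.isLinear.Build R (V p) (W p) _ (@point_map p) (@point_map_linear p).

Lemma point_mapE (s : section V) p : point_map (s p) = L s p.
Proof. by apply: clin_point => //; rewrite extE. Qed.

(** Bundle maps are the same as maps of sections that are linear over the smooth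
    functions. The algebra below is therefore done with sections only. *)
Lemma clin_bundle_map : exists F : bundle_map V W, forall s, push F s = L s.
Proof.
have sm (s : section V) :
    is_section (fun p => (@point_map p : {linear V p -> W p}) (s p)).
  have -> : (fun p => point_map (s p)) = L s.
    by apply: functional_extensionality_dep => p; exact: point_mapE.
  exact: sectionP.
exists (BundleMap sm) => s; apply: section_eq => p.
exact: point_mapE.
Qed.
End MkBundleMap.
End VectorBundle.

Lemma clin_push V (W : vfamily M) (F : bundle_map V W) : clin (push F).
Proof.
move=> f s t; apply: section_eq => p.
by rewrite secD secZ /= addr0 scale1r linearP.
Qed.

Lemma smooth_det (U : set M) r (Q : M -> 'M[R]_r) : open U ->
  (forall i j, smooth_on U (fun q => Q q i j)) -> smooth_on U (fun q => \det (Q q)).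
Proof.
move=> oU sQ; apply: smooth_on_sum => // s _.
by apply: (smooth_onM oU (smooth_on_cst U _)); apply: smooth_on_prod.
Qed.

(** Cramer's rule. *)
Lemma smooth_invmx (U : set M) r (Q : M -> 'M[R]_r) : open U ->
  (forall q, U q -> Q q \in unitmx) ->
  (forall i j, smooth_on U (fun q => Q q i j)) ->
  forall i j, smooth_on U (fun q => invmx (Q q) i j).
Proof.
move=> oU uQ sQ i j.
have sdet := smooth_det oU sQ.
have sadj : smooth_on U (fun q => \adj (Q q) i j).
  apply: (@smooth_on_eq _ _ _ _ (fun q => (-1) ^+ (j + i) * \det (row' j (col' i (Q q))))) => //.
    by move=> q _; rewrite !mxE.
  apply: (smooth_onM oU (smooth_on_cst U _)); apply: smooth_det => // k l.
  apply: (smooth_on_eq oU _ (sQ (lift j k) (lift i l))) => q _.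
  by rewrite !mxE.
have sV : smooth_on U (fun q => (\det (Q q))^-1).
  by apply: smooth_onV => // q /uQ; rewrite unitmxE unitfE.
apply: (smooth_on_eq oU _ (smooth_onM oU sV sadj)) => q Uq.
by rewrite /invmx uQ // mxE.
Qed.
End Sections.

(** * Nondegenerate forms and 1-forms *)

Section OneForms.
Context {R : realType} {n : nat} {M : manifold R n}.

(** Likewise 1-forms are the same as function-valued maps of vector fields that are
    linear over the smooth functions. *)
Lemma clinf_oneform (L : vfield M -> cinf M) : clinf L ->
  exists xi : oneform M, forall (x : vfield M) p, xi p (x p) = L x p.
Proof.
move=> hL; have vb := tangent_vbundle M.
pose lin p : {linear 'rV[R]_n -> R^o} := HB.pack (fun v : 'rV[R]_n => L (ext vb (p := p) v) p : R^o)
  (GRing.isLinear.Build R 'rV[R]_n R^o _ _ (clinf_ext_linear vb (p := p) hL)).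
have E (x : vfield M) p : (linfun (lin p) : covector) (x p) = L x p.
  by rewrite lfunE /=; apply: (clinf_point vb) => //; rewrite extE.
have sm : is_section (v := cotangent M) (fun p => linfun (lin p) : covector).
  move=> x; rewrite (_ : (fun _ => _) = L x); first exact: cinf_smooth.
  by apply/funext => p; exact: E.
by exists (Section_ sm).
Qed.
End OneForms.

Section FormTheory.
Context {R : realType} {n : nat} {M : manifold R n}.
Implicit Types (p q : M) (x y : vfield M).

Lemma lie_lin (f : cinf M) x y g : lie (f *: x + y) g = f * lie x g + lie y g.
Proof. by apply: cinf_eq => p; rewrite -[LHS]/(tder p ((f *: x + y) p) g) secD secZ tderP. Qed.

Lemma lieD x (f g : cinf M) : lie x (f + g) = lie x f + lie x g.
Proof. by apply: cinf_eq => p; rewrite -[LHS]/(tder p (x p) (f + g)) tderD. Qed.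

Lemma lieM x (f g : cinf M) : lie x (f * g) = f * lie x g + g * lie x f.
Proof. by apply: cinf_eq => p; rewrite -[LHS]/(tder p (x p) (f * g)) tderM. Qed.

Lemma lie_cst x (a : R) : lie x (cstC M a) = 0.
Proof. by apply: cinf_eq => p; exact: tder_cst. Qed.

Lemma lieZ x (a : R) (f : cinf M) : lie x (cstC M a * f) = cstC M a * lie x f.
Proof. by rewrite lieM lie_cst mulr0 addr0. Qed.

Lemma lieN x (f : cinf M) : lie x (- f) = - lie x f.
Proof.
have E (g : cinf M) : - g = cstC M (-1) * g by apply: cinf_eq => p; rewrite cinfM /= mulN1r.
by rewrite E lieZ -E.
Qed.

Lemma lie0 x : lie x 0 = 0 :> cinf M.
Proof. by rewrite -[RHS](lie_cst x 0); congr lie; exact: cinf_eq. Qed.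

Lemma lieBl x y (f : cinf M) : lie (x - y) f = lie x f - lie y f.
Proof. by rewrite addrC -scaleN1r lie_lin mulN1r addrC. Qed.

Variable E : psa_data M.

Lemma formD p (u v w : E p) : form (u + v) w = form u w + form v w.
Proof. by have := form_linear 1 u v w; rewrite scale1r mul1r. Qed.
Lemma form0 p (w : E p) : form 0 w = 0.
Proof. by apply: (addrI (form 0 w)); rewrite -formD !addr0. Qed.
Lemma formZ p a (u w : E p) : form (a *: u) w = a * form u w.
Proof. by have := form_linear a u 0 w; rewrite form0 !addr0. Qed.
Lemma form_linearr p a (u v w : E p) : form w (a *: u + v) = a * form w u + form w v.
Proof. by rewrite form_skew form_linear opprD -mulrN -!form_skew. Qed.
Lemma form0r p (w : E p) : form w 0 = 0.
Proof. by rewrite form_skew form0 oppr0. Qed.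
Lemma formN p (u w : E p) : form (- u) w = - form u w.
Proof. by rewrite -scaleN1r formZ mulN1r. Qed.

Lemma form_sum p (I : Type) (r : seq I) (a : I -> R) (t : I -> E p) w :
  form (\sum_(i <- r) a i *: t i) w = \sum_(i <- r) a i * form (t i) w.
Proof.
elim: r => [|i r IH]; first by rewrite !big_nil form0.
by rewrite !big_cons form_linear IH.
Qed.

Lemma form_sumr p (I : Type) (r : seq I) (a : I -> R) (t : I -> E p) w :
  form w (\sum_(i <- r) a i *: t i) = \sum_(i <- r) a i * form w (t i).
Proof.
elim: r => [|i r IH]; first by rewrite !big_nil form0r.
by rewrite !big_cons form_linearr IH.
Qed.

Lemma form_inj p (u v : E p) : (forall w, form u w = form v w) -> u = v.
Proof.
move=> uv; apply/eqP; rewrite -subr_eq0; apply/eqP/form_nondegenerate => w.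
by rewrite formD formN uv subrr.
Qed.

Lemma pairing_clin (e : section E) : clinf (fun s => pairing s e).
Proof. by move=> f s t; apply: cinf_eq => p; rewrite /= addr0 scale1r form_linear. Qed.
Lemma pairing_clinr (e : section E) : clinf (pairing e).
Proof. by move=> f s t; apply: cinf_eq => p; rewrite /= addr0 scale1r form_linearr. Qed.
Lemma pairing_skew (e e' : section E) : pairing e e' = - pairing e' e.
Proof. by apply: cinf_eq => p; rewrite /= form_skew. Qed.

Let vbE := psa_vbundle E.

Lemma pairing_inj (e e' : section E) :
  (forall d, pairing e d = pairing e' d) -> e = e'.
Proof.
move=> H; apply: section_eq => p; apply: form_inj => w.
by rewrite -(extE vbE w); have := congr1 (fun f : cinf M => f p) (H (ext vbE w)).
Qed.

(** The Gram matrix of a basis is invertible as the form is nondegenerate, so a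
    linear functional [l] is represented by the vector with the coordinates
    [l t *m Q^-1]. *)
Definition gram p r (t : 'I_r -> E p) : 'M[R]_r := \matrix_(i, j) form (t i) (t j).

Lemma gram_unit p r (t : 'I_r -> E p) :
  (forall v, exists a : 'I_r -> R, v = \sum_i a i *: t i) ->
  (forall a b : 'I_r -> R, \sum_i a i *: t i = \sum_i b i *: t i ->
     forall i, a i = b i) -> gram t \in unitmx.
Proof.
move=> gen uniq; rewrite unitmxE unitfE; apply/negP => /det0P[a a0 aQ].
case/eqP: a0; apply/rowP => i; rewrite [RHS]mxE.
apply: (uniq (a 0) (fun=> 0)); rewrite [RHS]big1 => [|j _]; last by rewrite scale0r.
apply: form_nondegenerate => v; have [b ->] := gen v.
rewrite form_sumr big1 // => j _; apply/eqP; rewrite mulf_eq0; apply/orP; right.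
move/rowP: aQ => /(_ j); rewrite !mxE => aQ; rewrite form_sum -[X in _ == X]aQ.
by apply/eqP; apply: eq_bigr => k _; rewrite mxE.
Qed.

Lemma gram_represent p r (t : 'I_r -> E p) (l : 'I_r -> R) j : gram t \in unitmx ->
  form (\sum_i ((\row_k l k) *m invmx (gram t)) 0 i *: t i) (t j) = l j.
Proof.
move=> uQ; rewrite form_sum.
transitivity (((\row_k l k) *m invmx (gram t) *m gram t) 0 j).
  by rewrite [RHS]mxE; apply: eq_bigr => i _; congr (_ * _); rewrite mxE.
by rewrite mulmxKV // mxE.
Qed.

Lemma lbasis_gram_unit W r (t : 'I_r -> section E) q :
  lbasis W t -> W q -> gram (fun i => t i q) \in unitmx.
Proof. by move=> [oW gen uniq _] Wq; apply: gram_unit; [exact: gen|exact: uniq]. Qed.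

Lemma riesz_point p (l : E p -> R) :
  (forall a u v, l (a *: u + v) = a * l u + l v) -> exists u, forall v, form u v = l v.
Proof.
move=> hl; have [W [r [t [Wp bt]]]] := vbundle_basis vbE p.
have uQ := lbasis_gram_unit bt Wp.
pose u := \sum_i ((\row_k l (t k p)) *m invmx (gram (fun i => t i p))) 0 i *: t i p.
exists u => v; have [oW gen _ _] := bt; have [b ->] := gen p Wp v.
have l0 : l 0 = 0.
  by have := hl (-1) 0 0; rewrite scaler0 addr0 mulN1r addNr.
have lsum (s : seq 'I_r) : l (\sum_(i <- s) b i *: t i p) =
    \sum_(i <- s) b i * l (t i p).
  by elim: s => [|i s IH]; rewrite ?big_nil ?l0 // !big_cons hl IH.
rewrite lsum form_sumr; apply: eq_bigr => j _.
by rewrite (gram_represent (fun k => l (t k p))).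
Qed.

(** Nondegeneracy represents [L] at each point; the coordinates of the representing
    vectors in a frame are given by the inverse of the Gram matrix, so they are
    smooth. *)
Lemma riesz (L : section E -> cinf M) : clinf L ->
  exists d : section E, forall e, pairing d e = L e.
Proof.
move=> hL.
have pt q : exists u : E q, forall e : section E, form u (e q) = L e q.
  have [u hu] := riesz_point (clinf_ext_linear vbE (p := q) hL).
  exists u => e; rewrite hu; apply: (clinf_point vbE hL).
  by rewrite extE.
have [d hd] : exists d : forall q, E q, forall q (e : section E), form (d q) (e q) = L e q.
  by exists (fun q => sval (cid (pt q))) => q; exact: (svalP (cid (pt q))).
have sd : is_section d.
  apply: (section_local vbE) => p.
  have [W [r [t [Wp bt]]]] := vbundle_basis vbE p; have [oW gen uniq _] := bt.
  pose a (i : 'I_r) (q : M) : R :=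
    ((\row_k L (t k) q) *m invmx (gram (fun i => t i q))) 0 i.
  have sa i : smooth_on W (a i).
    apply: (@smooth_on_eq _ _ _ _ (fun q => \sum_k L (t k) q *
        invmx (gram (fun i => t i q)) k i)) => //.
      by move=> q _; rewrite /a mxE; apply: eq_bigr => k _; rewrite mxE.
    apply: smooth_on_sum => // k _; apply: (smooth_onM oW).
      by apply: smooth_on_sub (cinf_smooth (L (t k))).
    apply: (smooth_invmx oW) => [q Wq|i' j']; first exact: (lbasis_gram_unit bt Wq).
    apply: (@smooth_on_eq _ _ _ _ (pairing (t i') (t j'))) => //.
      by move=> q _; rewrite mxE.
    by apply: smooth_on_sub (cinf_smooth _).
  have [s [W' [oW' Wp' WW es]]] := lbasis_section bt Wp sa.
  exists W', s; split=> // q Wq; rewrite es //.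
  apply: form_inj => w; have [b ->] := gen q (WW q Wq) w.
  rewrite !form_sumr; apply: eq_bigr => j _; congr (_ * _).
  rewrite hd (gram_represent (fun k => L (t k) q)) //.
  by apply: lbasis_gram_unit bt _; exact: WW.
by exists (Section_ sd) => e; apply: cinf_eq => q; rewrite /= hd.
Qed.

Lemma rho_clin : clin (@rho _ _ _ E).
Proof. exact: clin_push. Qed.

Lemma rhoD (e e' : section E) : rho (e + e') = rho e + rho e'.
Proof. exact: (clinD rho_clin). Qed.
Lemma rhoB (e e' : section E) : rho (e - e') = rho e - rho e'.
Proof. exact: (clinB rho_clin). Qed.

(** In particular the section [D f] exists. *)
Lemma pairing_D (f : cinf M) (e : section E) : pairing (D E f) e = lie (rho e) f.
Proof.
rewrite /D; case: xgetP => [d -> /(_ e) //|nex].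
exfalso; have [] := @riesz (fun e => lie (rho e) f); last by move=> d /nex.
by move=> g s t; rewrite rho_clin lie_lin.
Qed.

Lemma form_rho_star p (xi : covector) (v : E p) :
  form (rho_star E p xi) v = xi (anchor E p v).
Proof.
rewrite /rho_star; case: xgetP => [u -> /(_ v) //|nex].
exfalso; have [] := @riesz_point p (fun v => xi (anchor E p v)); last by move=> d /nex.
by move=> a u w; rewrite !linearP.
Qed.

(** The section that represents [L \o rho] is at each point the image under
    [rho_star] of a covector. *)
Lemma rho_star_section (L : vfield M -> cinf M) :
  (forall p (xi : covector), anchor E p (rho_star E p xi) = 0) -> clinf L ->
  exists d : section E, (forall e, pairing d e = L (rho e)) /\ rho d = 0.
Proof.
move=> ars hL; have [d hd] : exists d : section E, forall e, pairing d e = L (rho e).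
  by apply: riesz => f e e'; rewrite rho_clin hL.
exists d; split=> //; have [xi hxi] := clinf_oneform hL.
apply: section_eq => p; rewrite -[LHS]/(anchor E p (d p)).
rewrite (_ : d p = rho_star E p (xi p)) ?ars //; apply: form_inj => w.
rewrite form_rho_star -(extE (psa_vbundle E) w).
by rewrite -[RHS]/(xi p (rho (ext (psa_vbundle E) w) p)) hxi -hd.
Qed.
End FormTheory.

(** * Existence of isotropic splittings *)

Section SplittingExistence.
Context {R : realType} {n : nat} {M : manifold R n}.
Implicit Types (p q : M) (x y : vfield M).

(** Being a frame is an open condition: the transition matrix to a given frame is
    invertible near a point where it is the identity. *)
Lemma lbasis_perturb (V : vfamily M) p W r (t Y : 'I_r -> section V) :
  W p -> lbasis W t -> (forall i, Y i p = t i p) ->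
  exists W', W' p /\ lbasis W' Y.
Proof.
move=> Wp [oW gen uniq coef] Yt.
have [m hm] := choice (fun i => coef (Y i)).
pose Q q : 'M[R]_r := \matrix_(i, j) m i j q.
have sQ i j : smooth_on W (fun q => Q q i j).
  by apply: (smooth_on_eq oW _ ((hm i).1 j)) => q _; rewrite mxE.
have Qp : Q p = 1%:M.
  apply/matrixP => i j; rewrite !mxE.
  apply: (uniq p Wp (fun j => m i j p) (fun j => (i == j)%:R)).
  rewrite -(hm i).2 // Yt (bigD1 i) //= eqxx scale1r big1 ?addr0 // => k.
  by rewrite eq_sym => /negbTE ->; rewrite scale0r.
have dQ : nbhs p [set q | \det (Q q) != 0].
  have c := smooth_on_continuous oW Wp (smooth_det oW sQ).
  have n0 : nbhs (\det (Q p)) [set x : R | x != 0].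
    apply: open_nbhs_nbhs; split; first exact: open_neq.
    by rewrite /= Qp det1 oner_neq0.
  exact: (c _ n0).
pose W' := W `&` [set q | \det (Q q) != 0]°.
have oW' : open W' by apply: openI => //; exact: open_interior.
have uQ q : W' q -> Q q \in unitmx.
  by move=> [_ /interior_subset]; rewrite unitmxE unitfE.
have WW : W' `<=` W by move=> q [].
have YE q (a : 'I_r -> R) : W' q ->
    \sum_i a i *: Y i q = \sum_j ((\row_i a i) *m Q q) 0 j *: t j q.
  move=> Wq; transitivity (\sum_i \sum_j (a i * m i j q) *: t j q).
    apply: eq_bigr => i _; rewrite (hm i).2; last exact: WW.
    by rewrite scaler_sumr; apply: eq_bigr => j _; rewrite scalerA.
  rewrite exchange_big /=; apply: eq_bigr => j _.
  by rewrite mxE -scaler_suml; congr (_ *: _); apply: eq_bigr => i _; rewrite !mxE.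
have inv q (b : 'I_r -> R) : W' q -> \sum_j b j *: t j q =
    \sum_i ((\row_j b j) *m invmx (Q q)) 0 i *: Y i q.
  move=> Wq; rewrite YE //; apply: eq_bigr => j _; congr (_ *: _).
  rewrite (_ : \row_i _ = (\row_j b j) *m invmx (Q q)); last first.
    by apply/rowP => i; rewrite mxE.
  by rewrite mulmxKV ?uQ // mxE.
exists W'; split; first by split=> //; exact: nbhs_interior.
split=> //.
- move=> q Wq v; have [b ->] := gen q (WW q Wq) v.
  by exists (((\row_j b j) *m invmx (Q q)) 0); rewrite inv.
- move=> q Wq a b; rewrite !YE // => /(uniq q (WW q Wq)) ab.
  have : (\row_i a i) *m Q q = (\row_i b i) *m Q q by apply/rowP.
  move=> /(congr1 (mulmx^~ (invmx (Q q)))); rewrite !mulmxK ?uQ // => /rowP e i.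
  by have := e i; rewrite !mxE.
- move=> s; have [b [sb eb]] := coef s.
  exists (fun i q => ((\row_j b j q) *m invmx (Q q)) 0 i); split=> [i|q Wq].
    apply: (@smooth_on_eq _ _ _ _ (fun q => \sum_k b k q * invmx (Q q) k i)) => //.
      by move=> q _; rewrite mxE; apply: eq_bigr => k _; rewrite mxE.
    apply: smooth_on_sum => // k _; apply: (smooth_onM oW').
      by apply: smooth_on_sub (sb k).
    apply: (smooth_invmx oW') => // i' j'.
    by apply: smooth_on_sub (sQ i' j').
  by rewrite eb ?inv //; exact: WW.
Qed.

Variable E : psa_data M.
Hypothesis anchor_surj : forall p (v : tangent M p), exists u : E p, anchor E p u = v.

Definition partial_splitting (tau : vfield M -> section E) (chi : cinf M) :=
  clin tau /\ forall x, rho (tau x) = chi *: x.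

(** Lift a frame of [TM] at [p] to [E] and extend it to sections: their images under
    the anchor still form a frame near [p], which defines a splitting there. *)
Lemma local_splitting p : exists W tau chi,
  [/\ open W, W p, partial_splitting tau chi & forall q, W q -> chi q = 1].
Proof.
have [W [r [t [Wp bt]]]] := vbundle_basis (tangent_vbundle M) p.
have [u hu] := choice (fun i => anchor_surj (t i p)).
pose e i := ext (psa_vbundle E) (u i).
have [W' [Wp' bY]] := @lbasis_perturb (tangent M) p W r t (fun i => rho (e i)) Wp bt
  (fun i => etrans (congr1 (anchor E p) (extE (psa_vbundle E) (u i))) (hu i)).
have [oW gen uniq coef] := bY.
have [chi [V [K [oV Vp cK [VK KW] [chi1 chi0]]]]] := bump oW Wp'.
have [a ha] := choice coef.
pose g x i := mk_cinf (smooth_cutoff oW cK KW chi0 ((ha x).1 i)).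
exists V, (fun x => \sum_i g x i *: e i), chi; split=> //; split.
  move=> f x y; apply: section_eq => q.
  rewrite secD secZ !sec_sum scaler_sumr -big_split; apply: eq_bigr => i _.
  rewrite -[RHS]/(f q *: (g x i *: e i) q + (g y i *: e i) q).
  rewrite !secZ scalerA -scalerDl; congr (_ *: _) => /=.
  have [Wq|nWq] := pselect (W' q); last first.
    by rewrite (_ : chi q = 0) ?mul0r ?mulr0 ?addr0 //; apply/chi0 => /KW.
  rewrite (uniq q Wq ((a (f *: x + y))^~ q) (fun i => f q * a x i q + a y i q)).
    by rewrite mulrDr mulrCA.
  rewrite -(ha _).2 // secD secZ (ha x).2 // (ha y).2 // scaler_sumr -big_split /=.
  by apply: eq_bigr => j _; rewrite scalerDl scalerA.
move=> x; rewrite (clin_sum _ _ (@rho_clin _ _ _ E)); apply: section_eq => q.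
rewrite sec_sum secZ.
have [Wq|nWq] := pselect (W' q).
  rewrite (ha x).2 // scaler_sumr; apply: eq_bigr => i _.
  by rewrite (clinZ _ _ (@rho_clin _ _ _ E)) secZ scalerA.
have c0 : chi q = 0 by apply/chi0 => /KW.
rewrite c0 scale0r big1 // => i _.
by rewrite (clinZ _ _ (@rho_clin _ _ _ E)) secZ /= c0 mul0r scale0r.
Qed.

(** The partial splitting obtained after [k] steps, applied to [x], together with
    its factor. *)
Fixpoint glued (tau : nat -> vfield M -> section E) (chi : nat -> cinf M) k x :
    section E * cinf M :=
  if k is k'.+1 then
    let: (s, g) := glued tau chi k' x in (s + (1 - g) *: tau k' x, g + (1 - g) * chi k')
  else (0, 0).

(** Correcting a partial splitting with factor [g] by [1 - g] times the next one
    changes nothing where [g = 1]; along a countable cover by the sets where the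
    local factors are [1] the process is therefore stationary near each point. *)
Lemma global_splitting : exists sigma : vfield M -> section E,
  clin sigma /\ forall x, rho (sigma x) = x.
Proof.
have [B cB [Bo Bb]] := m_second_countable M.
have /countable_injP[g ginj] := cB.
pose good (b : set M) := exists tau chi, partial_splitting tau chi /\
  forall q, b q -> chi q = 1.
have ps0 : partial_splitting (fun=> 0) 0.
  split=> [f x y|x]; first by rewrite scaler0 addr0.
  by rewrite (clin0 (@rho_clin _ _ _ E)) scale0r.
(* [g] numbers the basic open sets. The [k]-th step uses a local splitting for the
   set with number [k], if there is one with factor 1 on that set. *)
have pick k : exists tc : (vfield M -> section E) * cinf M,
    partial_splitting tc.1 tc.2 /\
    forall b, B b -> g b = k -> good b -> forall q, b q -> tc.2 q = 1.
  have [[b [Bb' gb [tau [chi [pst c1]]]]]|no] :=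
      pselect (exists b, [/\ B b, g b = k & good b]).
    exists (tau, chi); split=> // b' Bb'' gb' _.
    by rewrite (ginj b' b) ?inE // gb gb'.
  exists (fun=> 0, 0); split=> // b Bb' gb gd.
  by exfalso; apply: no; exists b.
have [tc htc] := choice pick.
pose tau k := (tc k).1; pose chi k := (tc k).2.
pose s k x := (glued tau chi k x).1; pose G k := (glued tau chi k 0).2.
have GE k x : (glued tau chi k x).2 = G k.
  elim: k x => // k IH x; rewrite /G /=.
  have := IH x; have := IH 0; case: (glued tau chi k x) => ? ? /= _ ->.
  by rewrite /G; case: (glued tau chi k 0).
have sS k x : s k.+1 x = s k x + (1 - G k) *: tau k x.
  by rewrite /s /= -(GE k x); case: (glued tau chi k x).
have GS k : G k.+1 = G k + (1 - G k) * chi k.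
  by rewrite {1}/G /= /G; case: (glued tau chi k 0).
have pss k : partial_splitting (s k) (G k).
  elim: k => [|k [IHl IHr]]; first exact: ps0.
  have [hl hr] : partial_splitting (tau k) (chi k) := (htc k).1.
  split=> [f x y|x].
    rewrite !sS IHl hl !scalerDr !scalerA [f * _]mulrC -!addrA; congr (_ + _).
    by rewrite addrCA.
  rewrite sS (clinD (@rho_clin _ _ _ E)) (clinZ _ _ (@rho_clin _ _ _ E)) IHr hr GS.
  by rewrite [RHS]scalerDl scalerA.
have stat k b q x : B b -> g b = k -> good b -> b q ->
    forall m, (k < m)%N -> G m q = 1 /\ s m x q = s k.+1 x q.
  move=> Bb' gb gd bq; elim=> // m IH; rewrite ltnS leq_eqVlt => /orP[/eqP <-|km].
    split=> //; rewrite GS cinfD cinfM cinfD cinfN cinf1.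
    have [_ hk] := htc k; have c1 : chi k q = 1 by exact: (hk b).
    by rewrite c1 mulr1 addrC subrK.
  have [G1 sE] := IH km; rewrite GS sS secD secZ cinfD cinfM cinfD cinfN cinf1 G1.
  by rewrite subrr mul0r addr0 scale0r addr0 sE.
have cover q : exists b, [/\ B b, b q & good b].
  have [W [t [c [oW Wq pst c1]]]] := local_splitting q.
  have [b [Bb' bq] bW] := Bb q W (open_nbhs_nbhs (conj oW Wq)).
  by exists b; split=> //; exists t, c; split=> // q' /bW/c1.
have [bb hbb] := choice cover.
(* Step [N q] is one after the splitting attached to a neighbourhood of [q] has
   been used; the value at [q] does not change any more. *)
pose N q := (g (bb q)).+1.
have NE q m x : (N q <= m)%N -> G m q = 1 /\ s m x q = s (N q) x q.
  by have [h1 h2 h3] := hbb q; exact: (stat _ _ _ x h1 erefl h3 h2).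
have sec x : is_section (v := E) (fun q => s (N q) x q).
  apply: (section_local (psa_vbundle E)) => q; have [h1 h2 h3] := hbb q.
  exists (bb q), (s (N q) x); split=> //; first exact: Bo.
  move=> q' bq'; have [_ <-] := NE q' (maxn (N q) (N q')) x (leq_maxr _ _).
  by have [] := stat _ _ _ x h1 erefl h3 bq' _ (leq_maxl (N q) (N q')).
exists (fun x => Section_ (sec x)); split=> [f x y|x]; apply: section_eq => q.
  rewrite secD secZ -[LHS]/(s (N q) (f *: x + y) q).
  by rewrite (pss (N q)).1 secD secZ.
rewrite -[LHS]/(rho (s (N q) x) q) (pss (N q)).2 secZ.
by have [-> _] := NE q (N q) x (leqnn _); rewrite scale1r.
Qed.

Lemma isotropic_splittingP (F : psa_data M) (sigma : bundle_map (tangent M) F) :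
  (forall x, rho (push sigma x) = x) ->
  (forall x y, pairing (push sigma x) (push sigma y) = 0) -> isotropic_splitting sigma.
Proof.
move=> rs ps; have vb := tangent_vbundle M; split=> p v.
  by rewrite -{1}(extE vb v) -[LHS]/(rho (push sigma (ext vb v)) p) rs extE.
move=> w; rewrite -{1}(extE vb v) -{1}(extE vb w).
by rewrite -[LHS]/(pairing (push sigma (ext vb v)) (push sigma (ext vb w)) p) ps.
Qed.

(** A splitting [s] is made isotropic by subtracting half of the 2-form
    [(s x, s y)], seen as a map into the isotropic subbundle of 1-forms. *)
Lemma isotropic_splitting_exists :
  (forall p (xi : covector), anchor E p (rho_star E p xi) = 0) ->
  exists sigma : bundle_map (tangent M) E, isotropic_splitting sigma.
Proof.
move=> ars; have [s [sl sr]] := global_splitting.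
have rz x : exists d : section E, (forall e,
    pairing d e = - (cstC M (1 / 2) * pairing (s x) (s (rho e)))) /\ rho d = 0.
  apply: (rho_star_section (L := fun y => - (cstC M (1 / 2) * pairing (s x) (s y)))) => //.
  by move=> f y z; rewrite sl pairing_clinr mulrDr opprD mulrCA mulrN.
have [d hd] := choice rz.
have dl : clin d.
  move=> f x y; apply: pairing_inj => e.
  by rewrite pairing_clin !(hd _).1 sl pairing_clin mulrDr opprD mulrCA mulrN.
have tl : clin (fun x => s x + d x).
  by move=> f x y; rewrite sl dl scalerDr addrACA.
have [sigma hs] := clin_bundle_map (tangent_vbundle M) tl.
have iso x y : pairing (s x + d x) (s y + d y) = 0.
  rewrite (clinfD (pairing_clin _)) !(clinfD (pairing_clinr _)).
  rewrite [pairing (s x) (d y)]pairing_skew !(hd _).1 !(hd _).2 !sr.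
  rewrite (clin0 sl) (clinf0 (pairing_clinr _)) mulr0 oppr0 addr0.
  rewrite [pairing (s y) _]pairing_skew; apply: cinf_eq => p.
  by rewrite !(cinfD, cinfN, cinfM, cinf0) /=; lra.
exists sigma; apply: isotropic_splittingP => x; last by move=> y; rewrite !hs iso.
by rewrite hs rhoD sr (hd _).2 addr0.
Qed.
End SplittingExistence.

(** * The associator identity *)

Section AssociatorIdentity.
Context {R : realType} {n : nat} {M : manifold R n}.
Variables (X : zmodType) (L : X -> cinf M -> cinf M) (N : X -> X -> X).
Hypothesis LD : forall x f g, L x (f + g) = L x f + L x g.
Hypothesis LN : forall x f, L x (- f) = - L x f.
Hypothesis LZ : forall x a f, L x (cstC M a * f) = cstC M a * L x f.
Hypothesis LBl : forall x y f, L (x - y) f = L x f - L y f.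
Hypothesis Lbr : forall x y f, L (N x y - N y x) f = L x (L y f) - L y (L x f).
Hypothesis NBl : forall x y z, N (x - y) z = N x z - N y z.
Hypothesis NBr : forall x y z, N x (y - z) = N x y - N x z.
Hypothesis NA : forall x y z, N x (N y z) - N (N x y) z = N y (N x z) - N (N y x) z.

Variable a : X -> X -> X -> cinf M.

(** The component along 1-forms of a product [e1 * e2], evaluated on [z]: here
    [xi] is the vector field underlying [ei] and [wi] its 1-form. *)
Definition star_form (x1 : X) (w1 : X -> cinf M) (x2 : X) (w2 : X -> cinf M) (z : X) :
    cinf M :=
  a x1 z x2 + L x1 (w2 z) - cstC M (1 / 2) * L z (w2 x1) - w2 (N x1 z - N z x1)
  + w1 (N z x2) - cstC M (1 / 2) * L z (w1 x2).

(** [delta] on cochains of degree 3, for [N] in place of the connection and [L] in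
    place of the action of vector fields on functions. *)
Definition coboundary3 (x y z u : X) : cinf M :=
  L x (a y z u) - L y (a x z u) + L z (a x y u)
  - (a y z (N x u) - a x z (N y u) + a x y (N z u))
  + (- a (N x y - N y x) z u + a (N x z - N z x) y u - a (N y z - N z y) x u).

Hypothesis aB1 : forall x x' y z, a (x - x') y z = a x y z - a x' y z.
Hypothesis aB2 : forall x y y' z, a x (y - y') z = a x y z - a x y' z.
Hypothesis a_skew : forall x y z, a x y z = - a y x z.
Hypothesis a_cyc : forall x y z, a x y z + a y z x + a z x y = 0.

Variables (x1 x2 x3 : X) (w1 w2 w3 : X -> cinf M).
Hypothesis w1B : forall x y, w1 (x - y) = w1 x - w1 y.
Hypothesis w2B : forall x y, w2 (x - y) = w2 x - w2 y.
Hypothesis w3B : forall x y, w3 (x - y) = w3 x - w3 y.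

Let w12 := star_form x1 w1 x2 w2.
Let w21 := star_form x2 w2 x1 w1.
Let w13 := star_form x1 w1 x3 w3.
Let w23 := star_form x2 w2 x3 w3.

(** The function [T] of the associator axiom, in terms of the components of the
    three sections. *)
Definition T_form : cinf M :=
  (w12 x3 - w3 (N x1 x2)) + (w1 (N x2 x3) - w23 x1)
  - (w21 x3 - w3 (N x2 x1)) - (w2 (N x1 x3) - w13 x2).

(** The heart of the matter. The 1-form component of the defect in the associator
    axiom only involves [a]: everything that contains the [wi] cancels, because
    [N] is flat and torsion free, and what remains is the coboundary of [a]. The
    symmetries of [a] turn the terms [L u (a _ _ _)], including those coming from
    [T] with the factor 1/6, into the single one in the coboundary. *)
Lemma associator_identity u :
  (star_form x1 w1 (N x2 x3) w23 u - star_form (N x1 x2) w12 x3 w3 u)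
  - (star_form x2 w2 (N x1 x3) w13 u - star_form (N x2 x1) w21 x3 w3 u)
  - cstC M (1 / 6) * L u T_form = coboundary3 x1 x2 u x3.
Proof.
rewrite /T_form /coboundary3 /w12 /w21 /w13 /w23 /star_form.
rewrite !(LD, LN, LZ, Lbr).
rewrite !(NBl, NBr).
rewrite !(w1B, w2B, w3B, aB1, aB2).
rewrite !(LD, LN, LZ, Lbr).
have sk x y z v : L v (a x y z) = - L v (a y x z) by rewrite a_skew LN.
have cy x y z v : L v (a x y z) + L v (a y z x) + L v (a z x y) = 0.
  rewrite -!LD a_cyc -[in LHS](mul0r (0 : cinf M)).
  have -> : (0 : cinf M) = cstC M 0 by exact: cinf_eq.
  by rewrite LZ; apply: cinf_eq => p; rewrite !cinfM /= !mul0r.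
have fl (f : X -> cinf M) x y z : (forall x y, f (x - y) = f x - f y) ->
    f (N x (N y z)) - f (N (N x y) z) = f (N y (N x z)) - f (N (N y x) z).
  by move=> fB; rewrite -!fB NA.
(* What remains is a linear identity. The relations between its terms are the
   flatness of [N] on [w1] and [w2], the Jacobi identity on [w3], the bracket
   relation for [L] and the symmetries of [a]. *)
apply: cinf_eq => p.
have ev (f g : cinf M) : f = g -> f p = g p by move=> ->.
rewrite !(cinfD, cinfN, cinfM).
have -> : cstC M (1 / 2) p = 1 / 2 by [].
have -> : cstC M (1 / 6) p = 1 / 6 by [].
have := ev _ _ (fl w1 x2 u x3 w1B); have := ev _ _ (fl w2 x1 u x3 w2B).
have := ev _ _ (fl w3 x1 x2 u w3B); have := ev _ _ (fl w3 x1 u x2 w3B).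
have := ev _ _ (fl w3 x2 u x1 w3B).
have := ev _ _ (Lbr x1 x2 (w3 u)); rewrite LBl.
have := ev _ _ (cy x1 x2 x3 u).
have := ev _ _ (sk x1 x2 x3 u); have := ev _ _ (sk x1 x3 x2 u).
have := ev _ _ (sk x2 x3 x1 u).
have := ev _ _ (a_cyc x1 x2 (N u x3)); have := ev _ _ (a_skew x1 (N u x3) x2).
have := ev _ _ (a_skew x1 (N x2 u) x3); have := ev _ _ (a_skew x1 (N u x2) x3).
have := ev _ _ (a_skew x2 (N x1 u) x3); have := ev _ _ (a_skew x2 (N u x1) x3).
rewrite !(cinfD, cinfN, cinf0).
by move=> *; lra.
Qed.
End AssociatorIdentity.

(** * The product in terms of a splitting *)

Section SplitAlgebroid.
Context {R : realType} {n : nat} {M : manifold R n} {nabla : flat_connection M}.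
Implicit Types (x y z u : vfield M).

Lemma nablaBl x y z : nabla (x - y) z = nabla x z - nabla y z.
Proof. by rewrite nablaDl -scaleN1r nablaZl scaleN1r. Qed.

Lemma nabla0r x : nabla x 0 = 0.
Proof. by apply: (addrI (nabla x 0)); rewrite -nablaD !addr0. Qed.

Lemma nablaNr x y : nabla x (- y) = - nabla x y.
Proof. by apply: (addrI (nabla x y)); rewrite -nablaD !subrr nabla0r. Qed.

Lemma nablaBr x y z : nabla x (y - z) = nabla x y - nabla x z.
Proof. by rewrite nablaD nablaNr. Qed.

Lemma lie_bracket_nabla x y (f : cinf M) :
  lie (nabla x y - nabla y x) f = lie x (lie y f) - lie y (lie x f).
Proof. exact: nabla_torsion_free. Qed.

Variables (E : psa_data M) (sigma : bundle_map (tangent M) E).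
Hypothesis exE : is_exact E nabla.
Hypothesis isoS : isotropic_splitting sigma.
Implicit Types e : section E.

Let sg := push sigma.

Lemma rho_star_mul e1 e2 : rho (star e1 e2) = nabla (rho e1) (rho e2).
Proof. by have [_ _ _ ->] := exE. Qed.

Lemma anchor_rho_star p (xi : covector) : anchor E p (rho_star E p xi) = 0.
Proof. by have [_ k _ _] := exE; apply/k; exists xi. Qed.

Lemma rho_splitting x : rho (sg x) = x.
Proof. by apply: section_eq => p; exact: isoS.1. Qed.

Lemma pairing_splitting x y : pairing (sg x) (sg y) = 0.
Proof. by apply: cinf_eq => p; exact: isoS.2. Qed.

(** The kernel of the anchor consists of 1-forms, so it is isotropic. *)
Lemma pairing_kernel e e' : rho e = 0 -> rho e' = 0 -> pairing e e' = 0.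
Proof.
move=> re re'; apply: cinf_eq => p; rewrite /=.
have a0 (d : section E) : rho d = 0 -> anchor E p (d p) = 0.
  by move=> rd; rewrite -[LHS]/(rho d p) rd.
have [_ k _ _] := exE; have [xi <-] := (k p (e p)).1 (a0 _ re).
by rewrite form_rho_star a0 // linear0.
Qed.

(** The 1-form underlying a section, in the decomposition of [E] given by the
    splitting. *)
Definition wform e z : cinf M := pairing e (sg z).

Lemma wform_lin e : clinf (wform e).
Proof. by move=> f x y; rewrite /wform /sg clin_push pairing_clinr. Qed.

Lemma wformB e x y : wform e (x - y) = wform e x - wform e y.
Proof. exact: clinfB (wform_lin e) _ _. Qed.

Lemma wform_linl z : clinf (fun e => wform e z).
Proof. by move=> f e e'; rewrite /wform pairing_clin. Qed.

Lemma wformDl e e' z : wform (e + e') z = wform e z + wform e' z.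
Proof. exact: (clinfD (wform_linl z)). Qed.
Lemma wformBl e e' z : wform (e - e') z = wform e z - wform e' z.
Proof. exact: (clinfB (wform_linl z)). Qed.
Lemma wformZl f e z : wform (f *: e) z = f * wform e z.
Proof. exact: (clinfZ _ _ (wform_linl z)). Qed.
Lemma wform0l z : wform 0 z = 0.
Proof. exact: (clinf0 (wform_linl z)). Qed.

Lemma wform_splitting x z : wform (sg x) z = 0.
Proof. exact: pairing_splitting. Qed.

(** [e - sigma (rho e)] lies in the kernel of the anchor for every [e]. *)
Lemma pairingE e1 e2 : pairing e1 e2 = wform e1 (rho e2) - wform e2 (rho e1).
Proof.
have k e : rho (e - sg (rho e)) = 0 by rewrite rhoB rho_splitting subrr.
have := pairing_kernel (k e1) (k e2).
rewrite (clinfB (pairing_clin _)) !(clinfB (pairing_clinr _)) pairing_splitting subr0.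
move=> /eqP; rewrite subr_eq0 subr_eq => /eqP ->; rewrite /wform addrC.
by congr (_ + _); rewrite pairing_skew.
Qed.

Lemma split_ext e e' : rho e = rho e' -> (forall z, wform e z = wform e' z) -> e = e'.
Proof. by move=> re we; apply: pairing_inj => d; rewrite !pairingE re we. Qed.

Lemma wform_D (f : cinf M) z : wform (D E f) z = lie z f.
Proof. by rewrite /wform pairing_D rho_splitting. Qed.

Lemma rho_D (f : cinf M) : rho (D E f) = 0.
Proof.
have ll : clinf (fun x => lie x f) by move=> g x y; rewrite lie_lin.
have [d [hd rd]] := rho_star_section anchor_rho_star ll.
suff -> : D E f = d by [].
by apply: pairing_inj => e; rewrite pairing_D hd.
Qed.

Lemma starDl e e' d : star (e + e') d = star e d + star e' d.
Proof.
have := star_linearl 1 e e' d.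
have -> : cstC M 1 = 1 by exact: cinf_eq.
by rewrite !scale1r.
Qed.

Lemma starDr e e' d : star d (e + e') = star d e + star d e'.
Proof.
have := star_linearr 1 e e' d.
have -> : cstC M 1 = 1 by exact: cinf_eq.
by rewrite !scale1r.
Qed.

(** The product of [E] is the one that [sigma] and the tensor [a] determine. *)
Definition star_formula (a : vfield M -> vfield M -> vfield M -> cinf M) : Prop :=
  forall e1 e2 z, wform (star e1 e2) z =
    star_form (@lie _ _ M) nabla a (rho e1) (wform e1) (rho e2) (wform e2) z.

Definition split_tensor x z y : cinf M := wform (star (sg x) (sg y)) z.

Lemma split_tensor_star_formula a : star_formula a -> split_tensor = a.
Proof.
move=> sf; apply/funext => x; apply/funext => z; apply/funext => y.
rewrite /split_tensor sf /star_form !rho_splitting !wform_splitting.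
rewrite !lie0 !mulr0; apply: cinf_eq => p.
by rewrite !(cinfD, cinfN, cinf0); lra.
Qed.

Section FromInvariance.
Hypothesis inv : forall e1 e2 e3,
  lie (rho e1) (pairing e2 e3) =
  pairing (star e1 e2 - cstC M (1 / 2) *: D E (pairing e1 e2)) e3
  + pairing e2 (brack e1 e3).

(** The invariance axiom with [D] eliminated. *)
Lemma invE e1 e2 e3 : lie (rho e1) (pairing e2 e3) =
  pairing (star e1 e2) e3 - cstC M (1 / 2) * lie (rho e3) (pairing e1 e2)
  + pairing e2 (star e1 e3 - star e3 e1).
Proof.
by rewrite inv (clinfB (pairing_clin _)) (clinfZ _ _ (pairing_clin _)) pairing_D.
Qed.

Lemma lie0l (f : cinf M) : lie 0 f = 0.
Proof. by have := lieBl 0 0 f; rewrite subr0 subrr. Qed.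

Lemma pairing_kerl k e : rho k = 0 -> pairing k e = wform k (rho e).
Proof. by move=> rk; rewrite pairingE rk (clinf0 (wform_lin e)) subr0. Qed.

Lemma pairing_sgl x e : pairing (sg x) e = - wform e x.
Proof. by rewrite pairingE wform_splitting rho_splitting sub0r. Qed.

Lemma star_kernel_kernel k1 k2 z : rho k1 = 0 -> rho k2 = 0 ->
  wform (star k1 k2) z = 0.
Proof.
move=> r1 r2; have := invE k1 k2 (sg z).
rewrite r1 lie0l rho_splitting (pairing_kernel r1 r2) lie0 mulr0 subr0.
rewrite (pairing_kernel r2) ?addr0 //.
rewrite rhoB !rho_star_mul r1 rho_splitting nabla0l sub0r.
by rewrite nabla0r oppr0.
Qed.

(** Invariance for the triple [sigma x], [k], [sigma z]. *)
Lemma star_splitting_kernel x k z : rho k = 0 ->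
  wform (star (sg x) k) z = lie x (wform k z) - cstC M (1 / 2) * lie z (wform k x)
    - wform k (nabla x z - nabla z x).
Proof.
move=> rk; have := invE (sg x) k (sg z).
rewrite !rho_splitting pairing_sgl lieN (pairing_kerl (sg z) rk) rho_splitting.
rewrite (pairing_kerl _ rk) rhoB !rho_star_mul !rho_splitting -/(wform _ z) => ->.
by apply: cinf_eq => p; rewrite !(cinfD, cinfN, cinfM, cstCE); lra.
Qed.

(** Invariance for [sigma x], [sigma z], [k] expresses this product through the
    opposite one. *)
Lemma star_kernel_splitting x k z : rho k = 0 ->
  wform (star k (sg x)) z = wform k (nabla z x) - cstC M (1 / 2) * lie z (wform k x).
Proof.
move=> rk; have := invE (sg x) (sg z) k.
rewrite !rho_splitting rk lie0l mulr0 subr0 !pairing_sgl lieN.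
rewrite [pairing (star _ _) k]pairing_skew (pairing_kerl _ rk) rho_star_mul.
rewrite !rho_splitting wformBl (star_splitting_kernel x z rk) wformB.
move=> H.
apply: cinf_eq => p; have := cinf_congr p H.
by rewrite !(cinfD, cinfN, cinfM, cstCE); lra.
Qed.

(** Decompose both factors into their vector field and 1-form parts. Invariance
    determines all products but the one of two vector fields. *)
Lemma split_star_formula : star_formula split_tensor.
Proof.
move=> e1 e2 z; pose x1 := rho e1; pose x2 := rho e2.
pose k1 := e1 - sg x1; pose k2 := e2 - sg x2.
have r1 : rho k1 = 0 by rewrite rhoB rho_splitting subrr.
have r2 : rho k2 = 0 by rewrite rhoB rho_splitting subrr.
have w1 y : wform k1 y = wform e1 y.
  by rewrite wformBl wform_splitting subr0.
have w2 y : wform k2 y = wform e2 y.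
  by rewrite wformBl wform_splitting subr0.
have E1 : e1 = sg x1 + k1 by rewrite addrC subrK.
have E2 : e2 = sg x2 + k2 by rewrite addrC subrK.
clearbody k1 k2; rewrite {1}E1 {1}E2 starDl !starDr !wformDl.
rewrite (star_kernel_kernel z r1 r2) (star_splitting_kernel x1 z r2).
rewrite (star_kernel_splitting x2 z r1) !w1 !w2 -/(split_tensor x1 z x2) /star_form.
by apply: cinf_eq => p; rewrite !(cinfD, cinfN, cinfM, cinf0, cstCE); lra.
Qed.

(** Invariance for three sections coming from vector fields. The two symmetries of
    the tensor below are formal consequences. *)
Lemma split_tensor_rel x y z :
  split_tensor x y z = split_tensor x z y + split_tensor z y x.
Proof.
have := invE (sg x) (sg y) (sg z).
rewrite !pairing_splitting !lie0 mulr0 subr0 pairing_sgl wformBl.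
rewrite /split_tensor -/(wform _ z) => /eqP; rewrite eq_sym subr_eq0 => /eqP ->.
by rewrite subrK.
Qed.

Lemma split_tensor_skew x y z : split_tensor x y z = - split_tensor y x z.
Proof.
have := split_tensor_rel z x y; have := split_tensor_rel z y x.
move=> -> /eqP; rewrite -addrA -[X in X == _]addr0 (inj_eq (addrI _)) eq_sym addr_eq0.
by move=> /eqP ->.
Qed.

Lemma split_tensor_cyclic x y z :
  split_tensor x y z + split_tensor y z x + split_tensor z x y = 0.
Proof.
rewrite [split_tensor x y z]split_tensor_rel [split_tensor z x y]split_tensor_skew.
rewrite [split_tensor y z x]split_tensor_skew.
by apply: cinf_eq => p; rewrite !(cinfD, cinfN, cinf0); lra.
Qed.
End FromInvariance.

Section FromFormula.
Variable a : vfield M -> vfield M -> vfield M -> cinf M.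
Hypothesis sf : star_formula a.
Hypothesis a_skew : forall x y z, a x y z = - a y x z.
Hypothesis a_cyc : forall x y z, a x y z + a y z x + a z x y = 0.
Hypothesis a_lin2 : forall x z, clinf (a x ^~ z).

(** Linearity in one slot spreads to the others through the symmetries; the product
    itself is only linear over the real numbers. *)
Lemma skew_cyclic_linear1 y z : clinf (fun x => a x y z).
Proof. by move=> f x x'; rewrite a_skew a_lin2 opprD -mulrN -!a_skew. Qed.

Lemma skew_cyclic_linear3 x y : clinf (a x y).
Proof.
have a3 z : a x y z = - a y z x - a z x y.
  apply: cinf_eq => p; have := cinf_congr p (a_cyc x y z).
  by rewrite !(cinfD, cinfN, cinf0); lra.
move=> f z z'; rewrite !a3 a_lin2 skew_cyclic_linear1.
by apply: cinf_eq => p; rewrite !(cinfD, cinfN, cinfM); ring.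
Qed.

Lemma wform_jacobiator e1 e2 e3 u :
  wform (assoc e1 e2 e3 - assoc e2 e1 e3 - cstC M (1 / 6) *: D E (Tform e1 e2 e3)) u =
  coboundary3 (@lie _ _ M) nabla a (rho e1) (rho e2) u (rho e3).
Proof.
rewrite -(associator_identity (a := a) (@lieD _ _ M) (@lieN _ _ M) (@lieZ _ _ M) (@lieBl _ _ M)
  lie_bracket_nabla nablaBl nablaBr (@nabla_assoc _ _ _ nabla)
  (fun x x' y z => clinfB (skew_cyclic_linear1 y z) x x')
  (fun x y y' z => clinfB (a_lin2 x z) y y')
  a_skew a_cyc (rho e1) (rho e2) (rho e3) (wformB e1) (wformB e2) (wformB e3) u).
rewrite !wformBl wformZl wform_D.
have sfe e e' : wform (star e e') =
    star_form (@lie _ _ M) nabla a (rho e) (wform e) (rho e') (wform e').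
  by apply/funext => z; rewrite sf.
congr (_ - _ - _ * lie u _).
- by rewrite ?wformBl !sfe !rho_star_mul.
- by rewrite ?wformBl !sfe !rho_star_mul.
by rewrite /Tform /T_form !pairingE !rho_star_mul !sfe.
Qed.

Lemma rho_jacobiator e1 e2 e3 :
  rho (assoc e1 e2 e3 - assoc e2 e1 e3 - cstC M (1 / 6) *: D E (Tform e1 e2 e3)) = 0.
Proof.
rewrite !rhoB (clinZ _ _ (@rho_clin _ _ _ E)) rho_D scaler0 subr0 !rho_star_mul.
by rewrite nabla_assoc subrr.
Qed.

(** Conversely the product formula implies invariance. *)
Lemma formula_invariance e1 e2 e3 : lie (rho e1) (pairing e2 e3) =
  pairing (star e1 e2 - cstC M (1 / 2) *: D E (pairing e1 e2)) e3
  + pairing e2 (brack e1 e3).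
Proof.
rewrite (clinfB (pairing_clin _)) (clinfZ _ _ (pairing_clin _)) pairing_D /brack.
rewrite !pairingE rhoB !rho_star_mul wformBl !sf /star_form.
rewrite !(lieD, lieN, lieBl, wformB).
have := a_cyc (rho e1) (rho e2) (rho e3); have := a_skew (rho e1) (rho e3) (rho e2).
have := a_skew (rho e3) (rho e2) (rho e1).
move=> H3 H1 H2; apply: cinf_eq => p; have := cinf_congr p H3.
have := cinf_congr p H1; have := cinf_congr p H2.
by rewrite !(cinfD, cinfN, cinfM, cinf0, cstCE); lra.
Qed.

(** The defect in the associator axiom has no vector field part, by flatness, so
    the axiom holds exactly when its 1-form part, the coboundary, vanishes. *)
Lemma presymplectic_coboundary3 :
  is_presymplectic E <-> forall x y z u, coboundary3 (@lie _ _ M) nabla a x y z u = 0.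
Proof.
split=> [[as3 _] x y z u|cl].
  have := wform_jacobiator (sg x) (sg y) (sg u) z; rewrite !rho_splitting => <-.
  by rewrite as3 subrr wform0l.
split=> e1 e2 e3; last exact: formula_invariance.
apply/eqP; rewrite -subr_eq0; apply/eqP; apply: split_ext.
  by rewrite rho_jacobiator (clin0 (@rho_clin _ _ _ E)).
by move=> z; rewrite wform_jacobiator cl wform0l.
Qed.
End FromFormula.
End SplitAlgebroid.

(** * Cochains of low degree *)

Section LowDegreeCochains.
Context {R : realType} {n : nat} {M : manifold R n} {nabla : flat_connection M}.
Implicit Types x y z u : vfield M.
Local Notation A := (lsa_tangent nabla).

Lemma mktuple1 (T : Type) (f : 'I_1 -> T) : [tuple f j | j < 1] = [tuple f ord0].
Proof.
by apply: eq_from_tnth => j; rewrite tnth_mktuple ord1 (tnth_nth (f ord0)).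
Qed.

Lemma mktuple2 (T : Type) (f : 'I_2 -> T) :
  [tuple f j | j < 2] = [tuple f ord0; f ord_max].
Proof.
apply: eq_from_tnth => j; rewrite tnth_mktuple (tnth_nth (f ord0)).
by case: j => [[|[|//]] lt]; congr f; exact: val_inj.
Qed.

Lemma tuple1E (T : Type) (x : 1.-tuple T) : x = [tuple tnth x ord0].
Proof. by apply: eq_from_tnth => j; rewrite -(mktuple1 (tnth x)) tnth_mktuple. Qed.

Lemma tuple2E (T : Type) (x : 2.-tuple T) : x = [tuple tnth x ord0; tnth x ord_max].
Proof.
by apply: eq_from_tnth => j; rewrite -(mktuple2 (tnth x)) tnth_mktuple.
Qed.

Lemma lsa_derE x f : lsa_der (A := A) x f = lie x f.
Proof. by rewrite /lsa_der; congr lie; exact: section_eq. Qed.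

Lemma omit_pair x y (i : 'I_2) :
  omit (A := A) [tuple x; y] i = [tuple if i == ord0 then y else x].
Proof. by rewrite /omit mktuple1; case: i => [[|[|//]] lt]; congr [tuple _]. Qed.

Lemma delta1E (h : cochain A 1) x y z : delta h [tuple x; y] z =
  lie x (h [tuple y] z) - lie y (h [tuple x] z)
  - (h [tuple y] (nabla x z) - h [tuple x] (nabla y z))
  - h [tuple nabla x y - nabla y x] z.
Proof.
rewrite /delta (eq_bigr _ (fun i _ => big_mkcond _ _)) /=.
rewrite !big_ord_recl !big_ord0 /= !omit_pair /= !lsa_derE.
have -> : omit2 (A := A) [tuple x; y] ord0 (lift ord0 ord0) =
    [tuple nabla x y - nabla y x] by rewrite /omit2 mktuple1; congr [tuple _].
rewrite -![tnth _ ord0]/x -![tnth _ (lift _ _)]/y -![fintype.bump 0 0]/1%N.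
rewrite !(expr0, expr1, mul1r, mulN1r); apply: cinf_eq => p.
by rewrite !(cinfD, cinfN, cinf0); lra.
Qed.

Lemma enum3 : enum 'I_3 = [:: ord0; lift ord0 ord0; lift ord0 (lift ord0 ord0)].
Proof. by apply: (inj_map val_inj); rewrite val_enum_ord. Qed.

Lemma delta2E (phi : cochain A 2) x y z u : delta phi [tuple x; y; z] u =
  coboundary3 (@lie _ _ M) nabla (fun x y z => phi [tuple x; y] z) x y z u.
Proof.
pose i0 : 'I_3 := ord0; pose i1 : 'I_3 := lift ord0 ord0.
pose i2 : 'I_3 := lift ord0 (lift ord0 ord0).
have o0 : omit (A := A) [tuple x; y; z] i0 = [tuple y; z] by rewrite /omit mktuple2.
have o1 : omit (A := A) [tuple x; y; z] i1 = [tuple x; z] by rewrite /omit mktuple2.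
have o2 : omit (A := A) [tuple x; y; z] i2 = [tuple x; y] by rewrite /omit mktuple2.
have o01 : omit2 (A := A) [tuple x; y; z] i0 i1 = [tuple nabla x y - nabla y x; z].
  by rewrite /omit2 mktuple2 enum3.
have o02 : omit2 (A := A) [tuple x; y; z] i0 i2 = [tuple nabla x z - nabla z x; y].
  by rewrite /omit2 mktuple2 enum3.
have o12 : omit2 (A := A) [tuple x; y; z] i1 i2 = [tuple nabla y z - nabla z y; x].
  by rewrite /omit2 mktuple2 enum3.
rewrite /delta (eq_bigr _ (fun i _ => big_mkcond _ _)) /=.
rewrite !big_ord_recl !big_ord0 /= -/i0 -/i1 -/i2 o0 o1 o2 o01 o02 o12 !lsa_derE.
have t0 : tnth [tuple x; y; z] i0 = x by [].
have t1 : tnth [tuple x; y; z] i1 = y by [].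
have t2 : tnth [tuple x; y; z] i2 = z by [].
rewrite t0 t1 t2 -![fintype.bump 0 (fintype.bump 0 0)]/2%N -![fintype.bump 0 0]/1%N.
rewrite !(addn0, add0n) -![(1 + 2)%N]/3%N /coboundary3.
rewrite !(expr0, expr1, sqrrN, expr1n, mul1r, mulN1r) !exprS expr0 mulr1.
rewrite !(mulN1r, opprK, mul1r); apply: cinf_eq => p.
by rewrite !(cinfD, cinfN, cinf0); lra.
Qed.

Lemma perm_ord2 (s : 'S_2) : s = 1%g \/ s = tperm ord0 ord_max.
Proof.
have o2 (i : 'I_2) : i = ord0 \/ i = ord_max.
  by case: i => [[|[|//]] lt]; [left|right]; exact: val_inj.
have [s0|s0] := o2 (s ord0); [left|right]; apply/permP => i.
  rewrite perm1; have [->|->] := o2 i => //.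
  have [s1|//] := o2 (s ord_max).
  by have /perm_inj : s ord0 = s ord_max by rewrite s0 s1.
have [->|->] := o2 i; first by rewrite tpermL.
rewrite tpermR; have [//|s1] := o2 (s ord_max).
by have /perm_inj : s ord0 = s ord_max by rewrite s0 s1.
Qed.

(** Cochains on pairs are reduced to functions of three vector fields, with the
    sign rule for the two permutations of two arguments. *)
Lemma tilde_cochain2P (phi : cochain A 2) : is_tilde_cochain phi <->
  [/\ forall x z, clinf (fun y => phi [tuple x; y] z),
      forall x y z, phi [tuple x; y] z = - phi [tuple y; x] z &
      forall x y z, phi [tuple x; y] z + phi [tuple y; z] x + phi [tuple z; x] y = 0].
Proof.
split=> [[[l3 l12 sk] cyc]|[l2 sk cyc]].
  split=> // [x z f y y'|x y z].
    have := l12 [tuple x; x] ord_max f y y' z; rewrite /= !mktuple2 /=.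
    by rewrite -![tnth [tuple x; x] ord0]/x.
  have := sk (tperm ord0 ord_max) [tuple y; x] z.
  rewrite mktuple2 tpermL tpermR odd_tperm /= expr1 mulN1r.
  by rewrite -[tnth _ ord_max]/x -[tnth _ ord0]/y.
have l1 := skew_cyclic_linear1 sk l2.
have l3 := skew_cyclic_linear3 sk cyc l2.
split=> //; split.
- by move=> x f y z; rewrite (tuple2E x); exact: l3.
- move=> x i f y z w; rewrite /= !mktuple2.
  case: i => [[|[|//]] lt] /=; rewrite -?val_eqE /=; [exact: l1|exact: l2].
move=> s x w; rewrite mktuple2 [in RHS](tuple2E x).
have [->|->] := perm_ord2 s; first by rewrite !perm1 odd_perm1 mul1r.
by rewrite tpermL tpermR odd_tperm /= expr1 mulN1r sk.
Qed.

Lemma tilde_cochain1P (h : cochain A 1) : is_tilde_cochain h <->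
  (forall x, clinf (h [tuple x])) /\ (forall x y, h [tuple x] y = h [tuple y] x).
Proof.
split=> [[[l2 _ _] sym]|[l2 sym]]; first by split=> // x f y z; exact: l2.
split=> //; split.
- by move=> x f y z; rewrite (tuple1E x); exact: l2.
- move=> x i f y z w; rewrite /= !mktuple1.
  have E v : [tuple if ord0 == i then v else tnth x ord0] = [tuple v].
    by apply: val_inj; rewrite /= [i]ord1.
  by rewrite !E ![h _ w]sym; exact: l2.
move=> s x w; have -> : s = 1%g by apply/permP => i; rewrite !ord1.
by rewrite odd_perm1 mul1r mktuple1 perm1 -tuple1E.
Qed.

Lemma cochain2_ext (phi psi : cochain A 2) :
  (forall x y z, phi [tuple x; y] z = psi [tuple x; y] z) -> phi = psi.
Proof.
by move=> e; apply/funext => t; apply/funext => z; rewrite (tuple2E t).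
Qed.

Lemma tuple3E (T : Type) (t : 3.-tuple T) : exists x y z : T, t = [tuple x; y; z].
Proof.
case/tupleP: t => x t; case/tupleP: t => y t; case/tupleP: t => z t.
by exists x, y, z; rewrite (tuple0 t); exact: val_inj.
Qed.

Lemma tilde_cocycle2P (phi : cochain A 2) : tilde_cocycle phi <->
  is_tilde_cochain phi /\ forall x y z u,
    coboundary3 (@lie _ _ M) nabla (fun x y z => phi [tuple x; y] z) x y z u = 0.
Proof.
split=> [[tp cl]|[tp cl]]; split=> //.
  by move=> x y z u; rewrite -delta2E cl.
by move=> t u; have [x [y [z ->]]] := tuple3E t; rewrite delta2E.
Qed.
End LowDegreeCochains.

(** * The cochain of a splitting *)

Section Classification.
Context {R : realType} {n : nat} {M : manifold R n} {nabla : flat_connection M}.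
Implicit Types x y z u : vfield M.
Local Notation A := (lsa_tangent nabla).

Lemma exact_anchor_rho_star (E : exact_psa nabla) p (xi : covector) :
  anchor E p (rho_star E p xi) = 0.
Proof. exact: anchor_rho_star (epsa_exact E) p xi. Qed.

Lemma exact_splitting (E : exact_psa nabla) :
  exists sigma : bundle_map (tangent M) E, isotropic_splitting sigma.
Proof.
apply: isotropic_splitting_exists; last exact: exact_anchor_rho_star.
by have [_ _ su _] := epsa_exact E.
Qed.

Lemma exact_star_formula (E : exact_psa nabla) (sigma : bundle_map (tangent M) E) :
  isotropic_splitting sigma -> star_formula (nabla := nabla) sigma (split_tensor sigma).
Proof.
by move=> iso; apply: (split_star_formula (epsa_exact E) iso (epsa_presymplectic E).2).
Qed.

(** The 1-form that defines the cochain is [split_tensor], read off by pairing with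
    the splitting. *)
Lemma splitting_cochainP (E : exact_psa nabla) (sigma : bundle_map (tangent M) E)
    (tphi : cochain A 2) : isotropic_splitting sigma ->
  splitting_cochain sigma tphi <->
  forall x y z, tphi [tuple x; y] z = split_tensor sigma x y z.
Proof.
move=> iso; have exE := epsa_exact E; have vbE := psa_vbundle E.
have ker x y : rho (star (push sigma x) (push sigma y) - push sigma (nabla x y)) = 0.
  by rewrite rhoB (rho_star_mul exE) !(rho_splitting iso) subrr.
split=> [[phi [hphi tE]] x y z|H].
  apply: cinf_eq => p; rewrite tE.
  have := form_rho_star (phi x z p) (push sigma y p).
  rewrite -[X in _ = _ X]/(rho (push sigma y) p) (rho_splitting iso) => <-.
  rewrite hphi.
  rewrite -[LHS]/(wform sigma (star (push sigma x) (push sigma z) -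
    push sigma (nabla x z)) y p).
  by rewrite wformBl (wform_splitting iso) subr0.
have [phi hphi] := choice (fun xy : vfield M * vfield M =>
  clinf_oneform (wform_lin sigma (star (push sigma xy.1) (push sigma xy.2)))).
exists (fun x y => phi (x, y)); split=> [x y p|x y z p]; last first.
  by rewrite hphi H.
apply: form_inj => w; rewrite form_rho_star -(extE vbE w); set e := ext vbE w.
rewrite -[LHS]/(phi (x, y) p (rho e p)) hphi /=.
rewrite -[RHS]/(pairing (star (push sigma x) (push sigma y) - push sigma (nabla x y)) e p).
rewrite (pairing_kerl exE iso e (ker x y)) wformBl (wform_splitting iso).
by rewrite subr0.
Qed.

Definition splitting_tphi (E : exact_psa nabla) (sigma : bundle_map (tangent M) E) :
  cochain A 2 := fun t z => split_tensor sigma (tnth t ord0) (tnth t ord_max) z.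


Lemma splitting_cochain_unique (E : exact_psa nabla) (sigma : bundle_map (tangent M) E) :
  isotropic_splitting sigma -> exists! tphi, splitting_cochain sigma tphi.
Proof.
move=> iso; exists (splitting_tphi sigma); split; first exact/splitting_cochainP.
move=> tphi /(splitting_cochainP _ iso) h; apply: cochain2_ext => x y z.
by rewrite h.
Qed.

Lemma splitting_cocycle (E : exact_psa nabla) (sigma : bundle_map (tangent M) E) tphi :
  isotropic_splitting sigma -> splitting_cochain sigma tphi -> tilde_cocycle tphi.
Proof.
move=> iso /(splitting_cochainP _ iso) h.
have exE := epsa_exact E; have [ax1 ax2] := epsa_presymplectic E.
have sk := split_tensor_skew exE iso ax2.
have cy := split_tensor_cyclic exE iso ax2.
have l2 x z : clinf (fun y => split_tensor sigma x y z) by exact: wform_lin.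
apply/tilde_cocycle2P; split.
  apply/tilde_cochain2P; split=> [x z f y y'|x y z|x y z]; rewrite !h //.
  exact: l2.
have -> : (fun x y z => tphi [tuple x; y] z) = split_tensor sigma.
  by apply/funext => x; apply/funext => y; apply/funext => z.
apply/(presymplectic_coboundary3 exE iso (exact_star_formula iso)) => //.
Qed.

(** The difference of two splittings, a map from vector fields to 1-forms, as a
    cochain of degree 2. *)
Definition splitting_diff (E : psa_data M) (sigma sigma' : bundle_map (tangent M) E) :
  cochain A 1 := fun t y => wform sigma (push sigma' (tnth t ord0)) y.

Lemma wform_change (E : psa_data M) (sigma sigma' : bundle_map (tangent M) E) e z :
  is_exact E nabla -> isotropic_splitting sigma -> isotropic_splitting sigma' ->
  wform sigma' e z = wform sigma e z - splitting_diff sigma sigma' [tuple z] (rho e).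
Proof. by move=> ex iso iso'; rewrite {1}/wform (pairingE ex iso) (rho_splitting iso'). Qed.

(** Symmetry of the difference is isotropy of the second splitting. *)
Lemma splitting_diff_tilde (E : psa_data M) (sigma sigma' : bundle_map (tangent M) E) :
  is_exact E nabla -> isotropic_splitting sigma -> isotropic_splitting sigma' ->
  is_tilde_cochain (splitting_diff sigma sigma').
Proof.
move=> ex iso iso'; apply/tilde_cochain1P; split=> [x|x y]; first exact: wform_lin.
have := pairing_splitting iso' x y; rewrite (pairingE ex iso) !(rho_splitting iso').
by move=> /eqP; rewrite subr_eq0 => /eqP.
Qed.

(** Insert the sections [sigma' x] and [sigma' y] into the product formula for
    [sigma]. The two terms with factor 1/2 add up by symmetry of the difference. *)
Lemma split_tensor_change (E : exact_psa nabla) (sigma sigma' : bundle_map (tangent M) E)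
    x y z : isotropic_splitting sigma -> isotropic_splitting sigma' ->
  split_tensor sigma' x y z - split_tensor sigma x y z =
  delta (splitting_diff sigma sigma') [tuple x; y] z.
Proof.
move=> iso iso'; have ex := epsa_exact E.
have /tilde_cochain1P[_ sym] := splitting_diff_tilde ex iso iso'.
rewrite {1}/split_tensor (wform_change _ _ ex iso iso') (exact_star_formula iso).
rewrite (rho_star_mul ex) !(rho_splitting iso') delta1E /star_form.
pose h x y := splitting_diff sigma sigma' [tuple x] y.
have hE u v : wform sigma (push sigma' u) v = h u v by [].
have hs u v : h u v = h v u by exact: sym.
have hBr u v w : h w (u - v) = h w u - h w v by exact: wformB.
have hBl u v w : h (u - v) w = h u w - h v w by rewrite hs hBr !(hs w).
rewrite !hE -!/(h _ _) hBr hBl [h z x]hs [h z y]hs ![h z (nabla _ _)]hs.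
by apply: cinf_eq => p; rewrite !(cinfD, cinfN, cinfM, cstCE); lra.
Qed.
End Classification.

(** * Cohomology classes and isomorphisms *)

Section CohomologyClasses.
Context {R : realType} {n : nat} {M : manifold R n} {nabla : flat_connection M}.
Implicit Types x y z u : vfield M.
Local Notation A := (lsa_tangent nabla).
Implicit Types phi psi chi : cochain A 2.

Definition cohomologous phi psi :=
  tilde_coboundary (A := A) (k := 2) (fun t z => psi t z - phi t z).

Lemma cohomologousP phi psi : cohomologous phi psi <->
  exists h : cochain A 1, is_tilde_cochain h /\
    forall x y z, psi [tuple x; y] z - phi [tuple x; y] z = delta h [tuple x; y] z.
Proof.
split=> [[h th e]|[h [th e]]]; exists h => //.
by move=> t z; rewrite (tuple2E t) -e.
Qed.

Lemma cohomologous_refl phi : cohomologous phi phi.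
Proof.
apply/cohomologousP; exists (fun=> fun=> 0); split.
  by apply/tilde_cochain1P; split=> // x f y z; rewrite mulr0 addr0.
by move=> x y z; rewrite delta1E !lie0 !subrr.
Qed.

(** The coboundary is additive; with reflexivity this gives symmetry and
    transitivity. *)
Lemma cohomologous_sub phi psi chi :
  cohomologous phi psi -> cohomologous phi chi -> cohomologous psi chi.
Proof.
move=> /cohomologousP[h [/tilde_cochain1P[hl hs] eh]].
move=> /cohomologousP[k [/tilde_cochain1P[kl ks] ek]].
apply/cohomologousP; exists (fun t z => k t z - h t z); split.
  apply/tilde_cochain1P; split=> [x f y z|x y]; last by rewrite hs ks.
  rewrite hl kl; apply: cinf_eq => p; rewrite !(cinfD, cinfN, cinfM); ring.
move=> x y z; have := ek x y z; have := eh x y z; rewrite !delta1E.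
rewrite !(lieD, lieN) => H1 H2; apply: cinf_eq => p.
have := cinf_congr p H1; have := cinf_congr p H2.
by rewrite !(cinfD, cinfN); lra.
Qed.

Lemma tilde_class_eq phi psi : tilde_cocycle phi ->
  tilde_class phi = tilde_class psi <-> cohomologous psi phi.
Proof.
move=> cphi; split=> [E|c].
  have H : tilde_class phi phi by split; [|exact: cohomologous_refl].
  by move: H; rewrite E => -[].
have c' := cohomologous_sub c (cohomologous_refl psi).
apply/seteqP; split=> chi [cchi h]; split=> //.
  exact: cohomologous_sub c' h.
exact: cohomologous_sub c h.
Qed.
End CohomologyClasses.

Section Isomorphisms.
Context {R : realType} {n : nat} {M : manifold R n} {nabla : flat_connection M}.
Implicit Types x y z u : vfield M.
Local Notation A := (lsa_tangent nabla).

(** Sections are determined by their vector field and 1-form parts, and both can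
    be prescribed; this identifies [E] with [E'] once splittings are chosen. *)
Lemma split_transport (E E' : exact_psa nabla) (sigma : bundle_map (tangent M) E)
    (sigma' : bundle_map (tangent M) E') :
  isotropic_splitting sigma -> isotropic_splitting sigma' ->
  exists F : bundle_map E E', forall e, rho (push F e) = rho e /\
    forall z, wform sigma' (push F e) z = wform sigma e z.
Proof.
move=> iso iso'; have ex := epsa_exact E; have ex' := epsa_exact E'.
have [r hr] := choice (fun e : section E =>
  rho_star_section (@exact_anchor_rho_star _ _ _ _ E') (wform_lin sigma e)).
have rl : clin r.
  move=> f e e'; apply: pairing_inj => d.
  by rewrite pairing_clin !(hr _).1 wformDl wformZl.
have Fl : clin (fun e => push sigma' (rho e) + r e).
  by move=> f e e'; rewrite rho_clin clin_push rl scalerDr addrACA.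
have [F hF] := clin_bundle_map (psa_vbundle E) Fl.
exists F => e; rewrite hF rhoD (rho_splitting iso') (hr e).2 addr0; split=> // z.
by rewrite wformDl (wform_splitting iso') add0r /wform (hr e).1 (rho_splitting iso').
Qed.

(** The identification of sections with pairs respects products because these are
    determined by the same tensor. *)
Lemma split_tensor_iso (E E' : exact_psa nabla) (sigma : bundle_map (tangent M) E)
    (sigma' : bundle_map (tangent M) E') :
  isotropic_splitting sigma -> isotropic_splitting sigma' ->
  split_tensor sigma = split_tensor sigma' -> psa_iso E E'.
Proof.
move=> iso iso' ett; have ex := epsa_exact E; have ex' := epsa_exact E'.
have [F hF] := split_transport iso iso'.
have [G hG] := split_transport iso' iso.
have GF e : push G (push F e) = e.
  apply: (split_ext ex iso); first by rewrite (hG _).1 (hF _).1.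
  by move=> z; rewrite (hG _).2 (hF _).2.
have FG e : push F (push G e) = e.
  apply: (split_ext ex' iso'); first by rewrite (hF _).1 (hG _).1.
  by move=> z; rewrite (hF _).2 (hG _).2.
have Fw e : wform sigma' (push F e) = wform sigma e.
  by apply/funext => z; rewrite (hF e).2.
have vbE := psa_vbundle E; have vbE' := psa_vbundle E'.
exists F; split.
- move=> p; exists (G p) => v.
    by rewrite -(extE vbE v) -[LHS]/(push G (push F (ext vbE v)) p) GF.
  by rewrite -(extE vbE' v) -[LHS]/(push F (push G (ext vbE' v)) p) FG.
- move=> e1 e2; apply: (split_ext ex' iso').
    by rewrite (hF _).1 (rho_star_mul ex) (rho_star_mul ex') !(hF _).1.
  move=> z; rewrite (hF _).2 (exact_star_formula iso) (exact_star_formula iso').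
  by rewrite !(hF _).1 !Fw ett.
- move=> p u; rewrite -(extE vbE u).
  by rewrite -[LHS]/(rho (push F (ext vbE u)) p) (hF _).1.
move=> p u v; rewrite -(extE vbE u) -(extE vbE v).
rewrite -[LHS]/(pairing (push F (ext vbE u)) (push F (ext vbE v)) p).
by rewrite (pairingE ex' iso') !(hF _).1 !Fw -(pairingE ex iso).
Qed.

(** A bilinear form, seen as a map from vector fields to 1-forms, may be added to a
    splitting, and symmetry keeps the result isotropic. *)
Lemma splitting_shift (E : exact_psa nabla) (sigma : bundle_map (tangent M) E)
    (h : cochain A 1) : isotropic_splitting sigma -> is_tilde_cochain h ->
  exists sigma' : bundle_map (tangent M) E, isotropic_splitting sigma' /\
    forall x y, splitting_diff (nabla := nabla) sigma sigma' [tuple x] y = h [tuple x] y.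
Proof.
move=> iso /tilde_cochain1P[hl hs].
have [d hd] := choice (fun z => rho_star_section (@exact_anchor_rho_star _ _ _ _ E) (hl z)).
have dl : clin d.
  move=> f x y; apply: pairing_inj => e.
  by rewrite pairing_clin !(hd _).1 ![h _ (rho e)]hs hl.
have sl : clin (fun x => push sigma x + d x).
  by move=> f x y; rewrite clin_push dl scalerDr addrACA.
have [sigma' hs'] := clin_bundle_map (tangent_vbundle M) sl.
have iso' : isotropic_splitting sigma'.
  apply: isotropic_splittingP => [x|x y]; rewrite !hs'.
    by rewrite rhoD (rho_splitting iso) (hd x).2 addr0.
  rewrite (clinfD (pairing_clin _)) !(clinfD (pairing_clinr _)).
  rewrite (pairing_splitting iso) (pairing_kernel (epsa_exact E) (hd x).2 (hd y).2).
  rewrite [pairing (push sigma x) _]pairing_skew !(hd _).1 !(rho_splitting iso).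
  by rewrite addr0 add0r hs addrC subrr.
exists sigma'; split=> // x y.
rewrite /splitting_diff hs' wformDl (wform_splitting iso) add0r /wform (hd _).1.
by rewrite (rho_splitting iso).
Qed.

Lemma splitting_cochain_cohomologous (E : exact_psa nabla)
    (sigma sigma' : bundle_map (tangent M) E) (phi psi : cochain A 2) :
  isotropic_splitting sigma -> isotropic_splitting sigma' ->
  splitting_cochain sigma phi -> splitting_cochain sigma' psi -> cohomologous phi psi.
Proof.
move=> iso iso' /(splitting_cochainP _ iso) hp /(splitting_cochainP _ iso') hq.
apply/cohomologousP; exists (splitting_diff sigma sigma'); split.
  exact: splitting_diff_tilde (epsa_exact E) iso iso'.
by move=> x y z; rewrite hp hq split_tensor_change.
Qed.

(** An isomorphism transports a splitting, keeping its tensor. Conversely, if the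
    tensors differ by a coboundary, a shift of one splitting makes them equal. *)
Lemma psa_iso_cohomologous (E E' : exact_psa nabla) (sigma : bundle_map (tangent M) E)
    (sigma' : bundle_map (tangent M) E') (phi psi : cochain A 2) :
  isotropic_splitting sigma -> isotropic_splitting sigma' ->
  splitting_cochain sigma phi -> splitting_cochain sigma' psi ->
  psa_iso E E' <-> cohomologous phi psi.
Proof.
move=> iso iso' sp sq; split.
  move=> [F [_ Fstar Fa Ff]].
  have Fl : clin (fun x => push F (push sigma x)).
    by move=> f x y; rewrite !clin_push.
  have [tau ht] := clin_bundle_map (tangent_vbundle M) Fl.
  have Fp e1 e2 : pairing (push F e1) (push F e2) = pairing e1 e2.
    by apply: cinf_eq => p; exact: Ff.
  have Fr e : rho (push F e) = rho e by apply: section_eq => p; exact: Fa.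
  have isot : isotropic_splitting tau.
    apply: isotropic_splittingP => [x|x y]; rewrite !ht.
      by rewrite Fr (rho_splitting iso).
    by rewrite Fp (pairing_splitting iso).
  apply: (splitting_cochain_cohomologous isot iso' _ sq).
  apply/(splitting_cochainP _ isot) => x y z.
  rewrite ((splitting_cochainP _ iso).1 sp) /split_tensor /wform !ht -Fstar.
  by rewrite Fp.
move=> c; have c' := cohomologous_sub c (cohomologous_refl phi).
have /cohomologousP[h [th eh]] := c'.
have [tau [isot ht]] := splitting_shift iso' th.
apply: (split_tensor_iso iso isot).
apply/funext => x; apply/funext => y; apply/funext => z.
have := split_tensor_change x y z iso' isot.
rewrite delta1E !ht -delta1E -eh.
rewrite ((splitting_cochainP _ iso).1 sp) ((splitting_cochainP _ iso').1 sq).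
by move/addIr => ->.
Qed.
End Isomorphisms.

(** * The bundle TM + T*M *)

Section DoubleBundle.
Context {R : realType} {n : nat} (M : manifold R n).
Implicit Types (p q : M) (x y z : vfield M) (c d : chart R M n).

Definition double_fib : lmodType R := ('rV[R]_n * @covector R n)%type.

Definition is_double_section (s : M -> double_fib) : Prop :=
  is_section (v := tangent M) (fun p => (s p).1) /\
  is_section (v := cotangent M) (fun p => (s p).2).

Fact is_double_section0 : is_double_section (fun=> 0).
Proof. by split; exact: is_section0. Qed.

Fact is_double_sectionP (f : cinf M) s t : is_double_section s -> is_double_section t ->
  is_double_section (fun p => f p *: s p + t p).
Proof. by move=> [s1 s2] [t1 t2]; split; apply: is_sectionP. Qed.

Definition double : vfamily M :=
  @VFamily R n M (fun=> double_fib) is_double_section is_double_section0 is_double_sectionP.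

Definition vpart (e : section double) : vfield M := Section_ (sectionP e).1.
Definition xpart (e : section double) : oneform M := Section_ (sectionP e).2.
Definition dpair x (xi : oneform M) : section double :=
  @Section_ R n M double (fun p => (x p, xi p)) (conj (sectionP x) (sectionP xi)).

Definition contract (xi : oneform M) x : cinf M := mk_cinf (sectionP xi x).

Lemma double_section_eq (e e' : section double) :
  vpart e = vpart e' -> (forall z, contract (xpart e) z = contract (xpart e') z) -> e = e'.
Proof.
move=> v w; apply: section_eq => p; apply: injective_projections.
  by rewrite -[LHS]/(vpart e p) v.
apply/lfunP => u; have vb := tangent_vbundle M.
have uE : ext vb (p := p) u p = u := extE vb (p := p) u.
by rewrite -uE; exact: cinf_congr p (w (ext vb (p := p) u)).
Qed.

Lemma vpart_clin : clin (W := tangent M) vpart.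
Proof. by move=> f s t; apply: section_eq => p; rewrite secD secZ /= scale1r addr0. Qed.

Lemma contract_lin xi : clinf (contract xi).
Proof.
move=> f x y; apply: cinf_eq => p.
by rewrite -[LHS]/(xi p ((f *: x + y) p)) secD secZ linearP.
Qed.

Lemma xpart_lin z : clinf (fun e => contract (xpart e) z).
Proof.
move=> f s t; apply: cinf_eq => p; rewrite -[LHS]/((xpart (f *: s + t)) p (z p)).
by rewrite /= scale1r addr0 !lfunE /= lfunE.
Qed.

Lemma tcoef_linear c i q : linear (tcoef c i q : 'rV[R]_n -> R^o).
Proof. by move=> a u v; rewrite tcoefP. Qed.
HB.instance Definition _ c i q :=
  GRing.isLinear.Build R 'rV[R]_n R^o _ (tcoef c i q) (tcoef_linear c i q).

(** The coframe dual to the coordinate vector fields of [c]. *)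
Definition dual c i q : @covector R n := linfun (tcoef c i q : {linear 'rV[R]_n -> R^o}).

Definition double_frame c : frame double :=
  @Frame R n M double (cdom c) (n + n) (fun k q =>
    match fintype.split k with
    | inl i => (dvec c i q, 0)
    | inr i => (0, dual c i q)
    end).

Definition double_coef c q (u : double_fib) (k : 'I_(n + n)) : R :=
  match fintype.split k with
  | inl i => tcoef c i q u.1
  | inr i => u.2 (dvec c i q)
  end.

Lemma double_frame_sum c q (a : 'I_(n + n) -> R) :
  \sum_k a k *: fvec (V := double) (f := double_frame c) k q =
  (\sum_i a (lshift n i) *: dvec c i q, \sum_i a (rshift n i) *: dual c i q).
Proof.
rewrite big_split_ord /=.
rewrite (eq_bigr (fun i => (a (lshift n i) *: dvec c i q, 0))); last first.
  by move=> i _; rewrite (fintype.unsplitK (inl i)) /= -[LHS]/(_, _) scaler0.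
rewrite [X in _ + X](eq_bigr (fun i => (0, a (rshift n i) *: dual c i q))); last first.
  by move=> i _; rewrite (fintype.unsplitK (inr i)) -[LHS]/(_, _) scaler0.
apply: injective_projections => /=.
  by rewrite (raddf_sum fst) [X in _ + X](raddf_sum fst) /= [X in _ + X]big1 ?addr0.
by rewrite (raddf_sum snd) [X in _ + X](raddf_sum snd) /= big1 ?add0r.
Qed.

Lemma dual_sum c q (a : 'I_n -> R) (v : 'rV[R]_n) :
  (\sum_i a i *: dual c i q) v = \sum_i a i * tcoef c i q v.
Proof. by rewrite sum_lfunE; apply: eq_bigr => i _; rewrite !lfunE /= lfunE. Qed.

Lemma double_expand c q (u : double_fib) : atlas c -> cdom c q ->
  u = \sum_k double_coef c q u k *: fvec (V := double) (f := double_frame c) k q.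
Proof.
move=> Ac cq; rewrite double_frame_sum /double_coef; apply: injective_projections => /=.
  rewrite [LHS](@dvec_expand _ _ _ c q) //; apply: eq_bigr => i _.
  by rewrite (fintype.unsplitK (inl i)).
apply/lfunP => v; rewrite dual_sum {1}(@dvec_expand _ _ _ c q v) // linear_sum /=.
by apply: eq_bigr => i _; rewrite (fintype.unsplitK (inr i)) linearZ /= [LHS]mulrC.
Qed.

Lemma double_coef_sum c q (a : 'I_(n + n) -> R) k : atlas c -> cdom c q ->
  double_coef c q (\sum_k a k *: fvec (V := double) (f := double_frame c) k q) k = a k.
Proof.
move=> Ac cq; rewrite double_frame_sum /double_coef -[in RHS](fintype.splitK k).
case: (fintype.split k) => i /=; first by rewrite tcoef_sum.
rewrite dual_sum (bigD1 i) //= tcoef_dvec // eqxx mulr1 big1 ?addr0 // => j ji.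
by rewrite tcoef_dvec // (negbTE ji) mulr0.
Qed.

Lemma smooth_tcoef_dvec c d i k : atlas c -> atlas d ->
  smooth_on (cdom c `&` cdom d) (fun q => tcoef d k q (dvec c i q)).
Proof.
move=> Ac Ad; have oI : open (cdom c `&` cdom d) by apply: openI; exact: cdom_open.
have sk : smooth_on (cdom c `&` cdom d) (fun q => d q 0 k).
  by apply: smooth_on_sub (smooth_coord k Ad); exact: subIsetr.
apply: (smooth_on_eq oI _ (@smooth_partial _ _ _ c _ _ i Ac oI _ sk)) => // q [cq dq].
by rewrite /tcoef (tderf_dvec i Ac cq (cdom_open d) dq) //; exact: smooth_coord.
Qed.

Lemma dvec_extend c i q : atlas c -> cdom c q ->
  exists (X : vfield M) (V : set M), [/\ open V, V q & forall q', V q' -> X q' = dvec c i q'].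
Proof.
move=> Ac cq.
have [chi [V [K [oV Vq cK [VK KU] [chi1 chi0]]]]] := bump (cdom_open c) cq.
have sec : is_section (v := tangent M) (fun q => chi q *: dvec c i q).
  move=> f; have oc := cdom_open c.
  have sf : smooth_on (cdom c) f by apply: smooth_on_sub (cinf_smooth f).
  rewrite (_ : (fun _ => _) = fun q => chi q * partial i (f \o cinv c) (c q)).
    exact: (smooth_cutoff oc cK KU chi0 (@smooth_partial _ _ _ c _ _ i Ac oc (@subset_refl _ _) sf)).
  apply/funext => q'; have := tderP q' (chi q') (dvec c i q') 0 f.
  have t0 : tder q' 0 f = 0 by rewrite /tder big1 // => k _; rewrite mxE mul0r.
  rewrite addr0 t0 addr0 => ->.
  have [cq'|ncq'] := pselect (cdom c q').
    by congr (_ * _); rewrite -(tderf_dvec i Ac cq' oc cq' sf).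
  by rewrite (_ : chi q' = 0) ?mul0r //; apply/chi0 => /KU.
by exists (Section_ sec), V; split=> // q' Vq' /=; rewrite chi1 // scale1r.
Qed.

Lemma smooth_double_coef (s : section double) c k : atlas c ->
  smooth_on (cdom c) (fun q => double_coef c q (s q) k).
Proof.
move=> Ac; rewrite /double_coef; case: (fintype.split k) => i.
  exact: (vfield_coef (x := vpart s)) Ac (sectionP (vpart s)).
apply: smooth_on_glue => q cq; have [X [V [oV Vq XV]]] := dvec_extend i Ac cq.
exists V, (contract (xpart s) X); split=> //.
  by apply: smooth_on_sub (cinf_smooth _).
by move=> q' Vq' /=; rewrite XV.
Qed.

(** Coordinate vector fields and their duals form local frames, and a pair is smooth
    exactly when its coordinates in them are. *)
Lemma double_vbundle : is_vbundle double.
Proof.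
exists (double_frame @` @atlas R n M); split; first split.
- by move=> _ [c _ <-]; exact: cdom_open.
- move=> p; have [c [Ac cp]] := atlas_cover p.
  by exists (double_frame c); split=> //; exists c.
- move=> _ [c Ac <-] p /= cp v; exists (\row_k double_coef c p v k); split.
    rewrite [LHS](@double_expand c p) //; apply: eq_bigr => k _.
    by rewrite mxE.
  by move=> a ->; apply/rowP => k; rewrite mxE double_coef_sum.
- move=> _ _ [c Ac <-] [d Ad <-] k.
  exists (fun l q => double_coef d q (fvec (V := double) (f := double_frame c) k q) l).
  split=> [l|q [cq dq]]; last by rewrite [LHS](@double_expand d q).
  rewrite /double_coef /=; case: (fintype.split k) => i; case: (fintype.split l) => j /=.
  + exact: smooth_tcoef_dvec.
  + rewrite (_ : (fun _ => _) = fun=> 0); first exact: smooth_on_cst.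
    by apply/funext => q; rewrite lfunE.
  + rewrite (_ : (fun _ => _) = fun=> 0); first exact: smooth_on_cst.
    by apply/funext => q; rewrite tcoef0.
  rewrite (_ : (fun _ => _) = fun q => tcoef c i q (dvec d j q)).
    by rewrite setIC; exact: smooth_tcoef_dvec.
  by apply/funext => q; rewrite lfunE.
move=> s; split=> [hs _ [c Ac <-]|hs].
  exists (fun k q => double_coef c q (s q) k); split=> [k|q /= cq].
    exact: (smooth_double_coef (Section_ hs)).
  by rewrite [LHS](@double_expand c q).
have sm c k : atlas c -> smooth_on (cdom c) (fun q => double_coef c q (s q) k).
  move=> Ac; have [a [sa ea]] := hs _ (ex_intro2 _ _ c Ac erefl).
  apply: (smooth_on_eq (cdom_open c) _ (sa k)) => q cq.
  by rewrite ea // double_coef_sum.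
split.
  apply: vfield_from_coef => c Ac i.
  apply: (smooth_on_eq (cdom_open c) _ (sm c (lshift n i) Ac)) => q cq.
  by rewrite /double_coef (fintype.unsplitK (inl i)).
move=> X; apply: smooth_on_glue => q _; have [c [Ac cq]] := atlas_cover q.
have oc := cdom_open c.
exists (cdom c), (fun q => \sum_i tcoef c i q (X q) * double_coef c q (s q) (rshift n i)).
split=> //.
  apply: smooth_on_sum => // i _; apply: (smooth_onM oc); last exact: sm.
  exact: (vfield_coef (x := X)) Ac (sectionP X).
move=> q' cq'; rewrite [X q' in LHS](@dvec_expand _ _ _ c q') // linear_sum.
by apply: eq_bigr => i _; rewrite linearZ /double_coef (fintype.unsplitK (inr i)).
Qed.
End DoubleBundle.

(** * Realization of cocycles *)

Section Model.
Context {R : realType} {n : nat} {M : manifold R n} {nabla : flat_connection M}.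
Implicit Types x y z : vfield M.
Variable a : vfield M -> vfield M -> vfield M -> cinf M.
Hypothesis a_skew : forall x y z, a x y z = - a y x z.
Hypothesis a_cyc : forall x y z, a x y z + a y z x + a z x y = 0.
Hypothesis a_lin2 : forall x z, clinf (fun y => a x y z).

Let a_lin1 := skew_cyclic_linear1 a_skew a_lin2.
Let a_lin3 := skew_cyclic_linear3 a_skew a_cyc a_lin2.

Definition double_form p (u v : double M p) : R := u.2 v.1 - v.2 u.1.

Lemma double_form_linear p c (u v w : double M p) :
  double_form (c *: u + v) w = c * double_form u w + double_form v w.
Proof.
by rewrite /double_form /= lfunE /= lfunE /= linearP /=
  -[c *: w.2 _]/(c * w.2 _) -[c *: u.2 _]/(c * u.2 _); ring.
Qed.

Lemma double_form_skew p (u v : double M p) : double_form u v = - double_form v u.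
Proof. by rewrite /double_form opprB. Qed.

Lemma double_form_nondegenerate p (u : double M p) :
  (forall v, double_form u v = 0) -> u = 0.
Proof.
move=> H; apply: injective_projections.
  apply/rowP => i; rewrite [RHS]mxE.
  have cl : linear (fun v : 'rV[R]_n => v 0 i : R^o) by move=> c v w; rewrite !mxE.
  pose co : {linear 'rV[R]_n -> R^o} := HB.pack (fun v : 'rV[R]_n => v 0 i : R^o)
    (GRing.isLinear.Build R 'rV[R]_n R^o _ _ cl).
  have coE (v : 'rV[R]_n) : (linfun co : covector) v = v 0 i by rewrite lfunE.
  have : u.2 0 - (linfun co : covector) u.1 = 0 := H ((0, linfun co) : double M p).
  rewrite linear0 sub0r coE.
  by move/eqP; rewrite oppr_eq0 => /eqP.
apply/lfunP => w; have := H ((w, 0) : double M p).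
by rewrite /double_form /= !lfunE /= subr0.
Qed.

Lemma double_form_smooth (s t : section (double M)) :
  smooth (fun p => double_form (s p) (t p)).
Proof. exact: (cinf_smooth (contract (xpart s) (vpart t) - contract (xpart t) (vpart s))). Qed.

Lemma double_anchor_smooth (s : section (double M)) :
  is_section (v := tangent M) (fun p => (fst : {linear double_fib -> 'rV[R]_n}) (s p)).
Proof. exact: (sectionP s).1. Qed.

Definition double_anchor : bundle_map (double M) (tangent M) :=
  @BundleMap R n M (double M) (tangent M)
    (fun p => (fst : {linear double_fib -> 'rV[R]_n})) double_anchor_smooth.

(** The derivatives of the factor [f] cancel, so the product formula does define a
    1-form. *)
Lemma star_form_lin x1 w1 x2 w2 : clinf w1 -> clinf w2 ->
  clinf (V := tangent M) (star_form (@lie _ _ M) nabla a x1 w1 x2 w2).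
Proof.
move=> l1 l2 f y z; rewrite /star_form a_lin2 l2 lieD lieM !lie_lin.
rewrite nablaD nabla_leibniz nablaDl nablaZl.
have -> : f *: nabla x1 y + lie x1 f *: y + nabla x1 z -
    (f *: nabla y x1 + nabla z x1) =
    f *: (nabla x1 y - nabla y x1) + (lie x1 f *: y + (nabla x1 z - nabla z x1)).
  by rewrite scalerBr opprD -!addrA; congr (_ + _); rewrite [RHS]addrCA; congr (_ + _);
     rewrite [RHS]addrCA.
rewrite nablaDl nablaZl !l2 l1.
by apply: cinf_eq => p; rewrite !(cinfD, cinfN, cinfM); ring.
Qed.

(** The product is defined by the formula that it must satisfy. *)
Lemma double_star_exists (e1 e2 : section (double M)) : exists e : section (double M),
  vpart e = nabla (vpart e1) (vpart e2) /\
  forall z, contract (xpart e) z = star_form (@lie _ _ M) nabla a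
    (vpart e1) (contract (xpart e1)) (vpart e2) (contract (xpart e2)) z.
Proof.
have [xi hxi] := clinf_oneform (star_form_lin (vpart e1) (vpart e2)
  (contract_lin (xpart e1)) (contract_lin (xpart e2))).
exists (dpair (nabla (vpart e1) (vpart e2)) xi); split; first exact: section_eq.
by move=> z; apply: cinf_eq => p; rewrite -hxi.
Qed.

Definition double_star e1 e2 := sval (cid (double_star_exists e1 e2)).
Lemma double_starP e1 e2 : vpart (double_star e1 e2) = nabla (vpart e1) (vpart e2) /\
  forall z, contract (xpart (double_star e1 e2)) z = star_form (@lie _ _ M) nabla a
    (vpart e1) (contract (xpart e1)) (vpart e2) (contract (xpart e2)) z.
Proof. exact: (svalP (cid (double_star_exists e1 e2))). Qed.

Lemma double_star_linearl c e e' e1 :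
  double_star (cstC M c *: e + e') e1 = cstC M c *: double_star e e1 + double_star e' e1.
Proof.
apply: double_section_eq.
  by rewrite vpart_clin !(double_starP _ _).1 vpart_clin nabla_linear.
move=> z; rewrite xpart_lin !(double_starP _ _).2 /star_form vpart_clin.
rewrite !xpart_lin a_lin1 !lie_lin contract_lin nabla_linear nablaD nabla_leibniz.
rewrite !lie_cst scale0r addr0.
rewrite !lieD !lieZ.
set w1 := contract (xpart e1); have wB v w : w1 (v - w) = w1 v - w1 w.
  exact: (clinfB (contract_lin _)).
have wL f v w : w1 (f *: v + w) = f * w1 v + w1 w by exact: contract_lin.
rewrite !wB !wL.
by apply: cinf_eq => p; rewrite !(cinfD, cinfN, cinfM); ring.
Qed.

Lemma double_star_linearr c e e' e1 :
  double_star e1 (cstC M c *: e + e') = cstC M c *: double_star e1 e + double_star e1 e'.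
Proof.
apply: double_section_eq.
  rewrite vpart_clin !(double_starP _ _).1 vpart_clin nablaD nabla_leibniz.
  by rewrite lie_cst scale0r addr0.
move=> z; rewrite xpart_lin !(double_starP _ _).2 /star_form vpart_clin.
rewrite !xpart_lin a_lin3 nablaD nabla_leibniz lie_cst scale0r addr0 !contract_lin.
rewrite !lieD !lieZ.
by apply: cinf_eq => p; rewrite !(cinfD, cinfN, cinfM); ring.
Qed.

Definition double_psa : psa_data M :=
  @PsaData R n M (double M) (double_vbundle M) double_form double_form_linear
    double_form_skew double_form_nondegenerate double_form_smooth double_anchor
    double_star double_star_linearl double_star_linearr.

Lemma rho_double (e : section double_psa) : rho e = vpart e.
Proof. exact: section_eq. Qed.

Lemma double_rho_star p (xi : covector) : rho_star double_psa p xi = (0, xi).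
Proof.
apply: form_inj => w; rewrite form_rho_star.
by rewrite -[RHS]/(double_form _ _) /double_form /= linear0 subr0.
Qed.

Lemma double_exact : is_exact double_psa nabla.
Proof.
split.
- by move=> p xi eta; rewrite !double_rho_star => -[].
- move=> p [v xi]; split=> [/= v0|[eta]]; last by rewrite double_rho_star => -[<-].
  by exists xi; rewrite double_rho_star -v0.
- by move=> p v; exists ((v, 0) : double M p).
- by move=> e1 e2; rewrite !rho_double; exact: (double_starP e1 e2).1.
Qed.

Lemma double_splitting_clin : clin (W := double_psa) (fun x => dpair x 0).
Proof.
move=> f x y; apply: section_eq => p; rewrite secD secZ; apply: injective_projections => /=.
  by rewrite scale1r addr0.
by rewrite scaler0 addr0.
Qed.

(** The splitting is the inclusion of the first summand. *)
Lemma double_splitting : exists sigma : bundle_map (tangent M) double_psa,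
  isotropic_splitting sigma /\ star_formula (nabla := nabla) sigma a.
Proof.
have [sigma hs] := clin_bundle_map (tangent_vbundle M) double_splitting_clin.
have wE (e : section double_psa) z : wform sigma e z = contract (xpart e) z.
  rewrite /wform hs; apply: cinf_eq => p.
  rewrite -[LHS]/(double_form _ _) /double_form /= lfunE /= subr0.
  by [].
exists sigma; split.
  apply: isotropic_splittingP => [x|x y]; rewrite !hs; first exact: section_eq.
  by apply: cinf_eq => p; rewrite -[LHS]/(double_form _ _) /double_form /= !lfunE /= subr0.
move=> e1 e2 z; have we (e : section double_psa) : wform sigma e = contract (xpart e).
  by apply/funext => y; exact: wE.
by rewrite wE !we !rho_double; exact: (double_starP e1 e2).2.
Qed.
End Model.

Section Realization.
Context {R : realType} {n : nat} {M : manifold R n} {nabla : flat_connection M}.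

(** The product formula holds in [TM + T*M] by construction, and closedness gives
    the associator axiom. *)
Lemma cocycle_realized (tphi : cochain (lsa_tangent nabla) 2) : tilde_cocycle tphi ->
  exists (E : exact_psa nabla) (sigma : bundle_map (tangent M) E),
    isotropic_splitting sigma /\ splitting_cochain sigma tphi.
Proof.
move=> /tilde_cocycle2P[/tilde_cochain2P[l2 sk cy] cl].
pose a := fun x y z : vfield M => tphi [tuple x; y] z.
have ex := double_exact (nabla := nabla) (a := a) sk cy l2.
have [sigma [iso sf]] := double_splitting (nabla := nabla) (a := a) sk cy l2.
have ps := (presymplectic_coboundary3 ex iso sf sk cy l2).2 cl.
exists (ExactPsa ps ex), sigma; split=> //.
apply/(@splitting_cochainP _ _ _ _ (ExactPsa ps ex) sigma tphi iso) => x y z.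
by rewrite (split_tensor_star_formula iso sf).
Qed.
End Realization.

(** * The classification *)

Theorem theorem4p3 (R : realType) (n : nat) (M : manifold R n)
    (nabla : flat_connection M) :
  (* every E has an isotropic splitting *)
  (forall E : exact_psa nabla, exists sigma : bundle_map (tangent M) E,
     isotropic_splitting sigma) /\
  (* the cochain of an isotropic splitting is well defined and is a cocycle *)
  (forall (E : exact_psa nabla) (sigma : bundle_map (tangent M) E),
     isotropic_splitting sigma ->
     (exists! tphi, splitting_cochain sigma tphi) /\
     (forall tphi, splitting_cochain sigma tphi -> tilde_cocycle tphi)) /\
  (* its class does not depend on the splitting *)
  (forall (E : exact_psa nabla) (sigma sigma' : bundle_map (tangent M) E)
     (tphi tphi' : cochain (lsa_tangent nabla) 2),
     isotropic_splitting sigma -> isotropic_splitting sigma' ->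
     splitting_cochain sigma tphi -> splitting_cochain sigma' tphi' ->
     tilde_class tphi = tilde_class tphi') /\
  (* and induces a bijection from isomorphism classes onto the cohomology *)
  (exists G : iso_class nabla -> set (cochain (lsa_tangent nabla) 2),
     (forall (E : exact_psa nabla) (sigma : bundle_map (tangent M) E)
        (tphi : cochain (lsa_tangent nabla) 2),
        isotropic_splitting sigma -> splitting_cochain sigma tphi ->
        G (iso_class_of E) = tilde_class tphi) /\
     (forall c, tilde_H3 (lsa_tangent nabla) (G c)) /\
     (forall c c', G c = G c' -> c = c') /\
     (forall h, tilde_H3 (lsa_tangent nabla) h -> exists c, G c = h)).
Proof.
have indep (E : exact_psa nabla) (sigma sigma' : bundle_map (tangent M) E)
    (tphi tphi' : cochain (lsa_tangent nabla) 2) :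
    isotropic_splitting sigma -> isotropic_splitting sigma' ->
    splitting_cochain sigma tphi -> splitting_cochain sigma' tphi' ->
    tilde_class tphi = tilde_class tphi'.
  move=> iso iso' sp sp'; apply/(tilde_class_eq _ (splitting_cocycle iso sp)).
  exact: splitting_cochain_cohomologous iso' iso sp' sp.
split; first exact: exact_splitting.
split=> [E sigma iso|].
  split; first exact: splitting_cochain_unique.
  by move=> tphi; exact: splitting_cocycle.
split; first exact: indep.
have cls_ex (E : exact_psa nabla) : exists k : set (cochain (lsa_tangent nabla) 2),
    exists (sigma : bundle_map (tangent M) E) tphi,
    [/\ isotropic_splitting sigma, splitting_cochain sigma tphi & k = tilde_class tphi].
  have [sigma iso] := exact_splitting E.
  have [tphi [sp _]] := splitting_cochain_unique iso.
  by exists (tilde_class tphi), sigma, tphi.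
pose cls (E : exact_psa nabla) := sval (cid (cls_ex E)).
have clsP (E : exact_psa nabla) : exists (sigma : bundle_map (tangent M) E) tphi,
    [/\ isotropic_splitting sigma, splitting_cochain sigma tphi &
        cls E = tilde_class tphi] := svalP (cid (cls_ex E)).
have isoE (E E' : exact_psa nabla) : psa_iso E E' <-> cls E = cls E'.
  have [sigma [phi [iso sp ->]]] := clsP E; have [sigma' [psi [iso' sp' ->]]] := clsP E'.
  split.
    move/(psa_iso_cohomologous iso iso' sp sp') => c; apply/esym.
    by apply/(tilde_class_eq _ (splitting_cocycle iso' sp')).
  move=> e; apply/(psa_iso_cohomologous iso iso' sp sp').
  by apply/(tilde_class_eq _ (splitting_cocycle iso' sp')).
have repr (c : iso_class nabla) : exists E, iso_class_mem c = psa_iso E := iso_classP c.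
pose rep c := sval (cid (repr c)).
have repE c : iso_class_mem c = psa_iso (rep c) := svalP (cid (repr c)).
have class_ext (c c' : iso_class nabla) : iso_class_mem c = iso_class_mem c' -> c = c'.
  case: c c' => [m hm] [m' hm'] /= e; subst m'; congr IsoClass.
  exact: Prop_irrelevance.
have cls_rep (E : exact_psa nabla) : cls (rep (iso_class_of E)) = cls E.
  by apply/isoE; rewrite -repE; apply/isoE.
exists (fun c => cls (rep c)); split=> [E sigma tphi iso sp|].
  rewrite cls_rep; have [sigma' [psi [iso' sp' ->]]] := clsP E.
  exact: indep iso' iso sp' sp.
split=> [c|].
  have [sigma [phi [iso sp ->]]] := clsP (rep c).
  by exists phi => //; exact: splitting_cocycle iso sp.
split=> [c c' e|h [tphi ctphi <-]].
  apply: class_ext; rewrite !repE; apply/funext => E; apply/propext.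
  by rewrite !isoE e.
have [E [sigma [iso sp]]] := cocycle_realized ctphi.
exists (iso_class_of E); rewrite cls_rep; have [sigma' [psi [iso' sp' ->]]] := clsP E.
exact: indep iso' iso sp' sp.
Qed.
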